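(* Let $a,b,\alpha>0$ and $\xi\in(0,1)$, and let $\mathcal H$, $\mathcal A$ and $D(\mathcal A)$ be the energy space, operator and domain defined in the context. Consider the evolution equation $U_t=\mathcal A U$, $U(0)=U_0$. (1) If $U_0\in D(\mathcal A)$, then the evolution equation has a unique strong solution $U\in C^0(\mathbb R_+,D(\mathcal A))\cap C^1(\mathbb R_+,\mathcal H)$. (2) If $U_0\in\mathcal H$, then the evolution equation has a unique weak solution $U\in C^0(\mathbb R_+,\mathcal H)$.
   Context: Let $a,b,\alpha>0$ be constants and $\xi\in(0,1)$. The energy space is $\mathcal H=[H^2(0,1)\cap H^1_0(0,1)]\times L^2(0,1)$ with inner product $(U_1,U_2)_{\mathcal H}=\int_0^1(a\,u_{1,xx}\overline{u_{2,xx}}+v_1\overline{v_2})\,dx$ for $U_i=(u_i,v_i)$. The domain $D(\mathcal A)$ is the set of $(u,v)\in[H^4(0,\xi)\cap H^4(\xi,1)\cap H^2(0,1)]\times H^2(0,1)$ such that $u(0)=v(0)=u(1)=v(1)=0$, $u_{xx}(0)=u_{xx}(1)=0$, $u_{xx}(\xi^-)=u_{xx}(\xi^+)$ and $u_{xxx}(\xi^+)-u_{xxx}(\xi^-)=-\frac{\alpha}{a}v(\xi)$. The operator is $\mathcal A(u,v)=(v,\,-a\,u_{xxxx}-b\,v-\alpha v(\xi)\delta_\xi)$, where $\delta_\xi$ is the Dirac mass at $\xi$ and derivatives are taken in the sense of distributions on $(0,1)$ (the domain condition on the jump of $u_{xxx}$ makes the second component an $L^2(0,1)$ function). The evolution equation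 (with $U=(u,u_t)$) is the abstract form of the damped beam problem $u_{tt}+a u_{xxxx}+b u_t+\alpha u_t(\xi,t)\delta_\xi=0$ on $(0,1)\times(0,\infty)$, $u=u_{xx}=0$ at $x=0,1$. *)

(* Defs.v *)
From HB Require Import structures.
From mathcomp Require Import all_boot all_order all_algebra.
From mathcomp Require Import all_classical all_reals all_analysis.
From mathcomp Require Import complex.

Set Implicit Arguments.
Unset Strict Implicit.
Unset Printing Implicit Defensive.

Import Order.TTheory GRing.Theory Num.Theory.
Import numFieldNormedType.Exports.

Local Open Scope classical_set_scope.
Local Open Scope ring_scope.
Local Open Scope complex_scope.

(* Elements of the function spaces below are represented by total functions
   R -> R[i]; only their values almost everywhere on the interval at hand
   matter.  All intervals ]p, q[ are bounded with p < q. *)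

Definition integralC {R : realType} (D : set R) (f : R -> R[i]) : R[i] :=
  (\int[lebesgue_measure]_(x in D) complex.Re (f x))
    +i* (\int[lebesgue_measure]_(x in D) complex.Im (f x)).

Definition L2 {R : realType} (p q : R) (f : R -> R[i]) : Prop :=
  [/\ measurable_fun `]p, q[ (fun x => complex.Re (f x)),
      measurable_fun `]p, q[ (fun x => complex.Im (f x)) &
      lebesgue_measure.-integrable `]p, q[
        (fun x => (complex.Re (f x) ^+ 2 + complex.Im (f x) ^+ 2)%:E)].

Definition eq_ae {R : realType} (p q : R) (f g : R -> R[i]) : Prop :=
  {ae lebesgue_measure, forall x, `]p, q[%classic x -> f x = g x}.

(* Real-valued test functions suffice: a complex distribution is determined by
   its values on them. *)
Definition test_function {R : realType} (p q : R) (phi : R -> R) : Prop :=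
  (forall n x, derivable (derive1n n phi) x 1) /\
  (exists c d, [/\ p < c, c <= d, d < q &
                   forall x, x \notin `[c, d] -> phi x = 0]).

Definition distribution (R : realType) : Type := (R -> R) -> R[i].

Definition dist_fun {R : realType} (p q : R) (f : R -> R[i]) : distribution R :=
  fun phi => integralC `]p, q[ (fun x => f x * (phi x)%:C).

Definition dist_deriv {R : realType} (n : nat) (T : distribution R) :
    distribution R :=
  fun phi => (-1) ^+ n * T (derive1n n phi).

Definition dist_dirac {R : realType} (x : R) : distribution R :=
  fun phi => (phi x)%:C.

Definition eq_dist {R : realType} (p q : R) (S T : distribution R) : Prop :=
  forall phi, test_function p q phi -> S phi = T phi.

Definition is_weak_deriv {R : realType} (p q : R) (n : nat)
    (f g : R -> R[i]) : Prop :=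
  L2 p q g /\ eq_dist p q (dist_deriv n (dist_fun p q f)) (dist_fun p q g).

(* H^k(p, q) *)
Definition sobolev {R : realType} (k : nat) (p q : R) (f : R -> R[i]) : Prop :=
  L2 p q f /\ forall n, (n <= k)%N -> exists g, is_weak_deriv p q n f g.

(* A choice of the n-th weak derivative on ]p, q[ (unique almost everywhere);
   0 when there is none in L^2(p, q). *)
Definition weak_deriv {R : realType} (p q : R) (n : nat) (f : R -> R[i]) :
    R -> R[i] :=
  xget (fun=> 0) [set g | is_weak_deriv p q n f g].

(* Pointwise values up to the boundary: [cont_rep p q f] is the representative
   of f that is continuous on the closed interval [p, q].  It exists for f in
   H^1(p, q), and its values on [p, q] are then uniquely determined; those at
   p and q are the one-sided limits f(p^+) and f(q^-). *)
Definition cont_rep {R : realType} (p q : R) (f : R -> R[i]) : R -> R[i] :=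
  xget (fun=> 0) [set g | [/\ {within `[p, q], continuous (fun x => complex.Re (g x))},
                              {within `[p, q], continuous (fun x => complex.Im (g x))} &
                              eq_ae p q g f]].

Definition norm_H1 {R : realType} (p q : R) (f : R -> R[i]) : R :=
  Num.sqrt (complex.Re (integralC `]p, q[ (fun x =>
    f x * conjc (f x) + weak_deriv p q 1 f x * conjc (weak_deriv p q 1 f x)))).

(* H^1_0(p, q): the closure of the complex-valued test functions in H^1(p, q). *)
Definition sobolev10 {R : realType} (p q : R) (f : R -> R[i]) : Prop :=
  sobolev 1 p q f /\
  forall e : R, 0 < e -> exists phi psi : R -> R,
    [/\ test_function p q phi, test_function p q psi &
        norm_H1 p q (fun x => f x - (phi x +i* psi x)) < e].

Notation state R := ((R -> R[i]) * (R -> R[i]))%type.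

Definition in_H {R : realType} (U : state R) : Prop :=
  [/\ sobolev 2 0 1 U.1, sobolev10 0 1 U.1 & L2 0 1 U.2].

Definition eq_H {R : realType} (U V : state R) : Prop :=
  eq_ae 0 1 U.1 V.1 /\ eq_ae 0 1 U.2 V.2.

Definition inner_H {R : realType} (a : R) (U V : state R) : R[i] :=
  integralC `]0, 1[ (fun x =>
    a%:C * weak_deriv 0 1 2 U.1 x * conjc (weak_deriv 0 1 2 V.1 x)
    + U.2 x * conjc (V.2 x)).

Definition norm_H {R : realType} (a : R) (U : state R) : R :=
  Num.sqrt (complex.Re (inner_H a U U)).

Definition dom_A {R : realType} (a alpha xi : R) (U : state R) : Prop :=
  let u := U.1 in
  let v := cont_rep 0 1 U.2 in
  let uxx_l := cont_rep 0 xi (weak_deriv 0 xi 2 u) in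
  let uxx_r := cont_rep xi 1 (weak_deriv xi 1 2 u) in
  let uxxx_l := cont_rep 0 xi (weak_deriv 0 xi 3 u) in
  let uxxx_r := cont_rep xi 1 (weak_deriv xi 1 3 u) in
  [/\ [/\ sobolev 4 0 xi u, sobolev 4 xi 1 u, sobolev 2 0 1 u &
          sobolev 2 0 1 U.2],
      [/\ cont_rep 0 1 u 0 = 0, v 0 = 0, cont_rep 0 1 u 1 = 0 & v 1 = 0],
      uxx_l 0 = 0 /\ uxx_r 1 = 0,
      uxx_l xi = uxx_r xi &
      uxxx_r xi - uxxx_l xi = - (alpha / a)%:C * v xi].

(* - a u_xxxx - b v - alpha v(xi) delta_xi, as a distribution on ]0, 1[ *)
Definition A_dist {R : realType} (a b alpha xi : R) (U : state R) :
    distribution R :=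
  fun phi => - (a%:C * dist_deriv 4 (dist_fun 0 1 U.1) phi)
             - b%:C * dist_fun 0 1 U.2 phi
             - alpha%:C * cont_rep 0 1 U.2 xi * dist_dirac xi phi.

(* The second component is the L^2(0, 1) function that represents [A_dist]. *)
Definition opA {R : realType} (a b alpha xi : R) (U : state R) : state R :=
  (U.2, xget (fun=> 0) [set w | L2 0 1 w /\
          eq_dist 0 1 (A_dist a b alpha xi U) (dist_fun 0 1 w)]).

Definition graph_norm {R : realType} (a b alpha xi : R) (U : state R) : R :=
  norm_H a U + norm_H a (opA a b alpha xi U).

(* Curves U : R -> state R are only considered on R_+ = [0, +oo[. *)
Definition continuous_curve {R : realType} (N : state R -> R)
    (U : R -> state R) : Prop :=
  forall t, 0 <= t ->
    N (U s - U t) @[s --> within [set s | 0 <= s] (nbhs t)] --> (0 : R).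

Definition difference_quotient {R : realType} (U : R -> state R) (t s : R) :
    state R :=
  (fun x => ((s - t)^-1)%:C * ((U s).1 x - (U t).1 x),
   fun x => ((s - t)^-1)%:C * ((U s).2 x - (U t).2 x)).

Definition derivative_curve {R : realType} (N : state R -> R)
    (U dU : R -> state R) : Prop :=
  forall t, 0 <= t ->
    N (difference_quotient U t s - dU t)
      @[s --> within [set s | 0 <= s] (dnbhs t)] --> (0 : R).

Definition strong_solution {R : realType} (a b alpha xi : R) (U0 : state R)
    (U : R -> state R) : Prop :=
  [/\ forall t, 0 <= t -> dom_A a alpha xi (U t),
      continuous_curve (graph_norm a b alpha xi) U,
      exists dU : R -> state R,
        [/\ forall t, 0 <= t -> in_H (dU t),
            continuous_curve (norm_H a) dU,
            derivative_curve (norm_H a) U dU &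
            forall t, 0 <= t -> eq_H (dU t) (opA a b alpha xi (U t))] &
      eq_H (U 0) U0].

(* W = A^* V, the adjoint being taken in H *)
Definition adjoint_A {R : realType} (a b alpha xi : R) (V W : state R) : Prop :=
  [/\ in_H V, in_H W &
      forall Y, dom_A a alpha xi Y ->
        inner_H a (opA a b alpha xi Y) V = inner_H a Y W].

(* Weak solutions in the usual semigroup-theoretic sense (Ball, 1977): for each
   V in D(A^* ), t |-> (U(t), V) is absolutely continuous with derivative
   (U(t), A^* V), here in integrated form. *)
Definition weak_solution {R : realType} (a b alpha xi : R) (U0 : state R)
    (U : R -> state R) : Prop :=
  [/\ forall t, 0 <= t -> in_H (U t),
      continuous_curve (norm_H a) U,
      forall V W, adjoint_A a b alpha xi V W -> forall t, 0 <= t ->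
        inner_H a (U t) V
        = inner_H a U0 V + integralC `]0, t[ (fun s => inner_H a (U s) W) &
      eq_H (U 0) U0].

(* Main.v *)
(* The coordinates [(p, v) = (u_xx, v)] identify the energy space with a space of
   pairs of square integrable functions, with an equivalent inner product.  In
   them the operator A has the bounded inverse T of [beam_inv], built from the Green
   operator of the second derivative with Dirichlet conditions; T is dissipative,
   injective, and has dense range because its adjoint is conjugate to it by
   [(p, v) -> (p, - v)].  Curves with [d/dt (T Z) = Z] exist for each [Z(0)], as
   limits of backward Euler iterates, and are unique, since |T Z|^2 is
   nonincreasing.  Weak solutions are exactly these curves, and strong solutions
   are the curves T Z. *)

From HB Require Import structures.
Require Import Defs.
From mathcomp Require Import all_boot all_order all_algebra.
From mathcomp Require Import all_classical all_reals all_analysis.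
From mathcomp Require Import complex.
From mathcomp Require Import ring lra measurable_realfun.

Set Implicit Arguments.
Unset Strict Implicit.
Unset Printing Implicit Defensive.

Import Order.TTheory GRing.Theory Num.Theory.
Import numFieldNormedType.Exports.

Local Open Scope classical_set_scope.
Local Open Scope ring_scope.

(** * Hilbert spaces *)

Section InnerProduct.
Context {R : realType} {X : lmodType R} (ip : X -> X -> R).
Implicit Types (e k : R).

(** The obstacle is that the domain of the generator combines pointwise conditions at 0, 1 and [xi]
    with functions that are known only almost everywhere. The Green operator removes it: a function
    in H^2 with zero boundary values is the Green transform of its second derivative, and the Dirac
    mass is replaced by [kern xi], the square integrable function whose second derivative is that
    mass. The jump condition then merely fixes the coefficient of [kern xi] in [u_xx]. Dissipativity
    is the identity [<T x, x> = - b |v|^2 - alpha v(xi)^2], with [v] the Green transform of the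
    first component of [x]. The Euler steps are halved dyadically, because on the range of [T^2] one
    step of size [h] and two steps of size [h / 2] differ by a multiple of [h^2]; summed over a
    bounded time this makes the iterates Cauchy, uniformly in time. Density of that range and
    contractivity extend the convergence to all initial data. *)

Record hilbert : Prop := Hilbert {
  ipC : forall x y, ip x y = ip y x;
  ipDl : forall x y z, ip (x + y) z = ip x z + ip y z;
  ipZl : forall k x y, ip (k *: x) y = k * ip x y;
  ip_ge0 : forall x, 0 <= ip x x;
  ip_eq0 : forall x, ip x x = 0 -> x = 0;
  ip_complete : forall u : nat -> X,
    (forall e, 0 < e -> exists N, forall m n, (N <= m)%N -> (N <= n)%N ->
       ip (u m - u n) (u m - u n) <= e) ->
    exists l, forall e, 0 < e -> exists N, forall n, (N <= n)%N ->
       ip (u n - l) (u n - l) <= e }.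

Definition nrm x := Num.sqrt (ip x x).

Hypothesis H : hilbert.

Lemma ipDr x y z : ip x (y + z) = ip x y + ip x z.
Proof. by rewrite (ipC H) (ipDl H) !(ipC H x). Qed.

Lemma ipZr k x y : ip x (k *: y) = k * ip x y.
Proof. by rewrite (ipC H) (ipZl H) (ipC H x). Qed.

Lemma ipNl x y : ip (- x) y = - ip x y.
Proof. by rewrite -scaleN1r (ipZl H) mulN1r. Qed.

Lemma ipNr x y : ip x (- y) = - ip x y.
Proof. by rewrite -scaleN1r ipZr mulN1r. Qed.

Lemma ipBl x y z : ip (x - y) z = ip x z - ip y z.
Proof. by rewrite (ipDl H) ipNl. Qed.

Lemma ipBr x y z : ip x (y - z) = ip x y - ip x z.
Proof. by rewrite ipDr ipNr. Qed.

Lemma ip0l y : ip 0 y = 0.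
Proof. by rewrite -(scale0r (0 : X)) (ipZl H) mul0r. Qed.

Lemma ip0r y : ip y 0 = 0.
Proof. by rewrite (ipC H) ip0l. Qed.

Lemma nrm_ge0 x : 0 <= nrm x.
Proof. exact: sqrtr_ge0. Qed.

Lemma nrm_sqr x : nrm x ^+ 2 = ip x x.
Proof. by rewrite sqr_sqrtr // (ip_ge0 H). Qed.

Lemma nrm0 : nrm 0 = 0.
Proof. by rewrite /nrm ip0l sqrtr0. Qed.

Lemma nrm_eq0 x : nrm x = 0 -> x = 0.
Proof. by move=> x0; apply: (ip_eq0 H); rewrite -nrm_sqr x0 expr0n. Qed.

Lemma nrmZ k x : nrm (k *: x) = `|k| * nrm x.
Proof.
rewrite /nrm (ipZl H) ipZr mulrA -expr2 sqrtrM ?sqr_ge0 //.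
by rewrite sqrtr_sqr.
Qed.

Lemma nrmN x : nrm (- x) = nrm x.
Proof. by rewrite -scaleN1r nrmZ normrN1 mul1r. Qed.

Lemma nrmC x y : nrm (x - y) = nrm (y - x).
Proof. by rewrite -nrmN opprB. Qed.

Lemma cauchy_schwarz_sqr x y : ip x y ^+ 2 <= ip x x * ip y y.
Proof.
have [yy0|yy0] := eqVneq (ip y y) 0.
  by rewrite (ip_eq0 H yy0) !ip0r mulr0 expr0n.
have yy_gt0 : 0 < ip y y by rewrite lt_def yy0 (ip_ge0 H).
have := ip_ge0 H (x - (ip x y / ip y y) *: y).
rewrite ipBl !ipBr !(ipZl H) !ipZr (ipC H y x).
have -> : ip x x - ip x y / ip y y * ip x y -
    (ip x y / ip y y * ip x y - ip x y / ip y y * (ip x y / ip y y * ip y y)) =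
    ip x x - ip x y ^+ 2 / ip y y by field.
by rewrite subr_ge0 ler_pdivrMr.
Qed.

Lemma cauchy_schwarz x y : `|ip x y| <= nrm x * nrm y.
Proof.
rewrite -sqrtr_sqr /nrm -sqrtrM ?(ip_ge0 H) //.
exact/ler_wsqrtr/cauchy_schwarz_sqr.
Qed.

Lemma ip_le_nrm x y : ip x y <= nrm x * nrm y.
Proof. exact: le_trans (ler_norm _) (cauchy_schwarz x y). Qed.

Lemma nrmD x y : nrm (x + y) <= nrm x + nrm y.
Proof.
rewrite -(@ler_pXn2r _ 2) ?nnegrE ?addr_ge0 ?nrm_ge0 //.
rewrite nrm_sqr (ipDl H) !ipDr (ipC H y x) sqrrD !nrm_sqr.
have := ip_le_nrm x y; lra.
Qed.

Lemma nrmB x y : nrm (x - y) <= nrm x + nrm y.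
Proof. by rewrite (le_trans (nrmD _ _)) // nrmN. Qed.

Lemma nrm_tri y x z : nrm (x - z) <= nrm (x - y) + nrm (y - z).
Proof. by rewrite (le_trans _ (nrmD _ _)) // addrA subrK. Qed.

Lemma nrm_le_sqr x e : 0 <= e -> ip x x <= e ^+ 2 -> nrm x <= e.
Proof.
by move=> e0 xe; rewrite /nrm -[leRHS]ger0_norm // -sqrtr_sqr ler_wsqrtr.
Qed.

Lemma hilbert_complete (u : nat -> X) :
  (forall e, 0 < e -> exists N, forall m n, (N <= m)%N -> (N <= n)%N ->
     nrm (u m - u n) <= e) ->
  exists l, forall e, 0 < e -> exists N, forall n, (N <= n)%N ->
     nrm (u n - l) <= e.
Proof.
move=> cu; have [|l ul] := @ip_complete H u.
  move=> e e0; have [|N uN] := cu (Num.sqrt e); first by rewrite sqrtr_gt0.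
  exists N => m n Nm Nn; rewrite -nrm_sqr -(sqr_sqrtr (ltW e0)).
  by rewrite ler_pXn2r ?nnegrE ?nrm_ge0 ?sqrtr_ge0 // uN.
exists l => e e0; have [|N uN] := ul (e ^+ 2); first by rewrite exprn_gt0.
by exists N => n Nn; apply: nrm_le_sqr (uN _ Nn); exact: ltW.
Qed.

Lemma nrm_le_eps x : (forall e, 0 < e -> nrm x <= e) -> x = 0.
Proof.
move=> xe; apply: nrm_eq0; apply/eqP; rewrite eq_le nrm_ge0 andbT.
by apply/ler_addgt0Pr => e e0; rewrite add0r xe.
Qed.

Lemma ip_inj x y : (forall z, ip x z = ip y z) -> x = y.
Proof.
move=> xy; apply/eqP; rewrite -subr_eq0; apply/eqP/(ip_eq0 H).
by rewrite ipBl xy subrr.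
Qed.

(* Decides equalities of linear combinations, by pairing both sides with an
   arbitrary vector. *)
Local Ltac lmod :=
  apply: ip_inj => ?; rewrite ?(ipBl, ipNl, ipDl H, ipZl H, ip0l); ring.

Lemma near_harmonic e : 0 < e -> exists N, forall n, (N <= n)%N -> n.+1%:R^-1 <= e.
Proof.
move=> e0; exists (Num.truncn e^-1) => n Nn.
have e1 : e^-1 < n.+1%:R.
  by rewrite (lt_le_trans (truncnS_gt _)) // ler_nat ltnS.
by rewrite invf_ple ?posrE // ltW.
Qed.

(** Projection onto the closure of [M] without introducing that closure: a minimizing sequence in
    [M] converges to some [z], the vector [x - z] is orthogonal to [M], so it vanishes and [x]
    itself is the limit. *)
Lemma dense_of_orthogonal (M : X -> Prop) :
  M 0 -> (forall x y, M x -> M y -> M (x + y)) ->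
  (forall k x, M x -> M (k *: x)) ->
  (forall z, (forall m, M m -> ip z m = 0) -> z = 0) ->
  forall x e, 0 < e -> exists2 m, M m & nrm (x - m) <= e.
Proof.
move=> M0 MD MZ Mo x e e0.
pose S := [set ip (x - m) (x - m) | m in [set m | M m]].
have S_inf : has_inf S.
  split; first by exists (ip (x - 0) (x - 0)), 0.
  by exists 0 => _ [m _ <-]; exact: (ip_ge0 H).
set d := inf S.
have dS m : M m -> d <= ip (x - m) (x - m).
  by move=> Mm; apply: ge_inf; [exact: S_inf.2|exists m].
have /choice[m Mm] : forall n : nat, exists m, M m /\
    ip (x - m) (x - m) <= d + n.+1%:R^-1.
  move=> n; have n0 : (0 : R) < n.+1%:R^-1 by rewrite invr_gt0.
  have [_ [m Mm <-] dm] := inf_adherent n0 S_inf.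
  by exists m; split=> //; exact: ltW.
have Mm1 n := (Mm n).1; have Mm2 n := (Mm n).2.
(* Parallelogram law: the midpoint of [m i] and [m j] belongs to [M], hence its squared distance to
   [x] is at least [d]. *)
have dist_m i j : ip (m i - m j) (m i - m j) <=
    2 * (i.+1%:R^-1 + j.+1%:R^-1).
  have Mij : M ((2^-1 : R) *: (m i + m j)) by apply: MZ; apply: MD.
  have := dS _ Mij; have := Mm2 i; have := Mm2 j.
  rewrite !ipBl !ipBr !(ipZl H) !ipZr !(ipDl H) !ipDr.
  rewrite (ipC H (m i) x) (ipC H (m j) x) (ipC H (m j) (m i)).
  move: (i.+1%:R^-1) (j.+1%:R^-1) => hi hj; lra.
have [|z mz] := @hilbert_complete m.
  move=> r r0; have [N hN] := near_harmonic (divr_gt0 (exprn_gt0 2 r0) (ltr0n R 4)).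
  exists N => i j Ni Nj; apply: nrm_le_sqr; first exact: ltW.
  by apply: le_trans (dist_m i j) _; have := hN i Ni; have := hN j Nj;
    move: (i.+1%:R^-1) (j.+1%:R^-1) => hi hj; lra.
have xz_le : ip (x - z) (x - z) <= d.
  have d0 : 0 <= d.
    by apply: lb_le_inf; [exact: S_inf.1|move=> _ [? _ <-]; exact: (ip_ge0 H)].
  rewrite -nrm_sqr -(sqr_sqrtr d0) ler_pXn2r ?nnegrE ?nrm_ge0 ?sqrtr_ge0 //.
  apply/ler_addgt0Pr => r r0.
  have r20 : 0 < r / 2 by rewrite divr_gt0.
  have [N hN] := mz _ r20.
  have [N' hN'] := near_harmonic (exprn_gt0 2 r20).
  have := hN (maxn N N') (leq_maxl _ _); set n := maxn N N' => mnz.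
  have xmn : nrm (x - m n) <= Num.sqrt d + r / 2.
    apply: nrm_le_sqr; first by rewrite addr_ge0 ?sqrtr_ge0 // ltW.
    apply: le_trans (Mm2 n) _; rewrite sqrrD sqr_sqrtr //.
    have := hN' n (leq_maxr _ _); move: (n.+1%:R^-1) => hn.
    have : 0 <= Num.sqrt d * (r / 2) *+ 2.
      by rewrite mulrn_wge0 // mulr_ge0 ?sqrtr_ge0 // ltW.
    lra.
  by have := nrm_tri (m n) x z; lra.
have xz0 : x - z = 0.
  apply: Mo => p Mp; apply/eqP; rewrite -sqrf_eq0 eq_le sqr_ge0 andbT.
  (* [z] need not lie in [M], so minimality against [z + t p] is obtained as the limit of minimality
     against [m N + t p]. *)
  have ineq t : ip (x - z) (x - z) <= ip (x - z - t *: p) (x - z - t *: p).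
    apply: (le_trans xz_le); rewrite -nrm_sqr.
    have d0 : 0 <= d.
      by apply: lb_le_inf; [exact: S_inf.1|move=> _ [? _ <-]; exact: (ip_ge0 H)].
    rewrite -(sqr_sqrtr d0) ler_pXn2r ?nnegrE ?nrm_ge0 ?sqrtr_ge0 //.
    apply/ler_addgt0Pr => r r0; have [N hN] := mz _ r0.
    have := hN N (leqnn _).
    have : Num.sqrt d <= nrm (x - (m N + t *: p)).
      by apply: ler_wsqrtr; apply: dS; apply: MD => //; exact: MZ.
    have := nrmD (x - z - t *: p) (z - m N).
    have -> : x - z - t *: p + (z - m N) = x - (m N + t *: p) by lmod.
    by rewrite (nrmC z); lra.
  have [pp0|pp0] := eqVneq (ip p p) 0.
    by rewrite (ip_eq0 H pp0) ip0r expr0n.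
  (* This [t] minimizes the quadratic and leaves [|w|^2 - <w, p>^2 / |p|^2] on the right, which
     forces [<w, p> = 0]. *)
  have := ineq (ip (x - z) p / ip p p); move: (x - z) => w; rewrite [leRHS]ipBl !(ipBr w) ipBr !(ipZl H) !ipZr (ipC H p w).
  have pp_gt0 : 0 < ip p p by rewrite lt_def pp0 (ip_ge0 H).
  have -> : ip w w - ip w p / ip p p * ip w p -
    (ip w p / ip p p * ip w p - ip w p / ip p p * (ip w p / ip p p * ip p p)) =
    ip w w - ip w p ^+ 2 / ip p p by field.
  by rewrite lerBrDr gerDl pmulr_lle0 // invr_gt0.
have [N hN] := mz _ e0.
exists (m N) => //; have /eqP := xz0; rewrite subr_eq0 => /eqP ->.
by rewrite nrmC hN.
Qed.

End InnerProduct.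

(** * The contraction semigroup of the inverse of a dissipative operator *)

Section Semigroup.
Context {R : realType} {X : lmodType R} (ip : X -> X -> R) (T : {linear X -> X}).
Hypothesis H : hilbert ip.
Local Notation nrm := (nrm ip).
Implicit Types (e h s t M : R).

(* [T] plays the role of the inverse of the generator, so that no unbounded
   operator is needed. *)
Record dissipative_inverse : Prop := DissipativeInverse {
  dinv_bounded : exists2 K, 0 <= K & forall x, nrm (T x) <= K * nrm x;
  dinv_dissipative : forall x, ip (T x) x <= 0;
  dinv_dense : forall z, (forall x, ip z (T x) = 0) -> z = 0;
  dinv_inj : forall x, T x = 0 -> x = 0 }.

Hypothesis HT : dissipative_inverse.

Local Ltac lmod :=
  apply: (ip_inj H) => ?;
  rewrite ?(ipBl H, ipNl H, ipDl H, ipZl H, ip0l H); by first [ring | field].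

(** Pair [h x - T x] with [x]: dissipativity gives [h |x|^2 <= <h x - T x, x>], and Cauchy-Schwarz
    allows division by [|x|]. *)
Lemma shift_coercive h x : 0 < h -> h * nrm x <= nrm (T x - h *: x).
Proof.
move=> h0; have [x0|x0] := eqVneq (nrm x) 0; first by rewrite x0 mulr0 nrm_ge0.
have x_gt0 : 0 < nrm x by rewrite lt_def x0 nrm_ge0.
rewrite -(ler_pM2r x_gt0) -mulrA -expr2 (nrm_sqr H).
have := ip_le_nrm H (- (T x - h *: x)) x; rewrite (nrmN H).
by apply: le_trans; rewrite (ipNl H) (ipBl H) (ipZl H) opprB lerBrDr gerDl (dinv_dissipative HT).
Qed.

(** The range is dense: a vector [z] orthogonal to it, tested against its own image, satisfies
    [<T z, z> = h |z|^2], and dissipativity makes it zero. The range is closed because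
    [shift_coercive] turns convergent images into convergent preimages. *)
Lemma shift_surj h y : 0 < h -> exists x, T x - h *: x = y.
Proof.
move=> h0.
have dense e : 0 < e -> exists x, nrm (y - (T x - h *: x)) <= e.
  move=> e0.
  have [| | | |m [x <-] xm] := dense_of_orthogonal H
      (M := fun z => exists x, T x - h *: x = z) _ _ _ _ y e0; last by exists x.
  - by exists 0; rewrite (linear0 T) scaler0 subr0.
  - by move=> _ _ [x <-] [z <-]; exists (x + z); rewrite (linearD T); lmod.
  - move=> k _ [x <-]; exists (k *: x); rewrite (linearZ_LR T); lmod.
  - move=> z zM; have /zM : exists x, T x - h *: x = T z - h *: z by exists z.
    rewrite (ipC H) (ipBl H) (ipZl H) => /eqP; rewrite subr_eq0 => /eqP zz.
    apply: (ip_eq0 H); apply/eqP; rewrite eq_le (ip_ge0 H) andbT.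
    by rewrite -(pmulr_rle0 _ h0) -zz (dinv_dissipative HT).
have /choice[u uP] : forall n : nat, exists x, nrm (y - (T x - h *: x)) <= n.+1%:R^-1.
  by move=> n; apply: dense; rewrite invr_gt0.
have [|x ux] := @hilbert_complete _ _ _ H u.
  move=> e e0; have he0 : 0 < h * e / 2 by rewrite divr_gt0 // mulr_gt0.
  have [N hN] := near_harmonic he0; exists N => m n Nm Nn.
  rewrite -(ler_pM2l h0); apply: le_trans (shift_coercive _ h0) _.
  have -> : T (u m - u n) - h *: (u m - u n) =
      (y - (T (u n) - h *: u n)) - (y - (T (u m) - h *: u m)).
    by rewrite (linearB T); lmod.
  apply: le_trans (nrmB H _ _) _.
  have := le_trans (uP m) (hN m Nm); have := le_trans (uP n) (hN n Nn); lra.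
have [K K0 TK] := dinv_bounded HT.
exists x; apply/esym/eqP; rewrite -subr_eq0; apply/eqP/(nrm_le_eps H) => e e0.
have Kh0 : 0 < K + h by rewrite ltr_wpDl.
have [|N hN] := ux (e / 2 / (K + h)); first by rewrite !divr_gt0.
have [N' hN'] := near_harmonic (divr_gt0 e0 (ltr0n R 2)).
have := hN (maxn N N') (leq_maxl _ _); have := hN' (maxn N N') (leq_maxr _ _).
move: (maxn N N') => n hn unx; have un := le_trans (uP n) hn.
have -> : y - (T x - h *: x) = (y - (T (u n) - h *: u n)) +
    (T (u n - x) - h *: (u n - x)) by rewrite (linearB T); lmod.
apply: le_trans (nrmD H _ _) _.
have := nrmB H (T (u n - x)) (h *: (u n - x)); rewrite (nrmZ H) (gtr0_norm h0).
have := TK (u n - x); move: unx; rewrite ler_pdivlMr // mulrDr; lra.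
Qed.

(** With [A] the inverse of [T], this is the resolvent [(1 - h A)^-1], that is, one backward Euler
    step: the equation [y - h A y = x] has been multiplied by [T]. *)
Definition res (h : R) (x : X) : X := xget 0 [set y | T y - h *: y = T x].

Lemma resE h x : 0 < h -> T (res h x) = T x + h *: res h x.
Proof.
move=> h0; have [y yx] := shift_surj (T x) h0.
have : T (res h x) - h *: res h x = T x.
  exact: (@xgetPex _ 0 [set y | T y - h *: y = T x] (ex_intro _ y yx)).
by move/eqP; rewrite subr_eq => /eqP.
Qed.

Lemma res_unique h x y : 0 < h -> T y = T x + h *: y -> y = res h x.
Proof.
move=> h0 yx; apply/eqP; rewrite -subr_eq0; apply/eqP/(nrm_eq0 H).
apply/eqP; rewrite eq_le nrm_ge0 andbT -(pmulr_rle0 _ h0).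
apply: le_trans (shift_coercive _ h0) _.
rewrite [X in nrm X](_ : _ = 0) ?(nrm0 H) //.
by rewrite (linearB T) yx resE //; lmod.
Qed.

Lemma resB h x y : 0 < h -> res h (x - y) = res h x - res h y.
Proof.
move=> h0; apply/esym/res_unique => //.
by rewrite !(linearB T) !resE //; lmod.
Qed.

Lemma T_res h x : 0 < h -> T (res h x) = res h (T x).
Proof.
by move=> h0; apply: res_unique => //; rewrite {1}resE // (linearD T) (linearZ_LR T).
Qed.

Lemma res_le h x : 0 < h -> nrm (res h x) <= nrm x.
Proof.
move=> h0; set y := res h x.
have Td : T (y - x) = h *: y by rewrite (linearB T) resE //; lmod.
(* Pairing with [y - x] rather than with [y] yields [|y|^2 <= <y, x>]. *)
have : ip (T (y - x)) (y - x) <= 0 := dinv_dissipative HT _.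
rewrite Td (ipZl H) pmulr_rle0 // (ipBr H) subr_le0 -(nrm_sqr H) => yx.
have := le_trans yx (ip_le_nrm H _ _).
have [->|y0] := eqVneq (nrm y) 0; first by rewrite nrm_ge0.
by rewrite expr2 ler_pM2l // lt_def y0 nrm_ge0.
Qed.

Lemma res_incr h w : 0 < h -> res h (T w) - T w = h *: res h w.
Proof.
move=> h0; apply/eqP; rewrite subr_eq addrC; apply/eqP/esym/res_unique => //.
by rewrite (linearD T) (linearZ_LR T) resE //; lmod.
Qed.

(** Local error of halving the step: since [(1 - h A / 2)^2 - (1 - h A) = h^2 A^2 / 4], the one-step
    and two-step resolvents differ by [h^2 / 4] times [A^2] times their product. Acting on [T (T w)]
    cancels [A^2]. *)
Lemma res_halve h w : 0 < h ->
  res h (T (T w)) - res (h / 2) (res (h / 2) (T (T w))) =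
  (h ^+ 2 / 4) *: res h (res (h / 2) (res (h / 2) w)).
Proof.
move=> h0; have k0 : 0 < h / 2 by rewrite divr_gt0.
apply/eqP; rewrite subr_eq addrC; apply/eqP/esym/res_unique => //.
rewrite -!T_res // (linearD T) (linearZ_LR T) (resE (res _ _) h0).
rewrite !(resE _ k0) !(linearD T, linearZ_LR T) !(resE _ k0) !(linearD T, linearZ_LR T).
rewrite !(resE _ k0); lmod.
Qed.

Lemma iter_res_le h n x : 0 < h -> nrm (iter n (res h) x) <= nrm x.
Proof.
by move=> h0; elim: n => //= n IHn; apply: le_trans (res_le _ h0) IHn.
Qed.

Lemma iter_resB h n x y : 0 < h ->
  iter n (res h) (x - y) = iter n (res h) x - iter n (res h) y.
Proof. by move=> h0; elim: n => //= n ->; rewrite resB. Qed.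

Lemma T_iter_res h n x : 0 < h -> T (iter n (res h) x) = iter n (res h) (T x).
Proof. by move=> h0; elim: n => //= n <-; rewrite T_res. Qed.

Lemma iter_res_incr h m n w : 0 < h ->
  nrm (iter (m + n) (res h) (T w) - iter m (res h) (T w)) <= n%:R * h * nrm w.
Proof.
move=> h0; elim: n => [|n IHn]; first by rewrite addn0 subrr (nrm0 H) !mul0r.
rewrite addnS /=; apply: le_trans (nrm_tri H (iter (m + n) (res h) (T w)) _ _) _.
rewrite -T_iter_res // res_incr // (nrmZ H) (gtr0_norm h0) T_iter_res //.
have : nrm (res h (iter (m + n) (res h) w)) <= nrm w.
  by apply: le_trans (res_le _ h0) _; exact: iter_res_le.
move=> /(ler_wpM2l (ltW h0)).
by rewrite -[n.+1]addn1 natrD !mulrDl mul1r; lra.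
Qed.

(** The local errors add up without amplification because [res] is a contraction; when [n h] stays
    bounded, the total is of order [h]. *)
Lemma iter_res_halve h n w : 0 < h ->
  nrm (iter n (res h) (T (T w)) - iter n.*2 (res (h / 2)) (T (T w))) <=
  n%:R * (h ^+ 2 / 4) * nrm w.
Proof.
move=> h0; have k0 : 0 < h / 2 by rewrite divr_gt0.
elim: n => [|n IHn]; first by rewrite subrr (nrm0 H) !mul0r.
rewrite doubleS /=; set y := iter n.*2 _ _ in IHn *.
apply: le_trans (nrm_tri H (res h y) _ _) _.
have := res_le (iter n (res h) (T (T w)) - y) h0; rewrite resB //.
have -> : nrm (res h y - res (h / 2) (res (h / 2) y)) =
   h ^+ 2 / 4 * nrm (res h (res (h / 2) (res (h / 2) (iter n.*2 (res (h / 2)) w)))).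
  rewrite /y -!T_iter_res // res_halve // (nrmZ H) ger0_norm //.
  by rewrite divr_ge0 // sqr_ge0.
have : nrm (res h (res (h / 2) (res (h / 2) (iter n.*2 (res (h / 2)) w)))) <= nrm w.
  do 3 apply: le_trans (res_le _ _) _ => //; exact: iter_res_le.
have h4 : 0 <= h ^+ 2 / 4 by rewrite divr_ge0 // sqr_ge0.
move=> /(ler_wpM2l h4).
by rewrite -[n.+1]addn1 natrD !mulrDl mul1r; lra.
Qed.

Definition step (k : nat) : R := 2^-1 ^+ k.

(** The step sizes are powers of 1/2, so that passing from [k] to [k + 1] halves every step. The
    number of steps is the integer part of [t / step k]. *)
Definition euler (k : nat) (t : R) (x : X) : X :=
  iter (Num.truncn (t * 2 ^+ k)) (res (step k)) x.

Lemma step_gt0 k : 0 < step k.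
Proof. by rewrite /step exprn_gt0 // invr_gt0. Qed.

Lemma stepS k : step k.+1 = step k / 2.
Proof. by rewrite /step exprSr. Qed.

Lemma stepE k : step k = (2 ^+ k)^-1.
Proof. by rewrite /step exprVn. Qed.

Lemma step_small e : 0 < e -> exists N, forall k, (N <= k)%N -> step k <= e.
Proof.
move=> e0; have [N hN] := near_harmonic e0; exists N => k Nk.
apply: le_trans (hN k Nk); rewrite stepE lef_pV2 ?posrE ?exprn_gt0 //.
by rewrite -natrX ler_nat ltn_expl.
Qed.

Lemma truncn_step k (t : R) : 0 <= t ->
  (Num.truncn (t * 2 ^+ k))%:R * step k <= t <
  (Num.truncn (t * 2 ^+ k))%:R * step k + step k.
Proof.
move=> t0; have t20 : 0 <= t * 2 ^+ k by rewrite mulr_ge0 // exprn_ge0.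
have /andP[] := truncn_itv t20; move: (Num.truncn _) => n.
rewrite -(ler_pM2r (step_gt0 k)) -(ltr_pM2r (step_gt0 k)) -[n.+1%:R]natr1.
by rewrite mulrDl mul1r stepE mulfK ?expf_neq0 // => -> ->.
Qed.

(** [b] is the next binary digit of [t]: after halving the step, at most one further step fits
    before [t]. *)
Lemma truncn_double k (t : R) : 0 <= t -> let n := Num.truncn (t * 2 ^+ k) in
  exists b : bool, Num.truncn (t * 2 ^+ k.+1) = (n.*2 + b)%N.
Proof.
move=> t0 n; have t20 : 0 <= t * 2 ^+ k by rewrite mulr_ge0 // exprn_ge0.
have /andP[n1 n2] := truncn_itv t20; rewrite -/n in n1 n2.
have -> : t * 2 ^+ k.+1 = t * 2 ^+ k * 2 by rewrite exprSr mulrA.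
move: (t * 2 ^+ k) t20 n1 n2 => u u0 n1 n2.
have [un|un] := ltP u (n%:R + 2^-1).
  exists false; rewrite addn0; apply: truncn_def.
  by rewrite -[_.*2.+1%:R]natr1 -muln2 natrM; apply/andP; split; lra.
exists true; apply: truncn_def.
rewrite -[n.+1%:R]natr1 in n2.
by rewrite addn1 -[_.*2.+2%:R]natr1 -[_.*2.+1%:R]natr1 -muln2 natrM;
  apply/andP; split; lra.
Qed.

Lemma euler_le k t x : nrm (euler k t x) <= nrm x.
Proof. exact/iter_res_le/step_gt0. Qed.

Lemma eulerB k t x y : euler k t (x - y) = euler k t x - euler k t y.
Proof. exact/iter_resB/step_gt0. Qed.

Lemma euler_step M k t w : 0 <= t <= M ->
  nrm (euler k t (T (T w)) - euler k.+1 t (T (T w))) <=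
  (M * nrm w + nrm (T w)) * step k.
Proof.
move=> /andP[t0 tM]; have [b nb] := truncn_double k t0.
have /andP[nt _] := truncn_step k t0.
rewrite /euler nb; move: (Num.truncn _) nt => n nt.
have k0 := step_gt0 k; have k1 := step_gt0 k.+1.
apply: le_trans (nrm_tri H (iter n.*2 (res (step k.+1)) (T (T w))) _ _) _.
have A : nrm (iter n (res (step k)) (T (T w)) -
    iter n.*2 (res (step k.+1)) (T (T w))) <= M * nrm w * step k.
  rewrite stepS; apply: le_trans (iter_res_halve _ _ k0) _.
  rewrite [leRHS]mulrAC ler_wpM2r ?nrm_ge0 //.
  have ns0 : 0 <= n%:R * step k * step k by rewrite !mulr_ge0 // ltW.
  have := ler_wpM2r (ltW k0) (le_trans nt tM); lra.
have B : nrm (iter n.*2 (res (step k.+1)) (T (T w)) -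
    iter (n.*2 + b) (res (step k.+1)) (T (T w))) <= nrm (T w) * step k.
  rewrite (nrmC H); apply: le_trans (iter_res_incr _ _ _ k1) _.
  rewrite mulrC ler_wpM2l ?nrm_ge0 // stepS.
  by case: (b); rewrite ?mul1r ?mul0r; lra.
by rewrite mulrDl lerD.
Qed.

(** Telescoping of [euler_step]: the step sizes of the levels [k] to [k + j - 1] sum to
    [2 (step k - step (k + j))]. *)
Lemma euler_cauchy_smooth M w k j t : 0 <= t <= M ->
  nrm (euler k t (T (T w)) - euler (k + j) t (T (T w))) <=
  (M * nrm w + nrm (T w)) * 2 * (step k - step (k + j)).
Proof.
move=> tM; elim: j => [|j IHj]; first by rewrite addn0 !subrr (nrm0 H) mulr0.
apply: le_trans (nrm_tri H (euler (k + j) t (T (T w))) _ _) _.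
rewrite addnS; have := euler_step (k + j) w tM; rewrite stepS.
by move: (M * _ + _) IHj => C; lra.
Qed.

(** The range of [T^2] is the domain of [A^2], where [res_halve] controls the local error. *)
Lemma dense_range2 x e : 0 < e -> exists w, nrm (x - T (T w)) <= e.
Proof.
have dT y r : 0 < r -> exists w, nrm (y - T w) <= r.
  move=> r0.
  have [| | | |m [z <-] ym] := dense_of_orthogonal H
      (M := fun z => exists x, T x = z) _ _ _ _ y r0; last by exists z.
  - by exists 0; rewrite (linear0 T).
  - by move=> _ _ [u <-] [v <-]; exists (u + v); rewrite (linearD T).
  - by move=> k _ [u <-]; exists (k *: u); rewrite (linearZ_LR T).
  - by move=> z zM; apply: (dinv_dense HT) => u; apply: zM; exists u.
move=> e0; have [K K0 TK] := dinv_bounded HT.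
have [|u xu] := dT x (e / 2); first by rewrite divr_gt0.
have K1 : 0 < K + 1 by rewrite ltr_wpDl.
have [|w uw] := dT u (e / 2 / (K + 1)); first by rewrite !divr_gt0.
exists w; apply: le_trans (nrm_tri H (T u) _ _) _.
rewrite -(linearB T); have := TK (u - T w); move: uw.
rewrite ler_pdivlMr // mulrDr mulr1.
have := nrm_ge0 ip (u - T w); lra.
Qed.

Lemma euler_cauchy x M e : 0 < e -> exists N, forall k l t,
  (N <= k)%N -> (N <= l)%N -> 0 <= t <= M -> nrm (euler k t x - euler l t x) <= e.
Proof.
move=> e0.
have [|w xw] := dense_range2 x (e := e / 4); first by rewrite divr_gt0.
(* The absolute value covers negative [M]; the added 1 makes [C] positive, so that one may divide by
   it. *)
pose C := (`|M| * nrm w + nrm (T w)) * 2 + 1.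
have C0 : 0 < C.
  by rewrite ltr_wpDl // mulr_ge0 // addr_ge0 ?mulr_ge0 ?nrm_ge0.
have [|N hN] := step_small (e := e / 4 / C); first by rewrite !divr_gt0.
have smooth k t : (N <= k)%N -> 0 <= t <= M ->
    nrm (euler N t (T (T w)) - euler k t (T (T w))) <= e / 4.
  move=> /subnK <- /andP[t0 tM]; rewrite addnC.
  have tM' : 0 <= t <= `|M| by rewrite t0 (le_trans tM) // ler_norm.
  apply: le_trans (euler_cauchy_smooth _ _ _ tM') _.
  have := hN N (leqnn _); rewrite ler_pdivlMr // mulrDr mulr1.
  have := ltW (step_gt0 (N + (k - N))); have := ltW (step_gt0 N).
  have : 0 <= `|M| * nrm w + nrm (T w).
    by rewrite addr_ge0 ?mulr_ge0 ?nrm_ge0.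
  by rewrite /C; nra.
exists N => k l t Nk Nl tM.
have close j : (N <= j)%N -> nrm (euler j t x - euler N t (T (T w))) <= e / 2.
  move=> Nj; apply: le_trans (nrm_tri H (euler j t (T (T w))) _ _) _.
  have := euler_le j t (x - T (T w)); rewrite eulerB.
  by have := smooth j t Nj tM; rewrite (nrmC H (euler N _ _)); lra.
apply: le_trans (nrm_tri H (euler N t (T (T w))) _ _) _.
by have := close k Nk; have := close l Nl; rewrite (nrmC H (euler l t x)); lra.
Qed.

(** The semigroup generated by [A], as the limit of the Euler iterates. By [flow_lim] the default 0
    is not taken for [0 <= t]. *)
Definition flow (t : R) (x : X) : X :=
  xget 0 [set l | forall e, 0 < e ->
    exists N, forall k, (N <= k)%N -> nrm (euler k t x - l) <= e].

Lemma flow_lim t x e : 0 <= t -> 0 < e ->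
  exists N, forall k, (N <= k)%N -> nrm (euler k t x - flow t x) <= e.
Proof.
move=> t0; have [|l ul] := @hilbert_complete _ _ _ H (fun k => euler k t x).
  move=> r r0; have [N hN] := euler_cauchy x t r0; exists N => m n Nm Nn.
  by apply: hN; rewrite ?t0 /=.
exact: (@xgetPex _ 0 [set l | forall e, 0 < e ->
    exists N, forall k, (N <= k)%N -> nrm (euler k t x - l) <= e]
  (ex_intro _ l ul) e).
Qed.

Lemma flow_lim_unif x M e : 0 < e -> exists N, forall k t,
  (N <= k)%N -> 0 <= t <= M -> nrm (euler k t x - flow t x) <= e.
Proof.
move=> e0; have e20 : 0 < e / 2 by rewrite divr_gt0.
have [N hN] := euler_cauchy x M e20.
exists N => k t Nk tM; have /andP[t0 _] := tM.
have [N' hN'] := flow_lim x t0 e20.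
apply: le_trans (nrm_tri H (euler (maxn N N') t x) _ _) _.
have := hN' _ (leq_maxr N N').
by have := hN _ _ t Nk (leq_maxl N N') tM; lra.
Qed.

Lemma flow0 x : flow 0 x = x.
Proof.
apply/eqP; rewrite eq_sym -subr_eq0; apply/eqP/(nrm_le_eps H) => e e0.
have [N hN] := flow_lim x (lexx 0) e0; have := hN N (leqnn _).
by rewrite /euler mul0r truncn0.
Qed.

Definition curve_continuous (Z : R -> X) : Prop :=
  forall t e, 0 <= t -> 0 < e -> exists2 d : R, 0 < d &
    forall s, 0 <= s -> `|s - t| <= d -> nrm (Z s - Z t) <= e.

Definition curve_derivative (Y Z : R -> X) : Prop :=
  forall t e, 0 <= t -> 0 < e -> exists2 d : R, 0 < d &
    forall s, 0 <= s -> `|s - t| <= d ->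
      nrm (Y s - Y t - (s - t) *: Z t) <= e * `|s - t|.

(* [Y] is a primitive of [Z]: every ball containing the values of [Z] on
   [[s, t]] contains the mean slope of [Y].  In contrast with differentiability
   this passes to uniform limits. *)
Definition curve_primitive (Y Z : R -> X) : Prop :=
  forall s t c M, 0 <= s -> s <= t ->
    (forall r, s <= r <= t -> nrm (Z r - c) <= M) ->
    nrm (Y t - Y s - (t - s) *: c) <= (t - s) * M.

(** On the range of [T] the Euler iterates move by at most [|w|] per unit time. Rounding [s] and [t]
    to the grid costs at most one step, which disappears in the limit. *)
Lemma flow_lipschitz s t w : 0 <= s -> s <= t ->
  nrm (flow t (T w) - flow s (T w)) <= (t - s) * nrm w.
Proof.
move=> s0 st; have t0 := le_trans s0 st; apply/ler_addgt0Pr => e e0.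
have e30 : 0 < e / 3 by rewrite divr_gt0.
have [N1 h1] := flow_lim (T w) s0 e30; have [N2 h2] := flow_lim (T w) t0 e30.
have C0 : 0 < nrm w + 1 by rewrite ltr_wpDl // nrm_ge0.
have [|N3 h3] := step_small (e := e / 3 / (nrm w + 1)); first by rewrite !divr_gt0.
pose k := maxn N1 (maxn N2 N3).
have kN1 : (N1 <= k)%N by rewrite leq_maxl.
have kN2 : (N2 <= k)%N by rewrite /k maxnCA leq_maxl.
have kN3 : (N3 <= k)%N by rewrite /k maxnA leq_maxr.
apply: le_trans (nrm_tri H (euler k t (T w)) _ _) _.
have := nrm_tri H (euler k s (T w)) (euler k t (T w)) (flow s (T w)).
have := h1 k kN1; have := h2 k kN2; rewrite (nrmC H _ (flow t _)).
suff : nrm (euler k t (T w) - euler k s (T w)) <= (t - s) * nrm w + e / 3 by lra.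
have /andP[s1 s2] := truncn_step k s0; have /andP[t1 t2] := truncn_step k t0.
have mn : (Num.truncn (s * 2 ^+ k) <= Num.truncn (t * 2 ^+ k))%N.
  by apply: le_truncn; rewrite ler_pM2r // exprn_gt0.
rewrite /euler -{1}(subnKC mn); apply: le_trans (iter_res_incr _ _ _ (step_gt0 k)) _.
rewrite natrB // mulrBl; have := h3 k kN3; rewrite ler_pdivlMr // mulrDr mulr1.
have := nrm_ge0 ip w; have := step_gt0 k.
move: (_ * step k) (_ * step k) s1 s2 t1 t2 => a b s1 s2 t1 t2.
have ab : a - b <= t - s + step k by lra.
by have := ler_wpM2r (nrm_ge0 ip w) ab; rewrite mulrDl; lra.
Qed.

Lemma flow_continuous x : curve_continuous (flow^~ x).
Proof.
move=> t e t0 e0.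
have e30 : 0 < e / 3 by rewrite divr_gt0.
have [w xw] : exists w, nrm (x - T w) <= e / 3.
  by have [w xw] := dense_range2 x e30; exists (T w).
have C0 : 0 < nrm w + 1 by rewrite ltr_wpDl // nrm_ge0.
have contr r : 0 <= r -> nrm (flow r x - flow r (T w)) <= e / 3.
  move=> r0; apply: le_trans xw; apply/ler_addgt0Pr => f f0.
  have f20 : 0 < f / 2 by rewrite divr_gt0.
  have [N1 h1] := flow_lim x r0 f20; have [N2 h2] := flow_lim (T w) r0 f20.
  set k := maxn N1 N2.
  apply: le_trans (nrm_tri H (euler k r x) _ _) _.
  have := nrm_tri H (euler k r (T w)) (euler k r x) (flow r (T w)).
  have := h1 k (leq_maxl _ _); have := h2 k (leq_maxr _ _).
  rewrite (nrmC H (flow r x)); have := euler_le k r (x - T w); rewrite eulerB.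
  lra.
exists (e / 3 / (nrm w + 1)); first by rewrite !divr_gt0.
move=> s s0 std.
apply: le_trans (nrm_tri H (flow s (T w)) _ _) _.
have := nrm_tri H (flow t (T w)) (flow s (T w)) (flow t x).
have := contr s s0; have := contr t t0; rewrite (nrmC H (flow t x)).
suff : nrm (flow s (T w) - flow t (T w)) <= e / 3 by lra.
move: std; rewrite ler_pdivlMr // mulrDr mulr1; have := normr_ge0 (s - t).
have [st|st] := leP s t.
  have := flow_lipschitz w s0 st; rewrite (nrmC H) distrC ger0_norm ?subr_ge0 //.
  lra.
have := flow_lipschitz w t0 (ltW st); rewrite ger0_norm ?subr_ge0 ?(ltW st) //.
lra.
Qed.

(** The discrete form of [curve_primitive]. The indices satisfy [m < j <= m + n] because an implicit
    step from [y] to [z] gives [T z - T y = h z], with the new value [z]. *)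
Lemma T_iter_res_sum h m n x c M : 0 < h ->
  (forall j, (m < j <= m + n)%N -> nrm (iter j (res h) x - c) <= M) ->
  nrm (T (iter (m + n) (res h) x) - T (iter m (res h) x) - (n%:R * h) *: c) <=
  n%:R * h * M.
Proof.
move=> h0; elim: n => [|n IHn] cM.
  by rewrite addn0 subrr !mul0r scale0r subr0 (nrm0 H).
have {}IHn : nrm (T (iter (m + n) (res h) x) - T (iter m (res h) x) -
    (n%:R * h) *: c) <= n%:R * h * M.
  by apply: IHn => j /andP[mj jn]; apply: cM; rewrite mj addnS ltnW.
have -> : T (iter (m + n.+1) (res h) x) - T (iter m (res h) x) -
      (n.+1%:R * h) *: c =
    (T (iter (m + n) (res h) x) - T (iter m (res h) x) - (n%:R * h) *: c) +
    h *: (iter (m + n).+1 (res h) x - c).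
  rewrite addnS [in LHS]iterS resE // -iterS -[n.+1]addn1 natrD; lmod.
apply: le_trans (nrmD H _ _) _; rewrite (nrmZ H) (gtr0_norm h0).
have := cM (m + n).+1; rewrite addnS leqnn ltnS leq_addr => /(_ isT).
move=> /(ler_wpM2l (ltW h0)).
by rewrite -[n.+1%:R]natr1 !mulrDl mul1r; lra.
Qed.

Lemma T_flow_primitive x : curve_primitive (fun t => T (flow t x)) (flow^~ x).
Proof.
move=> s t c M s0 st cM; have t0 := le_trans s0 st; apply/ler_addgt0Pr => e e0.
have [K K0 TK] := dinv_bounded HT.
have M0 : 0 <= M by apply: le_trans (cM s _); rewrite ?nrm_ge0 ?lexx.
(* All errors are multiples of [q]: [2 K] comes from replacing the flow by Euler iterates under [T],
   [nrm c] from rounding the times, [M] and [t - s] from the enlarged length [t - s + q] and radius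
   [q + M]; the product [q q] is absorbed by [q <= 1]. *)
pose C := 2 * K + nrm c + M + (t - s) + 2.
have C1 : 1 <= C.
  by rewrite /C; have := nrm_ge0 ip c; lra.
have C0 : 0 < C by lra.
pose q := Num.min 1 (e / C).
have q0 : 0 < q by rewrite lt_min ltr01 divr_gt0.
have qC : q * C <= e by rewrite -ler_pdivlMr // ge_min lexx orbT.
have q1 : q <= 1 by rewrite ge_min lexx.
have [N1 h1] := flow_lim_unif x t q0; have [N2 h2] := step_small q0.
set k := maxn N1 N2.
have {}h1 := h1 k _ (leq_maxl _ _); have {}h2 := h2 k (leq_maxr _ _).
have hk0 := step_gt0 k.
have /andP[s1 s2] := truncn_step k s0; have /andP[t1 t2] := truncn_step k t0.
have mn : (Num.truncn (s * 2 ^+ k) <= Num.truncn (t * 2 ^+ k))%N.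
  by apply: le_truncn; rewrite ler_pM2r // exprn_gt0.
set m := Num.truncn (s * 2 ^+ k) in s1 s2 mn.
set n := Num.truncn (t * 2 ^+ k) in t1 t2 mn.
have sum : nrm (T (iter (m + (n - m)) (res (step k)) x) -
    T (iter m (res (step k)) x) - ((n - m)%:R * step k) *: c) <=
    (n - m)%:R * step k * (q + M).
  apply: T_iter_res_sum => // j; rewrite subnKC // => /andP[mj jn].
  have jk : euler k (j%:R * step k) x = iter j (res (step k)) x.
    by rewrite /euler stepE mulfVK ?expf_neq0 // natrK.
  have js : s <= j%:R * step k.
    apply: (le_trans (ltW s2)); rewrite -[X in _ + X]mul1r -mulrDl.
    by rewrite ler_pM2r // natr1 ler_nat.
  have jt : j%:R * step k <= t.
    by apply: le_trans t1; rewrite ler_pM2r // ler_nat.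
  rewrite -jk; apply: le_trans (nrm_tri H (flow (j%:R * step k) x) _ _) _.
  by rewrite lerD // ?h1 ?cM ?js ?(le_trans s0 js).
rewrite subnKC // natrB // mulrBl in sum.
have Ht : nrm (T (flow t x - euler k t x)) <= K * q.
  apply: le_trans (TK _) _; rewrite ler_wpM2l // (nrmC H) h1 // t0 lexx //.
have Hs : nrm (T (euler k s x - flow s x)) <= K * q.
  by apply: le_trans (TK _) _; rewrite ler_wpM2l // h1 // s0.
have -> : T (flow t x) - T (flow s x) - (t - s) *: c =
    T (flow t x - euler k t x) + T (euler k s x - flow s x) +
    ((T (iter n (res (step k)) x) -
    T (iter m (res (step k)) x) - (n%:R * step k - m%:R * step k) *: c) +
    ((n%:R * step k - m%:R * step k) - (t - s)) *: c).
  by rewrite !(linearB T) /euler -/m -/n; lmod.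
apply: le_trans (nrmD H _ _) _.
have := nrmD H (T (flow t x - euler k t x)) (T (euler k s x - flow s x)).
set y := T (iter n _ x) - _ - _ in sum *.
have := nrmD H y (((n%:R * step k - m%:R * step k) - (t - s)) *: c).
rewrite (nrmZ H).
have dq : `|n%:R * step k - m%:R * step k - (t - s)| <= q.
  by rewrite ler_norml; apply/andP; split; lra.
have := ler_wpM2r (nrm_ge0 ip c) dq.
have : (n%:R * step k - m%:R * step k) * (q + M) <= (t - s + q) * (q + M).
  by rewrite ler_wpM2r ?addr_ge0 // ?ltW //; move: dq; rewrite ler_norml => /andP[]; lra.
have -> : (t - s + q) * (q + M) = (t - s) * M + (t - s) * q + q * q + q * M by ring.
have : q * q <= q * 1 by rewrite ler_wpM2l // ltW.
by move: qC; rewrite /C !mulrDr; clearbody q; lra.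
Qed.

(** Use the ball of center [Z t] and radius [e], which by continuity contains all values of [Z] at
    times close to [t]. *)
Lemma curve_primitive_derivative Y Z :
  curve_primitive Y Z -> curve_continuous Z -> curve_derivative Y Z.
Proof.
move=> YZ cZ t e t0 e0; have [d d0 Zd] := cZ t e t0 e0; exists d => // s s0 std.
have [st|st] := leP t s.
  rewrite ger0_norm ?subr_ge0 // mulrC; apply: YZ => // r /andP[tr rs].
  apply: Zd; first exact: le_trans tr.
  apply: le_trans std; rewrite !ger0_norm ?subr_ge0 //; lra.
have -> : Y s - Y t - (s - t) *: Z t = - (Y t - Y s - (t - s) *: Z t) by lmod.
rewrite (nrmN H) distrC ger0_norm ?subr_ge0 ?(ltW st) // mulrC.
apply: YZ => //; first exact: ltW.
move=> r /andP[sr rt]; apply: Zd; first exact: le_trans sr.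
by apply: le_trans std; rewrite !(distrC _ t) !ger0_norm ?subr_ge0 ?(ltW st) //; lra.
Qed.

Theorem flow_exists x : exists Z : R -> X, [/\ Z 0 = x, curve_continuous Z &
  curve_derivative (fun t => T (Z t)) Z].
Proof.
exists (flow^~ x); split; [exact: flow0|exact: flow_continuous|].
exact/curve_primitive_derivative/flow_continuous/T_flow_primitive.
Qed.

(* |Y|^2 is nonincreasing, as its derivative is 2 <Z, T Z>. *)
Lemma flow_unique (Z : R -> X) :
  curve_derivative (fun t => T (Z t)) Z -> T (Z 0) = 0 ->
  forall t, 0 <= t -> T (Z t) = 0.
Proof.
move=> dY Y0 t t0; set Y := fun t => T (Z t) in dY.
pose g t := ip (Y t) (Y t).
have gE s r : g s - g r - (s - r) * (2 * ip (Z r) (Y r)) =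
    2 * ip (Y s - Y r - (s - r) *: Z r) (Y r) + nrm (Y s - Y r) ^+ 2.
  rewrite (nrm_sqr H) /g !(ipBl H) !(ipBr H) (ipZl H) (ipC H (Y r) (Y s)).
  ring.
(* The right-hand side of [gE] consists of a remainder term, controlled by [C], and the square of an
   increment of [Y], controlled by the Lipschitz bound [B]; each receives half of [e]. *)
have gd (r e : R) : 0 <= r -> 0 < e -> exists2 d : R, 0 < d &
    forall s, 0 <= s -> `|s - r| <= d ->
    `|g s - g r - (s - r) * (2 * ip (Z r) (Y r))| <= e * `|s - r|.
  move=> r0 e0; pose C := 2 * nrm (Y r) + 1.
  have C0 : 0 < C by rewrite ltr_wpDl // mulr_ge0 // nrm_ge0.
  have eC0 : 0 < e / 2 / C by rewrite !divr_gt0.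
  have [d d0 Yd] := dY r _ r0 eC0.
  pose B := e / 2 / C + nrm (Z r).
  have B0 : 0 < B by rewrite ltr_pwDl // nrm_ge0.
  exists (Num.min d (e / 2 / B ^+ 2)).
    by rewrite lt_min d0 !divr_gt0 // exprn_gt0.
  move=> s s0; rewrite le_min => /andP[sd sB].
  have := Yd s s0 sd; set u := Y s - Y r - _ => uC; rewrite gE -/u.
  have YB : nrm (Y s - Y r) <= B * `|s - r|.
    have -> : Y s - Y r = u + (s - r) *: Z r by rewrite /u; lmod.
    apply: le_trans (nrmD H _ _) _; rewrite (nrmZ H) /B mulrDl [X in _ <= _ + X]mulrC.
    by rewrite lerD2r.
  apply: le_trans (ler_normD _ _) _; rewrite normrM ger0_norm //.
  rewrite [X in _ + X]ger0_norm ?sqr_ge0 //.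
  have -> : e * `|s - r| = e / 2 * `|s - r| + e / 2 * `|s - r| by field.
  apply: lerD.
    apply: le_trans (ler_wpM2l _ (cauchy_schwarz H _ _)) _ => //.
    apply: le_trans (_ : _ <= e / 2 / C * `|s - r| * C) _.
      rewrite /C mulrDr mulr1 mulrCA mulrA.
      have := ler_wpM2r (nrm_ge0 ip (Y r)) uC.
      have : 0 <= e / 2 / C * `|s - r| by rewrite mulr_ge0 // ltW.
      by rewrite /C; lra.
    by rewrite mulrAC divfK // gt_eqF.
  apply: le_trans (_ : _ <= (B * `|s - r|) ^+ 2) _.
    by rewrite ler_pXn2r ?nnegrE ?nrm_ge0 // mulr_ge0 // ltW.
  rewrite exprMn [`|s - r| ^+ 2]expr2 mulrA ler_wpM2r // mulrC.
  by rewrite -ler_pdivlMr // exprn_gt0.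
have gder (r : R) : 0 < r -> is_derive r 1 g (2 * ip (Z r) (Y r)).
  move=> r0.
  have cvg_quot : h^-1 *: ((g \o shift r) (h *: 1) - g r) @[h --> 0^'] -->
      (2 * ip (Z r) (Y r) : R).
    apply/cvgrPdist_le => e e0; have [d d0 gd'] := gd r e (ltW r0) e0.
    near=> h; rewrite /= [h *: 1]mulr1.
    have h0 : h != 0 by near: h; exact: nbhs_dnbhs_neq.
    have hd : `|h| <= Num.min d r.
      by near: h; apply: dnbhs0_le; rewrite lt_min d0.
    move: hd; rewrite le_min => /andP[hd hr].
    have := gd' (h + r) _ _; rewrite addrK; move=> /(_ _ hd).
    have h1 : 0 <= h + r by move: hr; rewrite ler_norml => /andP[]; lra.
    move=> /(_ h1) gh; rewrite distrC.
    have -> : h^-1 *: (g (h + r) - g r) - 2 * ip (Z r) (Y r) =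
        h^-1 * (g (h + r) - g r - h * (2 * ip (Z r) (Y r))).
      by rewrite mulrBr mulrA mulVf // mul1r.
    by rewrite normrM normfV ler_pdivrMl ?normr_gt0 // (mulrC `|h|).
  apply: DeriveDef; first by apply/cvg_ex; exists (2 * ip (Z r) (Y r)).
  exact: cvg_lim.
(* The derivative just obtained is two-sided, hence available only for [r > 0]; at 0 the
   monotonicity criterion asks for continuity within the interval. *)
have gcont (r : R) : 0 < r -> {within `[0, r], continuous g}.
  move=> r0; apply/subspace_continuousP => u /= /[!in_itv] /= /andP[u0 _].
  apply/cvgrPdist_le => e e0; pose C := 1 + `|2 * ip (Z u) (Y u)|.
  have C0 : 0 < C by rewrite ltr_pwDl.
  have [d d0 gd'] := gd u 1 u0 ltr01.
  near=> v.
  have v0 : 0 <= v.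
    have : [set` `[0, r]] v by near: v; exact: withinT.
    by rewrite /= in_itv /= => /andP[].
  have vd : `|v - u| <= Num.min d (e / C).
    near: v; apply: cvg_within; apply/nbhs_ballP.
    exists (Num.min d (e / C)); first by rewrite /= lt_min d0 divr_gt0.
    by move=> v /=; rewrite distrC => /ltW.
  move: vd; rewrite le_min ler_pdivlMr // => /andP[vd vC].
  have := gd' v v0 vd; rewrite mul1r => gv; rewrite distrC; apply: le_trans vC.
  have -> : g v - g u = (g v - g u - (v - u) * (2 * ip (Z u) (Y u))) +
    (v - u) * (2 * ip (Z u) (Y u)) by ring.
  apply: le_trans (ler_normD _ _) _; rewrite /C mulrDr mulr1.
  by rewrite lerD // normrM.
have g0 : g 0 = 0 by rewrite /g /Y Y0 (ip0l H).
have gt : g t <= 0.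
  have [->|tn0] := eqVneq t 0; first by rewrite g0.
  have t_gt0 : 0 < t by rewrite lt_def tn0.
  rewrite -g0; apply: (@ler0_derive1_nincr _ g 0 t) => //.
  - by move=> r /[!in_itv] /andP[r0 _]; apply: (@ex_derive _ _ _ _ _ _ _ (gder r r0)).
  - move=> r /[!in_itv] /andP[r0 _]; rewrite derive1E.
    rewrite (@derive_val _ _ _ _ _ _ _ (gder r r0)) pmulr_rle0 //.
    by rewrite (ipC H) (dinv_dissipative HT).
  - exact: gcont.
by apply: (ip_eq0 H); apply/eqP; rewrite eq_le gt (ip_ge0 H).
Unshelve. all: by end_near. Qed.

End Semigroup.

(** * Square integrable functions and primitives *)

Section RealL2.
Context {R : realType}.
Notation mu := (@lebesgue_measure R).
Implicit Types (p q x c M k : R) (f g h : R -> R).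

Definition L2r p q f : Prop := measurable_fun `]p, q[ f /\
  mu.-integrable `]p, q[ (fun x => (f x ^+ 2)%:E).

Definition eqr_ae p q f g : Prop :=
  {ae mu, forall x, `]p, q[%classic x -> f x = g x}.

Lemma ae_imp (P Q : R -> Prop) : (forall x, P x -> Q x) ->
  {ae mu, forall x, P x} -> {ae mu, forall x, Q x}.
Proof.
move=> PQ; apply: filterS; first exact: (ae_filter_ringOfSetsType mu).
exact: PQ.
Qed.

Lemma ae_and (P Q : R -> Prop) : {ae mu, forall x, P x} ->
  {ae mu, forall x, Q x} -> {ae mu, forall x, P x /\ Q x}.
Proof.
move=> aP aQ; apply: filterI => //; exact: (ae_filter_ringOfSetsType mu).
Qed.

Lemma ae_neq c : {ae mu, forall x, x != c}.
Proof.
exists [set c]; split; [exact: measurable_set1|exact: lebesgue_measure_set1|].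
by move=> x /= /negP; rewrite negbK => /eqP.
Qed.

Lemma lebesgue_itv_lty p q : (mu `]p, q[%classic < +oo)%E.
Proof. by rewrite lebesgue_measure_itv /=; case: ifP => _; rewrite ?ltry // -EFinB ltry. Qed.

Lemma integrable_ext p q (F G : R -> \bar R) :
  (forall x, `]p, q[%classic x -> F x = G x) ->
  mu.-integrable `]p, q[ F -> mu.-integrable `]p, q[ G.
Proof. by move=> FG; apply: eq_integrable => // x /set_mem /FG. Qed.

Lemma L2r_mul p q f g : L2r p q f -> L2r p q g ->
  mu.-integrable `]p, q[ (EFin \o (fun x => f x * g x)).
Proof.
move=> [mf intf] [mg intg].
apply: (le_integrable _ _ _ (integrableD _ intf intg)) => //.
  exact/measurable_EFinP/measurable_funM.
move=> x _ /=; rewrite lee_fin normrM [leRHS]ger0_norm ?addr_ge0 ?sqr_ge0 //.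
rewrite -(real_normK (num_real (f x))) -(real_normK (num_real (g x))).
by move: (`|f x|) (`|g x|) => u v; have := sqr_ge0 (u - v); have := sqr_ge0 (u + v); nra.
Qed.

Lemma L2r_bounded p q f M : measurable_fun `]p, q[ f ->
  (forall x, `]p, q[%classic x -> `|f x| <= M) -> L2r p q f.
Proof.
move=> mf fM; split=> //.
apply: (@measurable_bounded_integrable _ _ _ mu (fun x => f x ^+ 2)) => //.
- exact: lebesgue_itv_lty.
- exact: measurable_funX.
exists (M ^+ 2); split; first exact: num_real.
move=> y My x /= /fM fxM; apply/ltW/(le_lt_trans _ My).
by rewrite normrX ler_pXn2r ?nnegrE // (le_trans _ fxM).
Qed.

Lemma L2r_cst p q c : L2r p q (fun=> c).
Proof. by apply: (L2r_bounded (M := `|c|)) => //; exact: measurable_cst. Qed.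

Lemma L2r_integrable p q f : L2r p q f -> mu.-integrable `]p, q[ (EFin \o f).
Proof.
move=> Lf; have := L2r_mul Lf (L2r_cst p q 1).
by apply: eq_integrable => // x _ /=; rewrite mulr1.
Qed.

Lemma L2r_ext p q f g : (forall x, `]p, q[%classic x -> f x = g x) ->
  L2r p q f -> L2r p q g.
Proof.
move=> fg [mf intf]; split.
  by apply: eq_measurable_fun mf => x /set_mem; exact: fg.
by apply: eq_integrable intf => // x /set_mem xD; rewrite fg.
Qed.

Lemma L2rD p q f g : L2r p q f -> L2r p q g -> L2r p q (fun x => f x + g x).
Proof.
move=> Lf Lg; split; first exact: measurable_funD Lf.1 Lg.1.
apply: (integrable_ext _ (integrableD _ (integrableD _ Lf.2 Lg.2)
  (integrableZl _ 2 (L2r_mul Lf Lg)))) => // x _ /=.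
by rewrite -EFinM -!EFinD; congr EFin; ring.
Qed.

Lemma L2rZ p q k f : L2r p q f -> L2r p q (fun x => k * f x).
Proof.
move=> [mf intf]; split; first exact: measurable_funM.
apply: (integrable_ext _ (integrableZl _ (k ^+ 2) intf)) => // x _ /=.
by rewrite -EFinM exprMn.
Qed.

Lemma L2rN p q f : L2r p q f -> L2r p q (fun x => - f x).
Proof. by move/(L2rZ (-1)); apply: L2r_ext => x _; rewrite mulN1r. Qed.

Lemma L2rB p q f g : L2r p q f -> L2r p q g -> L2r p q (fun x => f x - g x).
Proof. by move=> Lf /L2rN; apply: L2rD. Qed.

Lemma L2rS p q p' q' f : p <= p' -> q' <= q -> L2r p q f -> L2r p' q' f.
Proof.
move=> pp qq [mf intf].
have sub : `]p', q'[ `<=` `]p, q[.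
  move=> x /=; rewrite !in_itv /= => /andP[px xq].
  by rewrite (le_lt_trans pp px) (lt_le_trans xq qq).
by split; [exact: measurable_funS mf|exact: integrableS intf].
Qed.

Lemma continuous_measurable_oo p q f : {within `[p, q], continuous f} ->
  measurable_fun `]p, q[ f.
Proof.
move=> cf; apply: (@measurable_funS _ _ _ _ `[p, q]) => //.
  exact: subset_itv_oo_cc.
exact: subspace_continuous_measurable_fun.
Qed.

Lemma continuous_bounded_cc p q f : {within `[p, q], continuous f} ->
  exists2 M, 0 <= M & forall x, x \in `[p, q] -> `|f x| <= M.
Proof.
move=> cf; have := @compact_bounded _ _ (f @` `[p, q]).
have /[swap]/[apply] : compact (f @` `[p, q]).
  by apply: continuous_compact => //; exact: segment_compact.
move=> [M [_ /(_ (`|M| + 1))]]; rewrite (le_lt_trans (ler_norm M)) ?ltrDl // => /(_ isT) fM.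
by exists (`|M| + 1) => [|x xpq]; [rewrite addr_ge0|apply: fM; exists x].
Qed.

Lemma L2r_continuous p q f : {within `[p, q], continuous f} -> L2r p q f.
Proof.
move=> cf; have [M _ fM] := continuous_bounded_cc cf.
apply: (L2r_bounded (M := M)); first exact: continuous_measurable_oo.
by move=> x /subset_itv_oo_cc /fM.
Qed.

Lemma integrable_patch p q f : mu.-integrable `]p, q[ (EFin \o f) <->
  mu.-integrable setT (EFin \o (f \_ `]p, q[)).
Proof. by rewrite integrable_mkcond //= (restrict_EFin f). Qed.

Lemma integrable_split p c q f : p < c -> c < q ->
  mu.-integrable `]p, c[ (EFin \o f) -> mu.-integrable `]c, q[ (EFin \o f) ->
  mu.-integrable `]p, q[ (EFin \o f).
Proof.
move=> pc cq /integrable_patch f1 /integrable_patch f2; apply/integrable_patch.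
have fc : mu.-integrable [set c] (EFin \o f).
  by apply: null_set_integrable => //; [exact: measurable_fun_set1|exact: lebesgue_measure_set1].
rewrite integrable_mkcond //= (restrict_EFin f) in fc.
have := integrableD measurableT (integrableD measurableT f1 fc) f2.
apply: eq_integrable => // x _; rewrite -!EFinD; congr EFin.
have xcE : (x \in [set c]) = (x == c) by apply/idP/eqP; rewrite inE.
rewrite !patchE !mem_setE xcE !in_itv /= (_ : point = 0 :> R) //.
have [xc|xc|->] := ltgtP x c.
- by rewrite (lt_trans xc cq) !andbT !addr0.
- by rewrite (lt_trans pc xc) !andbF /= !add0r.
- by rewrite pc cq andbF /= addr0 add0r.
Qed.

Lemma L2r_split p c q f : p < c -> c < q -> L2r p c f -> L2r c q f -> L2r p q f.
Proof.
move=> pc cq L1 L2; split.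
  have := integrable_split pc cq (L2r_integrable L1) (L2r_integrable L2).
  by move=> /integrableP[/measurable_EFinP].
exact: (@integrable_split _ _ _ (fun x => f x ^+ 2) pc cq L1.2 L2.2).
Qed.

Lemma Rintegral_split p c q f : p < c -> c < q ->
  mu.-integrable `]p, q[ (EFin \o f) ->
  \int[mu]_(x in `]p, q[) f x =
  \int[mu]_(x in `]p, c[) f x + \int[mu]_(x in `]c, q[) f x.
Proof.
move=> pc cq intf.
have := @Rintegral_itvB _ f (BRight p) (BLeft q) c intf (ltW pc) cq.
move=> /eqP; rewrite subr_eq addrC => /eqP ->.
congr (_ + _); apply/esym/Rintegral_itv_bndo_bndc.
by apply: integrableS intf => //; apply: subset_itvl; rewrite bnd_simp ltW.
Qed.

Lemma eq_Rintegral_ae p q f g :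
  measurable_fun `]p, q[ f -> measurable_fun `]p, q[ g -> eqr_ae p q f g ->
  \int[mu]_(x in `]p, q[) f x = \int[mu]_(x in `]p, q[) g x.
Proof.
move=> mf mg fg; rewrite /Rintegral; congr fine; apply: ae_eq_integral => //.
- exact/measurable_EFinP.
- exact/measurable_EFinP.
- by apply: ae_imp fg => x /= fg /fg ->.
Qed.

Lemma eqr_aeW p q f g : (forall x, `]p, q[%classic x -> f x = g x) -> eqr_ae p q f g.
Proof. by move=> fg; apply: aeW. Qed.

Lemma eqr_ae_refl p q f : eqr_ae p q f f.
Proof. exact: eqr_aeW. Qed.

Lemma eqr_ae_sym p q f g : eqr_ae p q f g -> eqr_ae p q g f.
Proof. by apply: ae_imp => x fg /fg. Qed.

Lemma eqr_ae_trans p q f g h : eqr_ae p q f g -> eqr_ae p q g h -> eqr_ae p q f h.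
Proof.
move=> fg gh; apply: ae_imp (ae_and fg gh) => x [{}fg {}gh] xD.
by rewrite fg // gh.
Qed.

Lemma eqr_aeS p q p' q' f g : p <= p' -> q' <= q -> eqr_ae p q f g -> eqr_ae p' q' f g.
Proof.
move=> pp qq; apply: ae_imp => x fg; rewrite /= in_itv /= => /andP[px xq].
by apply: fg; rewrite /= in_itv /= (le_lt_trans pp px) (lt_le_trans xq qq).
Qed.

Lemma eqr_ae_split p c q f g : eqr_ae p c f g -> eqr_ae c q f g -> eqr_ae p q f g.
Proof.
move=> fg1 fg2; apply: ae_imp (ae_and (ae_and fg1 fg2) (ae_neq c)).
move=> x [[f1 f2] xc]; rewrite /= !in_itv /= in f1 f2 * => /andP[px xq].
have [|cx] := ltP x c; first by move=> xc'; apply: f1; rewrite px.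
by apply: f2; rewrite xq andbT lt_def xc.
Qed.

Lemma Rintegral_sqr_eq0 p q f : L2r p q f ->
  \int[mu]_(x in `]p, q[) f x ^+ 2 = 0 -> eqr_ae p q f (fun=> 0).
Proof.
move=> [mf intf] f0.
have : (\int[mu]_(x in `]p, q[) `|(f x ^+ 2)%:E| = 0)%E.
  under eq_integral do rewrite gee0_abs ?lee_fin ?sqr_ge0 //.
  rewrite -[LHS]fineK ?integrable_fin_num //; congr EFin; exact: f0.
move/ae_eq_integral_abs => /(_ (measurable_itv _)) h.
have {h} := h (proj1 (integrableP _ _ _ intf)).
by apply: ae_imp => x /= h /h [] /eqP; rewrite sqrf_eq0 => /eqP.
Qed.

End RealL2.

Section Primitive.
Context {R : realType}.
Notation mu := (@lebesgue_measure R).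
Implicit Types (p q x y c k : R) (f g h : R -> R).

Definition prim p f x : R := \int[mu]_(t in `]p, x[) f t.

Lemma prim_left p f : prim p f p = 0.
Proof. by rewrite /prim set_itv_ge ?Rintegral_set0 // bnd_simp ltxx. Qed.

Lemma integrable_le p q x f : x <= q -> mu.-integrable `]p, q[ (EFin \o f) ->
  mu.-integrable `]p, x[ (EFin \o f).
Proof. by move=> xq; apply: integrableS => //; exact: subset_itvl. Qed.

Lemma primD p q x f g : x <= q -> mu.-integrable `]p, q[ (EFin \o f) ->
  mu.-integrable `]p, q[ (EFin \o g) ->
  prim p (fun t => f t + g t) x = prim p f x + prim p g x.
Proof.
move=> xq intf intg; rewrite /prim RintegralD //; exact: integrable_le intf || exact: integrable_le intg.
Qed.

Lemma primZ p q x k f : x <= q -> mu.-integrable `]p, q[ (EFin \o f) ->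
  prim p (fun t => k * f t) x = k * prim p f x.
Proof. by move=> xq intf; rewrite /prim RintegralZl //; exact: integrable_le intf. Qed.

Lemma eq_prim p q x f g : x <= q ->
  measurable_fun `]p, q[ f -> measurable_fun `]p, q[ g -> eqr_ae p q f g ->
  prim p f x = prim p g x.
Proof.
move=> xq mf mg fg; apply: eq_Rintegral_ae.
- by apply: measurable_funS mf => //; exact: subset_itvl.
- by apply: measurable_funS mg => //; exact: subset_itvl.
- exact: eqr_aeS fg.
Qed.

Lemma prim_split p q x y f : p <= x -> x <= y -> y <= q ->
  mu.-integrable `]p, q[ (EFin \o f) ->
  prim p f y = prim p f x + prim x f y.
Proof.
move=> px xy yq intf; have := integrable_le yq intf.
move: px; rewrite le_eqVlt => /predU1P[->|px]; first by rewrite prim_left add0r.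
move: xy; rewrite le_eqVlt => /predU1P[->|xy]; first by rewrite prim_left addr0.
exact: Rintegral_split.
Qed.

Lemma prim_patch p q x f : p < q -> x <= q -> mu.-integrable `]p, q[ (EFin \o f) ->
  prim p f x = \int[mu]_(t in `[p, x]) (f \_ `]p, q[) t.
Proof.
move=> pq xq /integrable_patch intf.
rewrite -Rintegral_itv_obnd_cbnd; last exact: integrableS intf.
rewrite -Rintegral_itv_bndo_bndc; last exact: integrableS intf.
apply: eq_Rintegral => t; rewrite inE /= in_itv /= => /andP[pt tx].
by rewrite patchE mem_set //= in_itv /= pt (lt_le_trans tx).
Qed.

Lemma prim_continuous p q f : p < q -> mu.-integrable `]p, q[ (EFin \o f) ->
  {within `[p, q], continuous (prim p f)}.
Proof.
move=> pq intf.
have intfD : mu.-integrable `[p, q] (EFin \o (f \_ `]p, q[)).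
  by move/integrable_patch: intf; exact: integrableS.
apply: subspace_eq_continuous (parameterized_integral_continuous (ltW pq) intfD).
move=> x; rewrite inE /= in_itv /= => /andP[px xq].
exact: (esym (prim_patch pq xq intf)).
Qed.

(** Lebesgue differentiation, applied to the extension of [h] by zero: its primitive vanishes on the
    whole line, so its derivative does too. *)
Lemma prim_eq0_ae p q h : p < q -> mu.-integrable `]p, q[ (EFin \o h) ->
  (forall x, p < x -> x <= q -> prim p h x = 0) -> eqr_ae p q h (fun=> 0).
Proof.
move=> pq inth h0; set hD := h \_ `]p, q[.
have intT : mu.-integrable setT (EFin \o hD) by apply/integrable_patch.
have F0 x : \int[mu]_(t in [set` Interval (BRight p) (BRight x)]) hD t = 0.
  have intx : mu.-integrable [set` Interval (BRight p) (BRight x)] (EFin \o hD).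
    exact: integrableS intT.
  have [xp|px] := leP x p.
    by rewrite set_itv_ge ?Rintegral_set0 // bnd_simp -leNgt.
  rewrite -Rintegral_mkcondr.
  have [xq|qx] := ltP x q.
    rewrite (_ : _ `&` _ = `]p, x]%classic).
      rewrite -Rintegral_itv_bndo_bndc; first by apply: h0 => //; exact: ltW.
      exact/(integrable_le _ inth)/ltW.
    rewrite setIidl //; by apply: subset_itvl; rewrite bnd_simp.
  rewrite (_ : _ `&` _ = `]p, q[%classic); first by apply: h0.
  by rewrite setIidr //; apply: subset_itvl; rewrite bnd_simp.
have intTy y : mu.-integrable [set` Interval (BRight p) (BRight y)] (EFin \o hD).
  exact: integrableS intT.
have := @FTC1 R hD (BRight p) intTy (integrable_locally (measurable_itv _) inth).
rewrite /= (_ : (fun _ => _) = fun=> 0 :> R); last by apply/funext => x; exact: F0.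
apply: ae_imp => x hx; rewrite /= in_itv /= => /andP[px xq].
have [_] := hx px; rewrite derive1_cst => /esym.
by rewrite /hD patchE mem_set //= in_itv /= px.
Qed.

Lemma integrableM_continuous p q f g : mu.-integrable `]p, q[ (EFin \o f) ->
  {within `[p, q], continuous g} ->
  mu.-integrable `]p, q[ (EFin \o (fun x => f x * g x)).
Proof.
move=> intf cg; have [M _ gM] := continuous_bounded_cc cg.
have bg : [bounded g x | x in `]p, q[%classic].
  exists M; split; first exact: num_real.
  by move=> y My x /= /subset_itv_oo_cc /gM /le_trans; apply; exact: ltW.
by apply: (integrable_ext _ (integrableMl _ intf (continuous_measurable_oo cg) bg)).
Qed.

(* Fubini on the triangle [y < x]. *)
Lemma prim_by_parts p q f h : p < q -> mu.-integrable `]p, q[ (EFin \o f) ->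
  mu.-integrable `]p, q[ (EFin \o h) ->
  \int[mu]_(x in `]p, q[) (prim p f x * h x) +
  \int[mu]_(x in `]p, q[) (f x * prim p h x) = prim p f q * prim p h q.
Proof.
move=> pq intf inth.
pose fD := f \_ `]p, q[; pose hD := h \_ `]p, q[.
have intfD : mu.-integrable setT (EFin \o fD) by apply/integrable_patch.
have inthD : mu.-integrable setT (EFin \o hD) by apply/integrable_patch.
pose U := [set z : measurableTypeR R * measurableTypeR R | z.2 < z.1].
have mU : measurable U.
  have := @measurable_fun_ltr _ (measurableTypeR R * measurableTypeR R)%type R
    setT snd fst measurable_snd measurable_fst.
  move=> /(_ measurableT [set true] (I : measurable [set true])).
  by rewrite setTI; congr measurable; apply/seteqP; split=> z /=.
pose Phi (z : measurableTypeR R * measurableTypeR R) :=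
  (hD z.1 * (fD z.2 * \1_U z))%:E.
have mfD : measurable_fun setT fD by move/integrableP: intfD => [/measurable_EFinP].
have mhD : measurable_fun setT hD by move/integrableP: inthD => [/measurable_EFinP].
have mPhi : measurable_fun setT Phi.
  apply/measurable_EFinP; apply: measurable_funM.
    exact: measurableT_comp mhD measurable_fst.
  apply: measurable_funM; last exact: measurable_indic.
  exact: measurableT_comp mfD measurable_snd.
(* [Psi] dominates [Phi] and is integrable by Tonelli, as a product of integrable functions of
   separate variables. The inner integrals of [Phi] are [h x * prim p f x] in one order and
   [f y * (prim p h q - prim p h y)] in the other. *)
pose Psi (z : measurableTypeR R * measurableTypeR R) := (hD z.1 * fD z.2)%:E.
have mPsi : measurable_fun setT Psi.
  apply/measurable_EFinP; apply: measurable_funM.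
    exact: measurableT_comp mhD measurable_fst.
  exact: measurableT_comp mfD measurable_snd.
have intPsi : (mu \x mu)%E.-integrable setT Psi.
  apply/(integrable12ltyP mu mu mPsi).
  have intfa := integrable_abse intfD.
  pose c := fine (\int[mu]_y `|(fD y)%:E|)%E.
  have cE : (\int[mu]_y `|(fD y)%:E| = c%:E)%E by rewrite fineK // integrable_fin_num.
  under eq_integral => x _.
    under eq_integral do rewrite /= normrM EFinM.
    rewrite ge0_integralZl_EFin //; last exact: (measurable_int mu intfa).
    rewrite cE; over.
  exact: (integrable_lty _ (integrableZr measurableT c (integrable_abse inthD))).
have intPhi : (mu \x mu)%E.-integrable setT Phi.
  apply: (le_integrable measurableT mPhi) intPsi => z _.
  rewrite /Phi /Psi /= lee_fin !normrM ler_wpM2l // ler_piMr //.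
  by rewrite indicE; case: (_ \in _); rewrite ?normr1 ?normr0.
have intfp : mu.-integrable `]p, q[ (EFin \o (fun x => f x * prim p h x)).
  exact: integrableM_continuous intf (prim_continuous pq inth).
have inthp : mu.-integrable `]p, q[ (EFin \o (fun x => h x * prim p f x)).
  exact: integrableM_continuous inth (prim_continuous pq intf).
have intfc : mu.-integrable `]p, q[ (EFin \o (fun x => f x * prim p h q)).
  by apply: (integrable_ext _ (integrableZr _ (prim p h q) intf)).
have intfB : mu.-integrable `]p, q[
    (EFin \o (fun x => f x * prim p h q - f x * prim p h x)).
  by apply: (integrable_ext _ (integrableB _ intfc intfp)).
have E1 : (\int[mu]_x \int[mu]_y Phi (x, y) =
    (\int[mu]_(x in `]p, q[) (h x * prim p f x))%:E)%E.
  rewrite /Rintegral fineK; last by apply: integrable_fin_num.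
  rewrite [RHS]integral_mkcond; apply: eq_integral => x _.
  rewrite patchE; case: ifPn => [|xD].
    rewrite inE /= in_itv /= => /andP[px xq].
    have intx := integrable_le (ltW xq) intf.
    rewrite EFinM /prim Rintegral_mkcond /Rintegral fineK; last first.
      by apply: integrable_fin_num => //; apply/integrable_patch.
    rewrite -integralZl //; last by apply/integrable_patch.
    apply: eq_integral => y _; rewrite /Phi /hD /fD !patchE /= indicE.
    rewrite (_ : ((x, y) \in U) = (y < x)); last by apply/idP/idP; rewrite inE.
    rewrite !mem_setE !in_itv /= px xq -EFinM; congr EFin; congr (_ * _).
    have [yx|yx] := ltP y x; last by rewrite andbF mulr0.
    by rewrite (lt_trans yx xq) !andbT mulr1.
  by under eq_integral do rewrite /Phi /hD patchE /= (negbTE xD) mul0r;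
    rewrite integral0.
have E2 : (\int[mu]_y \int[mu]_x Phi (x, y) =
    (\int[mu]_(y in `]p, q[) (f y * prim p h q - f y * prim p h y))%:E)%E.
  rewrite /Rintegral fineK; last by apply: integrable_fin_num.
  rewrite [RHS]integral_mkcond; apply: eq_integral => y _.
  rewrite patchE; case: ifPn => [|yD].
    rewrite inE /= in_itv /= => /andP[py yq].
    have inty : mu.-integrable `]y, q[ (EFin \o h).
      by apply: integrableS inth => //; apply: subset_itvr; rewrite bnd_simp ltW.
    rewrite -mulrBr (prim_split (ltW py) (ltW yq) (lexx q) inth) addrAC subrr add0r.
    rewrite EFinM /prim Rintegral_mkcond /Rintegral fineK; last first.
      by apply: integrable_fin_num => //; apply/integrable_patch.
    rewrite -integralZl //; last by apply/integrable_patch.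
    apply: eq_integral => x _; rewrite /Phi /hD /fD !patchE /= indicE.
    rewrite (_ : ((x, y) \in U) = (y < x)); last by apply/idP/idP; rewrite inE.
    rewrite !mem_setE !in_itv /= py yq -EFinM; congr EFin.
    have [yx|yx] := ltP y x; last by rewrite /= !mulr0.
    by rewrite (lt_trans py yx) mulr1 /= mulrC.
  by under eq_integral do rewrite /Phi /fD [X in _ * (X * _)]patchE /= (negbTE yD) mul0r mulr0;
    rewrite integral0.
have := Fubini intPhi; rewrite E1 E2 => -[E].
under eq_Rintegral do rewrite mulrC.
rewrite E -RintegralD //.
under eq_Rintegral do rewrite subrK.
by rewrite RintegralZr.
Qed.

End Primitive.

(** * Test functions *)

Section Smooth.
Context {R : realType}.
Notation mu := (@lebesgue_measure R).
Implicit Types (p q x y c d k : R) (f g h phi : R -> R).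

Definition smooth f := forall n x, derivable (derive1n n f) x 1.

Lemma derivable_is_derive f x : derivable f x 1 -> is_derive x 1 f ((derive1 f) x).
Proof. by move=> df; rewrite derive1E; exact: derivableP. Qed.

Lemma is_derive_derive1 f x (df : R) : is_derive x 1 f df -> (derive1 f) x = df.
Proof. by move=> h; rewrite derive1E derive_val. Qed.

(** This replaces formulas for higher derivatives by a class of functions that is stable under one
    differentiation. *)
Lemma smooth_coind (P : (R -> R) -> Prop) :
  (forall f, P f -> (forall x, derivable f x 1) /\ P (derive1 f)) ->
  forall f, P f -> smooth f.
Proof.
move=> HP f Pf n; suff Pn : P (derive1n n f) by exact: (HP _ Pn).1.
by elim: n => [|n IHn]; rewrite ?derive1n0 // derive1nS; exact: (HP _ IHn).2.
Qed.

Lemma smooth_derivable f : smooth f -> forall x, derivable f x 1.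
Proof. by move=> sf; exact: (sf 0). Qed.

Lemma smooth_derive f : smooth f -> smooth (derive1 f).
Proof. by move=> sf n x; rewrite -derive1Sn. Qed.

Lemma smooth_continuous f : smooth f -> continuous f.
Proof.
by move=> sf x; apply/differentiable_continuous/derivable1_diffP/smooth_derivable.
Qed.

(** By the Leibniz rule, sums of products are stable under differentiation, whereas single products
    need not be in an evident way. *)
Inductive smooth_prod : (R -> R) -> Prop :=
| SmoothProd f g : smooth f -> smooth g -> smooth_prod (f * g)
| SmoothSum f g : smooth_prod f -> smooth_prod g -> smooth_prod (f + g).

Lemma derivable_derive1D f g : (forall x, derivable f x 1) ->
  (forall x, derivable g x 1) -> (derive1 (f + g)) = (derive1 f) + (derive1 g).
Proof.
move=> df dg; apply/funext => x; apply: is_derive_derive1.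
by have Df := derivable_is_derive (df x); have Dg := derivable_is_derive (dg x);
  exact: is_deriveD.
Qed.

Lemma derivable_derive1M f g : (forall x, derivable f x 1) ->
  (forall x, derivable g x 1) -> (derive1 (f * g)) = (derive1 f) * g + f * (derive1 g).
Proof.
move=> df dg; apply/funext => x.
have := is_deriveM (derivable_is_derive (df x)) (derivable_is_derive (dg x)).
move/is_derive_derive1 => ->; rewrite addrC /GRing.scale /=.
by rewrite mulrC.
Qed.

Lemma smooth_prod_derive f : smooth_prod f ->
  (forall x, derivable f x 1) /\ smooth_prod (derive1 f).
Proof.
elim=> {f} [f g sf sg|f g _ [df pf] _ [dg pg]].
  have df := smooth_derivable sf; have dg := smooth_derivable sg.
  split=> [x|]; first exact: derivableM.
  rewrite (derivable_derive1M df dg); apply: SmoothSum; apply: SmoothProd;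
    [exact: smooth_derive|exact: sg|exact: sf|exact: smooth_derive].
split=> [x|]; first exact: derivableD.
by rewrite (derivable_derive1D df dg); apply: SmoothSum.
Qed.

Lemma smoothM f g : smooth f -> smooth g -> smooth (f * g).
Proof.
by move=> sf sg; apply: (smooth_coind smooth_prod_derive); exact: SmoothProd.
Qed.

Lemma smooth_cst c : smooth (cst c).
Proof.
apply: (@smooth_coind (fun f => exists c, f = cst c)); last by exists c.
move=> _ [k ->]; split=> [x|]; first exact: derivable_cst.
by exists 0; apply/funext => x; rewrite derive1_cst.
Qed.

Lemma smoothZ k f : smooth f -> smooth (cst k * f).
Proof. by apply: smoothM; exact: smooth_cst. Qed.

Lemma smoothD f g : smooth f -> smooth g -> smooth (f + g).
Proof.
move=> sf sg; apply: (smooth_coind smooth_prod_derive).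
rewrite -(mulr1 f) -(mulr1 g).
by apply: SmoothSum; apply: SmoothProd; [exact: sf|exact: smooth_cst|exact: sg|exact: smooth_cst].
Qed.

Lemma smooth_affine k c f : smooth f -> smooth (fun x => f (k * x + c)).
Proof.
move=> sf.
apply: (@smooth_coind (fun h => exists g l, smooth g /\
    h = fun x => l * g (k * x + c))); last first.
  by exists f, 1; split=> //; apply/funext => x; rewrite mul1r.
move=> _ [g [l [sg ->]]].
have D x : is_derive x 1 (fun x => l * g (k * x + c)) (l * k * (derive1 g) (k * x + c)).
  have Dg := derivable_is_derive (@smooth_derivable g sg (k * x + c)).
  have Da : is_derive x 1 (fun x => k * x + c) k.
    apply: (is_derive_eq (is_deriveD (is_deriveZ k (is_derive_id x 1)) (is_derive_cst c x 1))).
    by rewrite addr0 /GRing.scale /= mulr1.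
  have := is_deriveZ l (@is_derive1_comp _ g (fun x => k * x + c) _ _ _ Dg Da).
  by move=> Dx; apply: is_derive_eq Dx _; rewrite /GRing.scale /=; ring.
split=> [x|]; first exact: (@ex_derive _ _ _ _ _ _ _ (D x)).
exists (derive1 g), (l * k); split; first exact: smooth_derive.
by apply/funext => x; exact: is_derive_derive1.
Qed.

(** The classical flat function [exp (- 1 / x)], times a power of [1 / x]. All powers occur because
    the derivative of [flat k] is a combination of [flat k.+2] and [flat k.+1]. *)
Definition flat (k : nat) x : R := if 0 < x then x^-1 ^+ k * expR (- x^-1) else 0.

Lemma flat_ge0 (k : nat) x : 0 <= flat k x.
Proof.
rewrite /flat; case: ifPn => // x0; rewrite mulr_ge0 ?expR_ge0 //.
by rewrite exprn_ge0 // invr_ge0 ltW.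
Qed.

(** With [y = 1 / x] and [m = k.+1], raise [exp (y / m) >= y / m] to the power [m]. The factor [x]
    left over makes the difference quotients at 0 tend to 0 in [flat_derive]. *)
Lemma flat_le (k : nat) x : 0 <= x -> flat k x <= k.+1%:R ^+ k.+1 * x.
Proof.
move=> x0; rewrite /flat; case: ifPn => [{}x0|_]; last by rewrite mulr_ge0 ?exprn_ge0.
set y := x^-1; have y0 : 0 < y by rewrite invr_gt0.
have m0 : 0 < k.+1%:R :> R by [].
rewrite expRN ler_pdivrMr ?expR_gt0 //.
have -> : y ^+ k = y ^+ k.+1 * x by rewrite exprS mulrAC mulVf ?mul1r ?gt_eqF.
rewrite mulrAC ler_wpM2r ?(ltW x0) // -ler_pdivrMl ?exprn_gt0 //.
have -> : expR y = expR (y / k.+1%:R) ^+ k.+1.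
  by rewrite -expRM_natl mulrC divfK // gt_eqF.
rewrite mulrC -expr_div_n ler_pXn2r ?nnegrE ?expR_ge0 ?divr_ge0 ?(ltW y0) //.
by apply: le_trans (expR_ge1Dx _); rewrite lerDr.
Qed.

Lemma flat_derive (k : nat) x : is_derive x 1 (flat k) (flat k.+2 x - k%:R * flat k.+1 x).
Proof.
have [x0|x0|->] := ltgtP x 0.
- have -> : flat k.+2 x - k%:R * flat k.+1 x = 0.
    by rewrite /flat ltNge (ltW x0) /= mulr0 subr0.
  have D0 := @is_derive_cst R R R 0 x 1; apply: near_eq_is_derive D0.
  near=> y; rewrite /flat /cst ltNge (_ : y <= 0) //.
  by apply: ltW; near: y; exact: lt_nbhsl.
- have xn0 : x != 0 by rewrite gt_eqF.
  pose F (y : R) := y^-1 ^+ k * expR (- y^-1).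
  suff DF : is_derive x 1 F (flat k.+2 x - k%:R * flat k.+1 x).
    apply: near_eq_is_derive DF.
    near=> y; rewrite /flat ifT //.
    by near: y; exact: lt_nbhsr.
  have Di : is_derive x 1 (fun y : R => y^-1) (- x^-1 ^+ 2).
    apply: is_derive_eq; first exact: is_deriveV.
    by rewrite /GRing.scale /= mulr1 exprVn.
  have DN := is_deriveN Di.
  have DE := is_derive1_comp (is_derive_expR _) DN.
  have DX := is_deriveX k Di.
  have -> : F = ((fun y : R => y^-1) ^+ k) * (expR \o - (fun y : R => y^-1)).
    by apply/funext => y; rewrite /F !fctE.
  apply: (is_derive_eq (is_deriveM DX DE)).
  rewrite /flat x0 /GRing.scale /= !fctE /=; case: k {DX F} => [|k] /=.
    by rewrite !expr0 !mul0r !subr0 !exprS !expr0 !mulr1 !mul1r ?addr0; ring.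
  by rewrite !exprS; ring.
- have -> : flat k.+2 0 - k%:R * flat k.+1 0 = 0 by rewrite /flat ltxx mulr0 subr0.
  have C0 : 0 < k.+2%:R ^+ k.+2 :> R by rewrite exprn_gt0.
  have cvg0 : h^-1 *: ((flat k \o shift 0) (h *: 1) - flat k 0) @[h --> 0^'] --> (0 : R).
    apply/cvgrPdist_le => e e0; near=> h.
    have h0 : h != 0 by near: h; exact: nbhs_dnbhs_neq.
    rewrite /= [h *: 1]mulr1 addr0 {2}/flat ltxx !subr0 sub0r normrN.
    have he : `|h| <= e / k.+2%:R ^+ k.+2.
      by near: h; apply: dnbhs0_le; rewrite divr_gt0.
    have [h_gt0|h_le0] := ltP 0 h; last first.
      by rewrite /flat ltNge h_le0 /= scaler0 normr0 ltW.
    have -> : h^-1 *: flat k h = flat k.+1 h.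
      by rewrite /flat h_gt0 exprS /GRing.scale /= mulrA.
    rewrite ger0_norm ?flat_ge0 //; apply: le_trans (flat_le _ (ltW h_gt0)) _.
    by rewrite -ler_pdivlMl // mulrC -[leLHS]gtr0_norm.
  apply: DeriveDef; first by apply/cvg_ex; exists (0 : R).
  exact: cvg_lim.
Unshelve. all: by end_near. Qed.

Inductive flat_span : (R -> R) -> Prop :=
| FlatBase (k : nat) : flat_span (flat k)
| FlatZ c f : flat_span f -> flat_span (cst c * f)
| FlatD f g : flat_span f -> flat_span g -> flat_span (f + g).

Lemma flat_span_derive f : flat_span f ->
  (forall x, derivable f x 1) /\ flat_span (derive1 f).
Proof.
elim=> {f} [k|c f _ [df sf]|f g _ [df sf] _ [dg sg]].
- split=> [x|]; first exact: (@ex_derive _ _ _ _ _ _ _ (flat_derive k x)).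
  rewrite (_ : (derive1 _) = flat k.+2 + cst (- k%:R) * flat k.+1).
    by apply: FlatD; [exact: FlatBase|apply: FlatZ; exact: FlatBase].
  apply/funext => x; rewrite (is_derive_derive1 (flat_derive k x)).
  by rewrite !fctE mulNr.
- split=> [x|]; first by apply: derivableM.
  rewrite (derivable_derive1M (fun x => derivable_cst c x 1) df).
  rewrite (_ : (derive1 (cst c)) = 0); last first.
    by apply/funext => x; rewrite derive1_cst.
  by rewrite mul0r add0r; apply: FlatZ.
- split=> [x|]; first exact: derivableD.
  by rewrite derivable_derive1D //; apply: FlatD.
Qed.

Lemma smooth_flat (k : nat) : smooth (flat k).
Proof. apply: (smooth_coind flat_span_derive); exact: FlatBase. Qed.

(** As [n] grows these tend pointwise to the indicator function of []c, d[] and stay between 0 and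
    1, which suits dominated convergence. *)
Definition bump c d (n : nat) x : R :=
  flat 0 (n.+1%:R * x + - (n.+1%:R * c)) * flat 0 (- n.+1%:R * x + n.+1%:R * d).

Lemma bump_smooth c d n : smooth (bump c d n).
Proof.
have A k l : smooth (fun x => flat 0 (k * x + l)) by apply: smooth_affine; exact: smooth_flat.
exact: (smoothM (A n.+1%:R (- (n.+1%:R * c))) (A (- n.+1%:R) (n.+1%:R * d))).
Qed.

Lemma flat0_le1 x : flat 0 x <= 1.
Proof.
rewrite /flat; case: ifPn => // x0; rewrite expr0 mul1r.
by rewrite -expR0 ler_expR oppr_le0 invr_ge0 ltW.
Qed.

Lemma bump_ge0 c d n x : 0 <= bump c d n x.
Proof. by rewrite mulr_ge0 // flat_ge0. Qed.

Lemma bump_le1 c d n x : bump c d n x <= 1.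
Proof. by rewrite mulr_ile1 ?flat_ge0 ?flat0_le1. Qed.

Lemma bump_eq0 c d n x : x \notin `]c, d[ -> bump c d n x = 0.
Proof.
have n0 : 0 < n.+1%:R :> R by [].
rewrite in_itv /= negb_and -!leNgt => /orP[xc|dx]; rewrite /bump.
  rewrite {1}/flat ifF ?mul0r //; apply/negbTE; rewrite -leNgt.
  by rewrite -mulrBr pmulr_rle0 // subr_le0.
rewrite {2}/flat ifF ?mulr0 //; apply/negbTE; rewrite -leNgt.
by rewrite mulNr addrC -mulrBr pmulr_rle0 // subr_le0.
Qed.

Lemma bump_cvg c d x : x \in `]c, d[ -> bump c d n x @[n --> \oo] --> (1 : R).
Proof.
rewrite in_itv /= => /andP[cx xd].
have F (u : R) : 0 < u -> (flat 0 (n.+1%:R * u) @[n --> \oo] --> (1 : R)).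
  move=> u0.
  have -> : (fun n => flat 0 (n.+1%:R * u)) = (fun n => expR (- u^-1 * n.+1%:R^-1)).
    apply/funext => n; rewrite /flat pmulr_rgt0 // u0 expr0 mul1r.
    by rewrite invfM mulrC mulNr.
  rewrite -[X in _ --> X]expR0.
  apply: (@cvg_comp _ _ _ (fun n => - u^-1 * n.+1%:R^-1) expR); last first.
    exact: continuous_expR.
  rewrite -(mulr0 (- u^-1)); apply: cvgMr; exact: cvg_harmonic.
rewrite -[X in _ --> X]mulr1.
have -> : (fun n => bump c d n x) =
    (fun n => flat 0 (n.+1%:R * (x - c)) * flat 0 (n.+1%:R * (d - x))).
  by apply/funext => n; rewrite /bump mulNr; congr (flat _ _ * flat _ _); ring.
by apply: cvgM; apply: F; rewrite subr_gt0.
Qed.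

Lemma bump_test p q c d n : p < c -> c <= d -> d < q -> test_function p q (bump c d n).
Proof.
move=> pc cd dq; split; first exact: bump_smooth.
exists c, d; split=> // x; rewrite in_itv /= => xcd; apply: bump_eq0.
apply: contra xcd; rewrite in_itv /= => /andP[cx xd]; by rewrite !ltW.
Qed.

End Smooth.

(** * Du Bois-Reymond lemmas; weak derivatives and primitives *)

Section TestFunctions.
Context {R : realType}.
Notation mu := (@lebesgue_measure R).
Implicit Types (p q x y c d k : R) (f g h phi psi : R -> R).

Lemma ae_exists_itv (P : R -> Prop) x y : {ae mu, forall t, P t} -> x < y ->
  exists t, [/\ x < t, t < y & P t].
Proof.
move=> [N [mN N0 PN]] xy; apply: contrapT => nP.
have : (mu `]x, y[%classic <= mu N)%E.
  apply: le_measure; rewrite ?inE //; move=> t /=; rewrite in_itv /= => /andP[xt ty].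
  by apply: PN => Pt; apply: nP; exists t.
by rewrite N0 lebesgue_measure_itv /= lte_fin xy -EFinD lee_fin leNgt subr_gt0 xy.
Qed.

Lemma within_continuous_le p q f x e : {within `[p, q], continuous f} ->
  x \in `[p, q] -> 0 < e -> exists2 d : R, 0 < d &
  forall y, y \in `[p, q] -> `|x - y| < d -> `|f x - f y| <= e.
Proof.
move=> /subspace_continuousP cf xpq e0.
have /cvgrPdist_le/(_ _ e0)/nbhs_ballP[d /= d0 hd] : f y @[y --> within `[p, q] (nbhs x)] --> f x.
  exact: (cf x xpq).
by exists d => // y ypq xyd; exact: (hd y xyd ypq).
Qed.

Lemma continuous_ae_eq p q f g : p < q ->
  {within `[p, q], continuous f} -> {within `[p, q], continuous g} ->
  eqr_ae p q f g -> forall x, x \in `[p, q] -> f x = g x.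
Proof.
move=> pq cf cg fg x xpq.
apply/eqP; rewrite -subr_eq0 -normr_eq0 eq_le normr_ge0 andbT.
apply/ler_addgt0Pr => e e0; rewrite add0r.
have e20 : 0 < e / 2 by rewrite divr_gt0.
have [d1 d10 hf] := within_continuous_le cf xpq e20.
have [d2 d20 hg] := within_continuous_le cg xpq e20.
move: xpq; rewrite in_itv /= => /andP[px xq].
pose d := Num.min d1 d2; have d0 : 0 < d by rewrite lt_min d10.
have : Num.max p (x - d) < Num.min q (x + d).
  by rewrite lt_min !gt_max pq; apply/andP; split; apply/andP; split; lra.
move=> /(ae_exists_itv fg)[t []].
rewrite gt_max lt_min => /andP[pt xdt] /andP[tq txd] fgt'.
have fgt : f t = g t by apply: fgt'; rewrite /= in_itv /= pt.
have xtd : `|x - t| < d by rewrite ltr_norml; apply/andP; split; lra.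
move: xtd; rewrite lt_min => /andP[xt1 xt2].
have tpq : t \in `[p, q] by rewrite in_itv /= !ltW.
have := hf t tpq xt1; have := hg t tpq xt2; rewrite fgt => g1 f1.
rewrite (le_trans (ler_distD (g t) _ _)) // (distrC (g t)).
by move: f1 g1; lra.
Qed.

Lemma prim_derive1 p x f : p <= x -> smooth f -> prim p (derive1 f) x = f x - f p.
Proof.
rewrite le_eqVlt => /predU1P[->|px] sf; first by rewrite prim_left subrr.
have cf := smooth_continuous sf; have cdf := smooth_continuous (smooth_derive sf).
have cw : {within `[p, x], continuous (derive1 f)} by exact: continuous_subspaceT.
rewrite /prim /Rintegral.
have mdf := continuous_measurable_oo cw.
rewrite integral_itv_bndo_bndc; last exact/measurable_EFinP.
rewrite integral_itv_obnd_cbnd; last exact/measurable_EFinP/measurable_fun_itv_bndo_bndcP.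
rewrite (continuous_FTC2 px cw (F := f)) //.
split=> [y _||]; first exact: smooth_derivable.
  by apply: cvg_at_right_filter; exact: cf.
by apply: cvg_at_left_filter; exact: cf.
Qed.

Lemma Rintegral_cst_itv c d k : c <= d -> \int[mu]_(x in `]c, d[) k = k * (d - c).
Proof.
move=> cd; have mucd : mu `]c, d[%classic = (d - c)%:E.
  rewrite lebesgue_measure_itv /= lte_fin; case: ifPn => [_|]; first by rewrite EFinB.
  by rewrite -leNgt => dc; rewrite (@le_anti _ _ c d) ?cd ?dc // subrr.
by rewrite Rintegral_cst //= mucd.
Qed.

Lemma prim_eq0 p f x : (forall t, p < t -> t < x -> f t = 0) -> prim p f x = 0.
Proof.
move=> f0; rewrite /prim (@eq_Rintegral _ _ _ _ _ (fun=> 0)) ?Rintegral_cst ?mul0r //.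
by move=> t; rewrite inE /= in_itv /= => /andP[]; exact: f0.
Qed.

Lemma smooth_primitive f : (forall x, derivable f x 1) -> smooth (derive1 f) -> smooth f.
Proof. by move=> df sf [|n] x; [exact: df|rewrite derive1Sn; exact: sf]. Qed.

Lemma continuous_integrable_oo p q f : continuous f ->
  mu.-integrable `]p, q[ (EFin \o f).
Proof.
move=> cf; apply: L2r_integrable; apply: L2r_continuous.
exact: continuous_subspaceT.
Qed.

Lemma prim_continuous_derive p x f : continuous f -> p < x ->
  is_derive x 1 (prim p f) (f x).
Proof.
move=> cf px.
have int y : mu.-integrable `]p, y] (EFin \o f).
  have cy : {within `[p, y], continuous f} by exact: continuous_subspaceT.
  have := continuous_compact_integrable (@segment_compact _ p y) cy.
  by apply: integrableS => //; apply: subset_itvr; rewrite bnd_simp.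
have -> : prim p f = fun y => \int[mu]_(t in [set` Interval (BRight p) (BRight y)]) f t.
  apply/funext => y; apply: Rintegral_itv_bndo_bndc; exact: continuous_integrable_oo.
have xx1 : x < x + 1 by rewrite ltrDl.
have pbx : (BRight p < BRight x)%O by rewrite bnd_simp.
have [dF F'] := @continuous_FTC1 R f (BRight p) x (x + 1) xx1 (int _) pbx (cf x).
by rewrite -F'; exact: derivable_is_derive.
Qed.

Section Test.
Variables p q : R.
Local Notation test := (test_function p q).

Lemma test_smooth phi : test phi -> smooth phi.
Proof. by case. Qed.

Lemma test_continuous phi : test phi -> {within `[p, q], continuous phi}.
Proof. by move=> /test_smooth/smooth_continuous; exact: continuous_subspaceT. Qed.

Lemma test_left phi x : test phi -> x <= p -> phi x = 0.
Proof.
move=> [_ [c [d [pc cd dq phi0]]]] xp; rewrite phi0 // in_itv /= negb_and -!ltNge.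
by rewrite (le_lt_trans xp pc).
Qed.

Lemma test_right phi x : test phi -> q <= x -> phi x = 0.
Proof.
move=> [_ [c [d [pc cd dq phi0]]]] qx; rewrite phi0 // in_itv /= negb_and -!ltNge.
by rewrite (lt_le_trans dq qx) orbT.
Qed.

Lemma test_derive phi : test phi -> test (derive1 phi).
Proof.
move=> [sphi [c [d [pc cd dq phi0]]]]; split; first exact: smooth_derive.
exists c, d; split=> // x xcd; apply: is_derive_derive1.
have D0 := @is_derive_cst R R R 0 x 1; apply: near_eq_is_derive D0.
move: xcd; rewrite in_itv /= negb_and -!ltNge => /orP[xc|dx].
  near=> y; rewrite phi0 // in_itv /= negb_and -!ltNge.
  by apply/orP; left; near: y; exact: lt_nbhsl.
near=> y; rewrite phi0 // in_itv /= negb_and -!ltNge.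
by apply/orP; right; near: y; exact: lt_nbhsr.
Unshelve. all: by end_near. Qed.

Lemma testD phi psi : test phi -> test psi -> test (phi + psi).
Proof.
move=> [sphi [c [d [pc cd dq phi0]]]] [spsi [c' [d' [pc' cd' dq' psi0]]]].
split; first exact: (@smoothD _ phi psi sphi spsi).
exists (Num.min c c'), (Num.max d d'); split.
- by rewrite lt_min pc.
- by rewrite ge_min le_max cd.
- by rewrite gt_max dq.
move=> x; rewrite in_itv /= ge_min le_max negb_and !negb_or -!ltNge => xcd.
rewrite !fctE phi0 ?psi0 ?addr0 // in_itv /= negb_and -!ltNge.
  by case/orP: xcd => /andP[x1 x2]; rewrite ?x1 ?x2 ?orbT.
by case/orP: xcd => /andP[x1 x2]; rewrite ?x1 ?x2 ?orbT.
Qed.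

Lemma testZ k phi : test phi -> test (cst k * phi).
Proof.
move=> [sphi [c [d [pc cd dq phi0]]]]; split; first exact: (@smoothZ _ k phi sphi).
by exists c, d; split=> // x /phi0; rewrite !fctE => ->; rewrite mulr0.
Qed.

Lemma prim_test phi x : test phi -> p <= x -> prim p (derive1 phi) x = phi x.
Proof.
move=> tphi px; rewrite prim_derive1 //; last exact: test_smooth.
by rewrite (test_left tphi (lexx p)) subr0.
Qed.

Hypothesis pq : p < q.

Lemma L2r_test phi : test phi -> L2r p q phi.
Proof. by move/test_continuous/L2r_continuous. Qed.

Lemma integrableM_test f phi : mu.-integrable `]p, q[ (EFin \o f) -> test phi ->
  mu.-integrable `]p, q[ (EFin \o (fun x => f x * phi x)).
Proof. by move=> intf /test_continuous; exact: integrableM_continuous. Qed.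

Lemma Rintegral_bump_cvg f c d : p < c -> c < d -> d < q ->
  mu.-integrable `]p, q[ (EFin \o f) ->
  (\int[mu]_(x in `]p, q[) (f x * bump c d n x)) @[n --> \oo] -->
  \int[mu]_(x in `]c, d[) f x.
Proof.
move=> pc cd dq intf.
have mf : measurable_fun `]p, q[ f by move/integrableP: intf => [/measurable_EFinP].
have sub : `]c, d[ `<=` `]p, q[ by apply: subset_itv; rewrite bnd_simp ltW.
have -> : \int[mu]_(x in `]c, d[) f x = \int[mu]_(x in `]p, q[) (f \_ `]c, d[) x.
  by rewrite -Rintegral_mkcondr setIidr.
have intfc : mu.-integrable `]p, q[ (EFin \o (f \_ `]c, d[)).
  have intcd : mu.-integrable `]c, d[ (EFin \o f) by apply: integrableS intf.
  by move/integrable_patch: intcd; exact: integrableS.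
apply: fine_cvg; rewrite fineK; last by apply: integrable_fin_num.
apply: (@dominated_cvg _ _ _ mu _ _ (fun n x => (f x * bump c d n x)%:E) _
  (fun x => `|f x|%:E)) => //.
- move=> n; apply/measurable_EFinP; apply: measurable_funM => //.
  apply: continuous_measurable_oo; apply: continuous_subspaceT.
  by apply: smooth_continuous; exact: bump_smooth.
- move=> x _; apply: cvg_EFin; first exact: nearW.
  rewrite patchE; case: ifPn => [|xcd].
    rewrite mem_setE => xcd; rewrite -[X in _ --> X]mulr1.
    by apply: cvgM; [exact: cvg_cst|exact: bump_cvg].
  rewrite mem_setE in xcd.
  rewrite (_ : _ \o _ = fun=> 0 :> R); first exact: cvg_cst.
  by apply/funext => n /=; rewrite bump_eq0 ?mulr0.
- exact: integrable_abse intf.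
- move=> n x _; rewrite /= lee_fin normrM ler_piMr //.
  by rewrite ger0_norm ?bump_le1 ?bump_ge0.
Qed.

(** Testing with bumps gives zero integral over every inner subinterval. Hence the primitive of [f]
    is constant, up to the end points by continuity, and [f] vanishes by differentiation. *)
Lemma test_orthogonal_eq0 f : mu.-integrable `]p, q[ (EFin \o f) ->
  (forall phi, test phi -> \int[mu]_(x in `]p, q[) (f x * phi x) = 0) ->
  eqr_ae p q f (fun=> 0).
Proof.
move=> intf f0.
have cP := prim_continuous pq intf.
have int0 c d : p < c -> c < d -> d < q -> \int[mu]_(x in `]c, d[) f x = 0.
  move=> pc cd dq; have := Rintegral_bump_cvg pc cd dq intf.
  have -> : (fun n => \int[mu]_(x in `]p, q[) (f x * bump c d n x)) = fun=> 0.
    by apply/funext => n; rewrite f0 //; apply: bump_test => //; exact: ltW.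
  by move=> cv; apply: (cvg_unique (@Rhausdorff R) cv); exact: cvg_cst.
have constP c d : p < c -> c < d -> d < q -> prim p f c = prim p f d.
  move=> pc cd dq.
  rewrite (prim_split (ltW pc) (ltW cd) (ltW dq) intf).
  by rewrite (_ : prim c f d = 0) ?addr0 //; exact: int0.
pose m : R := (p + q) / 2.
have pq' : p < q := pq.
have pm : p < m by rewrite /m; lra.
have mq : m < q by rewrite /m; lra.
have Pm x : x \in `[p, q] -> prim p f x = prim p f m.
  have cc : {within `[p, q], continuous (fun=> prim p f m)} by move=> ?; exact: cvg_cst.
  apply: (continuous_ae_eq pq cP cc); apply: eqr_aeW => {}x /=.
  rewrite in_itv /= => /andP[px xq].
  by have [xm|mx|->//] := ltgtP x m; [exact: constP|rewrite (constP m x)].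
apply: prim_eq0_ae => // x px xq.
rewrite Pm ?in_itv /= ?(ltW px) // -(Pm p) ?prim_left // in_itv /= lexx ltW //.
Qed.

(** The zero mean makes the primitive vanish to the right of the support as well; it singles out the
    derivatives of test functions among all test functions. *)
Lemma test_prim phi : test phi -> prim p phi q = 0 -> test (prim p phi) /\
  derive1 (prim p phi) = phi.
Proof.
move=> tphi phi0; have [sphi [c [d [pc cd dq phi0']]]] := tphi.
have cphi := smooth_continuous sphi.
have left0 x : x < c -> prim p phi x = 0.
  move=> xc; apply: prim_eq0 => t _ tx; apply: phi0'.
  by rewrite in_itv /= negb_and -!ltNge (lt_trans tx xc).
have DF x : is_derive x 1 (prim p phi) (phi x).
  have [px|xp] := ltP p x; first exact: prim_continuous_derive.
  rewrite (test_left tphi xp).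
  have D0 := @is_derive_cst R R R 0 x 1; apply: near_eq_is_derive D0.
  near=> y; rewrite left0 //; near: y; apply: lt_nbhsl; exact: le_lt_trans pc.
have dE : derive1 (prim p phi) = phi.
  by apply/funext => x; exact: is_derive_derive1.
split; last exact: dE.
split.
  apply: smooth_primitive; last by rewrite dE.
  by move=> x; exact: (@ex_derive _ _ _ _ _ _ _ (DF x)).
exists c, d; split=> // x; rewrite in_itv /= negb_and -!ltNge => /orP[/left0//|dx].
have right0 y z : d <= y -> prim y phi z = 0.
  move=> dy; apply: prim_eq0 => t yt _; apply: phi0'.
  by rewrite in_itv /= negb_and -!ltNge (le_lt_trans dy yt) orbT.
have px : p <= x by apply: ltW; apply: lt_trans dx; exact: lt_le_trans cd.
have [xq|/ltW qx] := leP x q.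
  have := prim_split px xq (lexx q) (continuous_integrable_oo p q cphi).
  by rewrite phi0 (right0 x) ?(ltW dx) // addr0.
have := prim_split (ltW pq) qx (lexx x) (continuous_integrable_oo p x cphi).
by rewrite phi0 (right0 q) ?(ltW dq) // addr0.
Unshelve. all: by end_near. Qed.

Lemma test_unit_mass : exists2 phi, test phi & 0 < \int[mu]_(x in `]p, q[) phi x.
Proof.
have pq' : p < q := pq.
pose c : R := (2 * p + q) / 3; pose d : R := (p + 2 * q) / 3.
have pc : p < c by rewrite /c; lra.
have cd : c < d by rewrite /c /d; lra.
have dq : d < q by rewrite /d; lra.
have int1 : mu.-integrable `]p, q[ (EFin \o (fun=> 1 : R)).
  by apply: L2r_integrable; exact: L2r_cst.
have := Rintegral_bump_cvg pc cd dq int1.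
rewrite Rintegral_cst_itv ?(ltW cd) // mul1r.
have dc0 : 0 < d - c by rewrite subr_gt0.
move=> /cvgr_gt /(_ 0 dc0) [n _ /(_ n (leqnn n)) /= hn].
exists (bump c d n); first by apply: bump_test => //; exact: ltW.
by move: hn; under eq_Rintegral do rewrite mul1r.
Qed.

(** The du Bois-Reymond lemma. The constant is the mean of [f] with weight [phi0]. *)
Lemma test_derive_orthogonal_cst f : mu.-integrable `]p, q[ (EFin \o f) ->
  (forall phi, test phi -> \int[mu]_(x in `]p, q[) (f x * derive1 phi x) = 0) ->
  exists c, eqr_ae p q f (fun=> c).
Proof.
move=> intf f0; have [phi0 tphi0 m0] := test_unit_mass.
set m := \int[mu]_(x in `]p, q[) phi0 x in m0.
pose c := (\int[mu]_(x in `]p, q[) (f x * phi0 x)) / m; exists c.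
have intc : mu.-integrable `]p, q[ (EFin \o (fun=> c)).
  by apply: L2r_integrable; exact: L2r_cst.
have intfc : mu.-integrable `]p, q[ (EFin \o (fun x => f x - c)).
  by apply: (integrable_ext _ (integrableB _ intf intc)).
have inttest psi : test psi -> mu.-integrable `]p, q[ (EFin \o psi).
  by move=> tpsi; apply: L2r_integrable; exact: L2r_test.
have : eqr_ae p q (fun x => f x - c) (fun=> 0).
  apply: test_orthogonal_eq0 => // psi tpsi.
  (* Adding this multiple of [phi0] cancels the mean of [psi], so that [theta] is the derivative of
     a test function. *)
  pose k := - ((\int[mu]_(x in `]p, q[) psi x) / m).
  pose theta := psi + cst k * phi0.
  have ttheta : test theta by apply: testD => //; exact: testZ.
  have theta0 : prim p theta q = 0.
    rewrite /prim /theta.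
    have -> : \int[mu]_(t in `]p, q[) (psi + cst k * phi0) t =
      \int[mu]_(t in `]p, q[) (psi t + k * phi0 t) by [].
    rewrite RintegralD //; first last.
    - by apply: (integrable_ext _ (integrableZl _ k (inttest _ tphi0))).
    - exact: inttest.
    rewrite RintegralZl //; last exact: inttest.
    by rewrite /k mulNr divfK ?subrr // gt_eqF.
  have [tP dP] := test_prim ttheta theta0; have := f0 _ tP; rewrite dP.
  have -> : \int[mu]_(x in `]p, q[) (f x * theta x) =
    \int[mu]_(x in `]p, q[) (f x * psi x + k * (f x * phi0 x)).
    by apply: eq_Rintegral => x _; rewrite /theta !fctE; ring.
  have ifpsi := integrableM_test intf tpsi.
  have ifphi := integrableM_test intf tphi0.
  rewrite RintegralD //; last by apply: (integrable_ext _ (integrableZl _ k ifphi)).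
  rewrite RintegralZl // => E.
  have -> : \int[mu]_(x in `]p, q[) ((f x - c) * psi x) =
    \int[mu]_(x in `]p, q[) (f x * psi x - c * psi x).
    by apply: eq_Rintegral => x _; ring.
  have ipsi := inttest _ tpsi.
  rewrite RintegralB //; last by apply: (integrable_ext _ (integrableZl _ c ipsi)).
  by rewrite RintegralZl //; move: E; rewrite /k /c => <-; ring.
by apply: ae_imp => x fc xD; have /eqP := fc xD; rewrite subr_eq0 => /eqP.
Qed.

Lemma Rintegral_test_derive phi : test phi -> \int[mu]_(x in `]p, q[) derive1 phi x = 0.
Proof.
move=> tphi; have := prim_test tphi (ltW pq); rewrite /prim => ->.
exact: test_right tphi (lexx q).
Qed.

Lemma weak_derive_prim c f g : measurable_fun `]p, q[ f ->
  mu.-integrable `]p, q[ (EFin \o g) -> eqr_ae p q f (fun x => c + prim p g x) ->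
  forall phi, test phi -> \int[mu]_(x in `]p, q[) (f x * derive1 phi x) =
    - \int[mu]_(x in `]p, q[) (g x * phi x).
Proof.
move=> mf intg fg phi tphi; have tphi' := test_derive tphi.
have mphi' := continuous_measurable_oo (test_continuous tphi').
have cP := prim_continuous pq intg; have mP := continuous_measurable_oo cP.
have iphi' : mu.-integrable `]p, q[ (EFin \o derive1 phi).
  by apply: L2r_integrable; exact: L2r_test.
have iP : mu.-integrable `]p, q[ (EFin \o (fun x => derive1 phi x * prim p g x)).
  exact: integrableM_continuous.
rewrite (eq_Rintegral_ae (g := fun x => c * derive1 phi x + derive1 phi x * prim p g x)).
- rewrite RintegralD //; last by apply: (integrable_ext _ (integrableZl _ c iphi')).
  rewrite RintegralZl // Rintegral_test_derive // mulr0 add0r.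
  have := prim_by_parts pq iphi' intg.
  rewrite (prim_test tphi (ltW pq)) (test_right tphi (lexx q)) mul0r addrC.
  move=> /eqP; rewrite addr_eq0 => /eqP ->; congr (- _).
  apply: eq_Rintegral => x; rewrite inE /= in_itv /= => /andP[px _].
  by rewrite (prim_test tphi (ltW px)) mulrC.
- exact: measurable_funM.
- apply: measurable_funD; apply: measurable_funM => //.
- by apply: ae_imp fg => x fg xD; rewrite fg //; ring.
Qed.

(** [f] and [prim p g] have the same weak derivative, so their difference is constant by the du
    Bois-Reymond lemma. This is what gives a weakly differentiable function its point values. *)
Lemma prim_weak_derive f g : mu.-integrable `]p, q[ (EFin \o f) ->
  mu.-integrable `]p, q[ (EFin \o g) ->
  (forall phi, test phi -> \int[mu]_(x in `]p, q[) (f x * derive1 phi x) =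
    - \int[mu]_(x in `]p, q[) (g x * phi x)) ->
  exists c, eqr_ae p q f (fun x => c + prim p g x).
Proof.
move=> intf intg fg.
have iP : mu.-integrable `]p, q[ (EFin \o prim p g).
  by apply: L2r_integrable; apply: L2r_continuous; exact: prim_continuous.
have mP : measurable_fun `]p, q[ (prim p g) by move/integrableP: iP => [/measurable_EFinP].
have [||c fc] := @test_derive_orthogonal_cst (fun x => f x - prim p g x).
- by apply: (integrable_ext _ (integrableB _ intf iP)).
- move=> phi tphi; have tphi' := test_derive tphi.
  have -> : \int[mu]_(x in `]p, q[) ((f x - prim p g x) * derive1 phi x) =
    \int[mu]_(x in `]p, q[) (f x * derive1 phi x - prim p g x * derive1 phi x).
    by apply: eq_Rintegral => x _; ring.
  rewrite RintegralB //; [|exact: integrableM_test..].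
  rewrite fg // (weak_derive_prim (c := 0) mP intg _ tphi) ?subrr //.
  by apply: eqr_aeW => x _; rewrite add0r.
by exists c; apply: ae_imp fc => x fc xD; rewrite -(fc xD) subrK.
Qed.

End Test.
End TestFunctions.

(** * The Hilbert space [L^2(0, 1)] *)

Section Completeness.
Context {R : realType}.
Notation mu := (@lebesgue_measure R).
Implicit Types (f g h : R -> R).
Local Notation L2 := (L2r (0 : R) 1).
Local Notation D := [set` `](0 : R), 1[].

(** The interval has length 1, so this is the nonnegativity of the variance of [|f|]. *)
Lemma Rintegral_norm_le f : L2 f ->
  \int[mu]_(x in D) `|f x| <= Num.sqrt (\int[mu]_(x in D) f x ^+ 2).
Proof.
move=> Lf; have Lnf : L2 (fun x => `|f x|).
  split; first exact: measurableT_comp Lf.1.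
  by apply: (integrable_ext _ Lf.2) => x _; rewrite real_normK ?num_real.
set m := (\int[mu]_(x in _) `|f x|); set s := (\int[mu]_(x in _) _).
have m0 : 0 <= m by apply: Rintegral_ge0.
have Lc := L2r_cst 0 1 m.
have : 0 <= \int[mu]_(x in D) (`|f x| - m) ^+ 2.
  by apply: Rintegral_ge0 => x _; exact: sqr_ge0.
have -> : \int[mu]_(x in D) (`|f x| - m) ^+ 2 = s - m ^+ 2.
  have -> : \int[mu]_(x in D) (`|f x| - m) ^+ 2 =
      \int[mu]_(x in D) (f x ^+ 2 + (- 2 * m) * `|f x| + m ^+ 2).
    by apply: eq_Rintegral => x _; rewrite -(real_normK (num_real (f x))); ring.
  have i1 : mu.-integrable D (EFin \o (fun x => f x ^+ 2)) by exact: Lf.2.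
  have i2 : mu.-integrable D (EFin \o (fun x => (- 2 * m) * `|f x|)).
    by apply: L2r_integrable; exact: L2rZ.
  have i12 : mu.-integrable D (EFin \o (fun x => f x ^+ 2 + (- 2 * m) * `|f x|)).
    by apply: (integrable_ext _ (integrableD _ i1 i2)).
  rewrite RintegralD //; last exact: L2r_integrable (L2r_cst _ _ _).
  rewrite RintegralD // Rintegral_cst_itv // RintegralZl //; last exact: L2r_integrable.
  by rewrite -/s -/m; ring.
rewrite subr_ge0 => ms; rewrite -(ger0_norm m0) -sqrtr_sqr.
exact: ler_wsqrtr.
Qed.

(** Riesz-Fischer: a subsequence with geometrically bounded increments converges almost everywhere,
    and the lemma of Fatou transfers the Cauchy bounds to the limit. *)
Lemma L2r_complete (u : nat -> R -> R) : (forall n, L2 (u n)) ->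
  (forall e, 0 < e -> exists N, forall m n, (N <= m)%N -> (N <= n)%N ->
    \int[mu]_(x in D) (u m x - u n x) ^+ 2 <= e) ->
  exists2 f, L2 f & forall e, 0 < e -> exists N, forall n, (N <= n)%N ->
    \int[mu]_(x in D) (u n x - f x) ^+ 2 <= e.
Proof.
move=> Lu cu.
have /choice[N hN] : forall k : nat, exists N, forall m n, (N <= m)%N -> (N <= n)%N ->
    \int[mu]_(x in D) (u m x - u n x) ^+ 2 <= (2^-1 ^+ k) ^+ 2.
  by move=> k; apply: cu; rewrite !exprn_gt0 // invr_gt0.
(* This index is nondecreasing and dominates both [N] and the identity; the latter serves to compare
   the subsequence with [u n]. *)
pose M k := (k + \sum_(j < k.+1) N j)%N.
have NM k : (N k <= M k)%N by rewrite /M big_ord_recr /= addnA leq_addl.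
have MS k : (M k <= M k.+1)%N by rewrite /M [\sum_(j < k.+2) _]big_ord_recr /= leq_add // leq_addr.
have Mk k : (k <= M k)%N by rewrite /M leq_addr.
pose g k := u (M k); pose d k x := g k.+1 x - g k x.
have Lg k : L2 (g k) by exact: Lu.
have Ld k : L2 (d k) by exact: L2rB.
have Lnd k : mu.-integrable D (EFin \o (fun x => `|d k x|)).
  exact: (integrable_abse (L2r_integrable (Ld k))).
have d_le k : \int[mu]_(x in D) `|d k x| <= 2^-1 ^+ k.
  apply: le_trans (Rintegral_norm_le (Ld k)) _.
  rewrite -[leRHS]ger0_norm ?exprn_ge0 ?invr_ge0 // -sqrtr_sqr ler_wsqrtr //.
  by apply: hN => //; exact: leq_trans (MS k).
pose S x := (\sum_(0 <= k <oo) (`|d k x|)%:E)%E.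
have intS : mu.-integrable D S.
  have S0 x : (0 <= S x)%E by apply: nneseries_ge0 => k _ _; rewrite lee_fin.
  apply/integrableP; split.
    apply: (@ge0_emeasurable_sum _ _ _ _ (fun k x => (`|d k x|)%:E) xpredT).
      by move=> k x _ _; rewrite lee_fin.
    by move=> k _; exact: (measurable_int mu (Lnd k)).
  under eq_integral do rewrite gee0_abs //.
  rewrite integral_nneseries //; last by move=> k; exact: (measurable_int mu (Lnd k)).
  apply: (@le_lt_trans _ _ 2%:E); last by rewrite ltry.
  apply: lime_le; first by apply: is_cvg_nneseries => k _ _; apply: integral_ge0 => x _; rewrite lee_fin.
  apply: nearW => n.
  have E k : (\int[mu]_(x in D) `|d k x|%:E = (\int[mu]_(x in D) `|d k x|)%:E)%E.
    by rewrite /Rintegral fineK //; exact: (integrable_fin_num _ (Lnd k)).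
  under eq_bigr do rewrite E.
  rewrite sumEFin lee_fin.
  (* The exact value of the geometric sum, since the bound 2 alone does not pass through the
     induction. *)
  suff : \sum_(0 <= k < n) \int[mu]_(x in D) `|d k x| <= 2 - 2 * 2^-1 ^+ n.
    have p0 : 0 <= (2^-1 : R) ^+ n by rewrite exprn_ge0 // invr_ge0.
    move: (\sum_(0 <= k < n) _) => s'; lra.
  elim: n => [|n IHn]; first by rewrite big_geq // expr0 mulr1 subrr.
  rewrite big_nat_recr //= exprS; move: IHn (d_le n).
  by move: (\sum_(0 <= k < n) _) (\int[mu]_(x in D) _) (2^-1 ^+ n) => s' i' q'; lra.
have Sfin : {ae mu, forall x, D x -> S x \is a fin_num}.
  exact: (integrable_ae _ intS).
have gcvg x : S x \is a fin_num -> cvgn (fun k => g k x).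
  move=> Sx.
  have : cvgn [normed series (fun k => d k x)].
    apply: nondecreasing_is_cvgn.
      by apply: nondecreasing_series => k /= _ _; exact: normr_ge0.
    exists (fine (S x)) => _ [n _ <-]; rewrite -lee_fin fineK // /series /= -sumEFin.
    by apply: (nneseries_lim_ge (P := xpredT)) => k _ _; rewrite lee_fin.
  move/normed_cvg; have -> : series (fun k => d k x) = fun n => g n x - g 0 x.
    by apply/funext => n; rewrite /series /= /d telescope_sumr.
  move=> /cvg_ex[l gl]; apply/cvg_ex; exists (l + g 0 x).
  have -> : (fun k => g k x) = (fun n => g n x - g 0 x + g 0 x).
    by apply/funext => n; rewrite subrK.
  by apply: cvgD => //; exact: cvg_cst.
(* The upper limit is measurable whether or not the sequence converges, and [fine] sends infinite
   values to 0. *)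
pose f x := fine (limn_esup (fun k => (g k x)%:E)).
have mf : measurable_fun D f.
  apply: (@measurable_comp _ _ _ _ _ _ setT fine) => //.

  apply: (@measurable_fun_limn_esup _ _ _ _ (fun k x => (g k x)%:E)) => k.
  by apply/measurable_EFinP; exact: (Lg k).1.
have fcvg x : cvgn (fun k => g k x) -> g k x @[k --> \oo] --> f x.
  move=> /cvg_ex[l gl]; rewrite /f.
  have gl' : (g k x)%:E @[k --> \oo] --> l%:E by apply: cvg_EFin => //; exact: nearW.
  by rewrite (cvg_limn_einf_sup gl').2.
have ae_cvg : {ae mu, forall x, D x -> g k x @[k --> \oo] --> f x}.
  by apply: ae_imp Sfin => x Sx xD; exact/fcvg/gcvg/Sx.
have key e n : 0 < e ->
    (forall m, (n <= m)%N -> \int[mu]_(x in D) (u n x - u m x) ^+ 2 <= e) ->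
    (\int[mu]_(x in D) ((u n x - f x) ^+ 2)%:E <= e%:E)%E.
  move=> e0 ne.
  (* The shift by [n] ensures [n <= M (k + n)], so that the hypothesis bounds every one of these
     integrals. *)
  pose w k x := ((u n x - g (k + n)%N x) ^+ 2)%:E.
  have Lw k : L2 (fun x => u n x - g (k + n)%N x) by exact: L2rB.
  have mw k : measurable_fun D (w k) by exact: (measurable_int mu (Lw k).2).
  have w0 k x : (0 <= w k x)%E by rewrite lee_fin sqr_ge0.
  have wf x : g k x @[k --> \oo] --> f x -> limn_einf (fun k => w k x) = ((u n x - f x) ^+ 2)%:E.
    move=> gf; have wl : w k x @[k --> \oo] --> ((u n x - f x) ^+ 2)%:E.
      apply: cvg_EFin; first exact: nearW.
      have gf' : g (k + n)%N x @[k --> \oo] --> f x.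
        exact: (cvg_comp _ _ (cvg_addnr n) gf).
      by rewrite expr2; apply: cvgM; apply: cvgB => //; exact: cvg_cst.
    by rewrite (cvg_limn_einf_sup wl).1.
  have -> : (\int[mu]_(x in D) ((u n x - f x) ^+ 2)%:E =
      \int[mu]_(x in D) limn_einf (fun k => w k x))%E.
    apply: ae_eq_integral => //.
    - apply/measurable_EFinP; apply: measurable_funX; apply: measurable_funB => //.
      exact: (Lu n).1.
    - rewrite (_ : (fun x => _) = (fun x => - limn_esup (fun k => - w k x))%E).
        have mo := @oppe_measurable R setT.
        have mNw k := measurableT_comp mo (mw k).
        exact (measurableT_comp mo (@measurable_fun_limn_esup _ _ _ _
          (fun k x => - w k x)%E mNw)).
      by apply/funext => x; rewrite -[RHS]oppeK limn_esupN !oppeK.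
    - by apply: ae_imp ae_cvg => x gf xD; rewrite wf //; exact: gf.
  apply: le_trans (fatou _ _ _ _) _ => //.
  rewrite limn_einf_lim; apply: lime_le; first exact: is_cvg_einfs.
  apply: nearW => k; apply: (@le_trans _ _ (\int[mu]_(x in D) w k x)%E).
    by apply: ereal_inf_lbound; exists k => /=.
  rewrite -[leLHS]fineK; last by apply: integrable_fin_num => //; exact: (Lw k).2.
  by rewrite lee_fin; apply: ne; rewrite (leq_trans _ (Mk _)) // leq_addl.
have Lf : L2 f.
  have [n hn] := cu 1 ltr01.
  have Lnf : L2 (fun x => u n x - f x).
    split; first by apply: measurable_funB => //; exact: (Lu n).1.
    apply/integrableP; split.
      apply/measurable_EFinP; apply: measurable_funX; apply: measurable_funB => //.
      exact: (Lu n).1.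
    under eq_integral do rewrite gee0_abs ?lee_fin ?sqr_ge0 //.
    apply: le_lt_trans (key 1 n ltr01 _) (ltry _) => m nm; exact: hn.
  by apply: L2r_ext (L2rB (Lu n) Lnf) => x _; rewrite subKr.
exists f => // e e0; have [n hn] := cu e e0; exists n => m nm.
have Lmf := L2rB (Lu m) Lf.
rewrite -lee_fin /Rintegral fineK; last by apply: integrable_fin_num => //; exact: Lmf.2.
by apply: key => // j mj; apply: hn => //; exact: leq_trans mj.
Qed.

End Completeness.

(** * Classes of square integrable functions as a real Hilbert space *)

Section EType.
Context {R : realType}.
Notation mu := (@lebesgue_measure R).
Implicit Types (f g h : R -> R).
Local Notation L2 := (L2r (0 : R) 1).

(* The elements of [L^2(0, 1)] are represented by their primitives, so that
   equality almost everywhere becomes Leibniz equality. *)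
Definition prim01 f : R -> R^o := fun x => prim 0 f (Num.min x 1).

Definition primL2 : {pred R -> R^o} := fun F => `[< exists2 f, L2 f & F = prim01 f >].

Lemma prim01D f g : L2 f -> L2 g -> prim01 (fun x => f x + g x) = prim01 f + prim01 g.
Proof.
move=> Lf Lg; apply/funext => x; rewrite /prim01 (@primD _ 0 1) ?ge_min ?lexx ?orbT //;
  exact: L2r_integrable.
Qed.

Lemma prim01Z k f : L2 f -> prim01 (fun x => k * f x) = k *: prim01 f.
Proof.
move=> Lf; apply/funext => x; rewrite /prim01 (@primZ _ 0 1) ?ge_min ?lexx ?orbT //;
  exact: L2r_integrable.
Qed.

Lemma primL2_submod_closed : submod_closed primL2.
Proof.
split=> [|k F G /asboolP[f Lf ->] /asboolP[g Lg ->]]; apply/asboolP.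
  exists (fun=> 0); first exact: L2r_cst.
  by apply/funext => x; rewrite /prim01 prim_eq0.
exists (fun x => k * f x + g x); first exact: L2rD (L2rZ k Lf) Lg.
by rewrite prim01D ?prim01Z //; exact: L2rZ.
Qed.

HB.instance Definition _ := GRing.isSubmodClosed.Build R (R -> R^o) primL2
  primL2_submod_closed.

Record L2space := MkL2space { L2val : R -> R^o; _ : L2val \in primL2 }.

HB.instance Definition _ := [isSub for L2val].
HB.instance Definition _ := [Choice of L2space by <:].
HB.instance Definition _ := [SubChoice_isSubLmodule of L2space by <:].

Definition rep (F : L2space) : R -> R := xget (fun=> 0) [set f | L2 f /\ L2val F = prim01 f].

(** The default 0 is never taken for square integrable [f]. *)
Definition cls f : L2space := insubd 0 (prim01 f).

Lemma repP F : L2 (rep F) /\ L2val F = prim01 (rep F).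
Proof.
have /asboolP[f Lf Ff] := valP F.
exact: (@xgetPex _ (fun=> 0) [set f | L2 f /\ L2val F = prim01 f] (ex_intro _ f (conj Lf Ff))).
Qed.

Lemma L2_rep F : L2 (rep F). Proof. exact: (repP F).1. Qed.

Lemma L2val_cls f : L2 f -> L2val (cls f) = prim01 f.
Proof. by move=> Lf; rewrite /cls (insubdK _) //; apply/asboolP; exists f. Qed.

Lemma prim01_inj f g : L2 f -> L2 g -> prim01 f = prim01 g -> eqr_ae 0 1 f g.
Proof.
move=> Lf Lg fg.
have Lh := L2rB Lf Lg; have intg := L2r_integrable Lg.
have : eqr_ae 0 1 (fun x => f x - g x) (fun=> 0).
  apply: prim_eq0_ae => //; first exact: L2r_integrable.
  move=> x x0 x1; have := congr1 (fun F : R -> R^o => F x) fg.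
  rewrite /prim01 /= (min_idPl x1) => fgx.
  have -> : prim 0 (fun t => f t - g t) x = prim 0 (fun t => f t + (-1) * g t) x.
    by apply: eq_Rintegral => t _; rewrite mulN1r.
  rewrite (primD x1 (L2r_integrable Lf)) ?(primZ _ x1) //.
    by rewrite fgx mulN1r subrr.
  exact: (L2r_integrable (L2rZ _ Lg)).
by apply: ae_imp => x fgx xD; have /eqP := fgx xD; rewrite subr_eq0 => /eqP.
Qed.

Lemma cls_eq f g : L2 f -> L2 g -> eqr_ae 0 1 f g -> cls f = cls g.
Proof.
move=> Lf Lg fg; apply: val_inj; rewrite /= !L2val_cls //.
apply/funext => x; rewrite /prim01; apply: (@eq_prim _ 0 1) => //.
- by rewrite ge_min lexx orbT.
- exact: Lf.1.
- exact: Lg.1.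
Qed.

Lemma rep_cls f : L2 f -> eqr_ae 0 1 (rep (cls f)) f.
Proof.
move=> Lf; have [Lr Er] := repP (cls f).
by apply: prim01_inj => //; rewrite -Er L2val_cls.
Qed.

Lemma cls_rep F : cls (rep F) = F.
Proof. by apply: val_inj; rewrite /= L2val_cls; [rewrite -(repP F).2|exact: L2_rep]. Qed.

Lemma cls_inj f g : L2 f -> L2 g -> cls f = cls g -> eqr_ae 0 1 f g.
Proof.
move=> Lf Lg fg; apply: eqr_ae_trans (rep_cls Lg).
by rewrite -fg; exact/eqr_ae_sym/rep_cls.
Qed.

Lemma clsD f g : L2 f -> L2 g -> cls (fun x => f x + g x) = cls f + cls g.
Proof.
move=> Lf Lg; apply: val_inj; rewrite /= !L2val_cls ?prim01D //; exact: L2rD.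
Qed.

Lemma clsZ k f : L2 f -> cls (fun x => k * f x) = k *: cls f.
Proof.
move=> Lf; apply: val_inj; rewrite /= !L2val_cls ?prim01Z //; exact: L2rZ.
Qed.

Lemma clsB f g : L2 f -> L2 g -> cls (fun x => f x - g x) = cls f - cls g.
Proof.
move=> Lf Lg; rewrite -scaleN1r -clsZ // -clsD //; last exact: L2rZ.
by congr cls; apply/funext => x; rewrite mulN1r.
Qed.

Definition ipL2 (F G : L2space) : R := \int[mu]_(x in `]0, 1[) (rep F x * rep G x).

Lemma ipL2E F G f g : L2 f -> L2 g -> cls f = F -> cls g = G ->
  ipL2 F G = \int[mu]_(x in `]0, 1[) (f x * g x).
Proof.
move=> Lf Lg <- <-; apply: eq_Rintegral_ae.
- by apply: measurable_funM; exact: (L2_rep _).1.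
- by apply: measurable_funM; [exact: Lf.1|exact: Lg.1].
apply: ae_imp (ae_and (rep_cls Lf) (rep_cls Lg)) => x [fx gx] xD.
by rewrite fx // gx.
Qed.

Lemma hilbert_L2 : hilbert ipL2.
Proof.
split.
- by move=> F G; apply: eq_Rintegral => x _; rewrite mulrC.
- move=> F G K.
  have LF := L2_rep F; have LG := L2_rep G; have LK := L2_rep K.
  rewrite (ipL2E (L2rD LF LG) LK) ?cls_rep //; last by rewrite clsD ?cls_rep.
  rewrite /ipL2 -RintegralD //; [|exact: L2r_mul..].
  by apply: eq_Rintegral => x _; rewrite mulrDl.
- move=> k F G; have LF := L2_rep F; have LG := L2_rep G.
  rewrite (ipL2E (L2rZ k LF) LG) ?cls_rep //; last by rewrite clsZ ?cls_rep.
  rewrite /ipL2 -RintegralZl //; last exact: L2r_mul.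
  by apply: eq_Rintegral => x _; rewrite mulrA.
- by move=> F; apply: Rintegral_ge0 => x _; rewrite -expr2 sqr_ge0.
- move=> F F0; have LF := L2_rep F.
  have : eqr_ae 0 1 (rep F) (fun=> 0).
    apply: Rintegral_sqr_eq0 => //; exact: F0.
  move/(cls_eq LF (L2r_cst 0 1 0)); rewrite cls_rep => ->.
  apply/eqP; rewrite -[cls _]subr0 subr_eq0; apply/eqP.
  have := clsZ 0 LF; rewrite cls_rep scale0r => <-; congr cls.
  by apply/funext => x; rewrite mul0r.
- move=> u cu.
  have normE (F G : L2space) g : L2 g -> cls g = G ->
      ipL2 (F - G) (F - G) = \int[mu]_(x in `]0, 1[) (rep F x - g x) ^+ 2.
    move=> Lg gG; have LFg := L2rB (L2_rep F) Lg.
    rewrite (ipL2E LFg LFg) ?clsB ?gG ?cls_rep //; exact: L2_rep.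
  have [n||f Lf uf] := @L2r_complete _ (fun n => rep (u n)); first exact: L2_rep.
    move=> e e0; have [N hN] := cu e e0; exists N => m n Nm Nn.
    by rewrite -(normE _ (u n)) ?hN ?cls_rep //; exact: L2_rep.
  exists (cls f) => e e0; have [N hN] := uf e e0; exists N => n Nn.
  by rewrite (normE _ _ _ Lf erefl) hN.
Qed.

End EType.

(** * The inverse of the generator *)

Section AbstractBeam.
Context {R : realType} {E : lmodType R} (ip : E -> E -> R) (G : E -> E) (kappa : E).
Context (a b alpha : R).
Hypothesis H : hilbert ip.
Hypotheses (a0 : 0 < a) (b0 : 0 < b) (alpha0 : 0 < alpha).
Hypothesis GD : forall x y, G (x + y) = G x + G y.
Hypothesis GZ : forall k x, G (k *: x) = k *: G x.
Hypothesis Gsym : forall x y, ip (G x) y = ip x (G y).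
Hypothesis Ginj : forall x, G x = 0 -> x = 0.
Hypothesis Gbounded : exists2 K, 0 <= K & forall x, nrm ip (G x) <= K * nrm ip x.
Implicit Types (x y z : E * E) (k K e : R).

Definition energy x y : R := a * ip x.1 y.1 + ip x.2 y.2.

Lemma energyC x y : energy x y = energy y x.
Proof. by rewrite /energy (ipC H) (ipC H x.2). Qed.

Lemma energy_ge0 x : 0 <= energy x x.
Proof. by rewrite addr_ge0 ?mulr_ge0 ?(ltW a0) ?(ip_ge0 H). Qed.

Lemma energy1_le x : a * ip x.1 x.1 <= energy x x.
Proof. by rewrite lerDl (ip_ge0 H). Qed.

Lemma energy2_le x : ip x.2 x.2 <= energy x x.
Proof. by rewrite lerDr mulr_ge0 ?(ltW a0) ?(ip_ge0 H). Qed.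

Lemma hilbert_energy : hilbert energy.
Proof.
split.
- exact: energyC.
- by move=> x y z; rewrite /energy /= !(ipDl H); ring.
- by move=> k x y; rewrite /energy /= !(ipZl H); ring.
- exact: energy_ge0.
- move=> [x1 x2] x0; have [x10 x20] : ip x1 x1 = 0 /\ ip x2 x2 = 0.
    have := energy1_le (x1, x2); have := energy2_le (x1, x2); rewrite x0 /=.
    have := ip_ge0 H x1; have := ip_ge0 H x2; move: (ip x1 x1) (ip x2 x2) => s t.
    move=> t0 s0 tle; rewrite pmulr_rle0 // => sle.
    by split; apply/eqP; rewrite eq_le ?s0 ?t0 ?sle ?tle.
  by rewrite (ip_eq0 H x10) (ip_eq0 H x20).
- move=> u cu.
  have [|l1 l1P] := @ip_complete _ _ _ H (fun n => (u n).1).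
    move=> e e0; have [N hN] := cu (a * e) (mulr_gt0 a0 e0); exists N => m n Nm Nn.
    rewrite -(ler_pM2l a0); apply: le_trans (energy1_le _) (hN m n Nm Nn).
  have [|l2 l2P] := @ip_complete _ _ _ H (fun n => (u n).2).
    move=> e e0; have [N hN] := cu e e0; exists N => m n Nm Nn.
    exact: le_trans (energy2_le _) (hN m n Nm Nn).
  exists (l1, l2) => e e0.
  have [|N1 hN1] := l1P (e / 2 / a); first by rewrite !divr_gt0.
  have [|N2 hN2] := l2P (e / 2); first by rewrite divr_gt0.
  exists (maxn N1 N2) => n; rewrite geq_max => /andP[n1 n2].
  have h1 := hN1 n n1; have h2 := hN2 n n2.
  rewrite ler_pdivlMr // mulrC in h1.
  by rewrite [leRHS]splitr /energy /= lerD.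
Qed.

Lemma nrm_energy1 x : nrm ip x.1 <= (Num.sqrt a)^-1 * nrm energy x.
Proof.
have sa : 0 < Num.sqrt a by rewrite sqrtr_gt0.
rewrite -(ler_pM2l sa) mulrA divff ?gt_eqF // mul1r -sqrtrM ?(ltW a0) //.
exact/ler_wsqrtr/energy1_le.
Qed.

Lemma nrm_energy2 x : nrm ip x.2 <= nrm energy x.
Proof. exact/ler_wsqrtr/energy2_le. Qed.

Lemma nrm_energy_le x : nrm energy x <= Num.sqrt a * nrm ip x.1 + nrm ip x.2.
Proof.
have sa : 0 <= Num.sqrt a * nrm ip x.1 by rewrite mulr_ge0 ?sqrtr_ge0.
apply: nrm_le_sqr.
  by rewrite addr_ge0 ?sqrtr_ge0.
rewrite sqrrD exprMn sqr_sqrtr ?(ltW a0) // !(nrm_sqr H) /energy addrAC lerDl.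
by rewrite mulrn_wge0 // mulr_ge0 ?sqrtr_ge0.
Qed.

(* The inverse of the generator in the coordinates [(u_xx, v)]: for [G] the Green
   operator, [v = G phi] and [a u_xx = - G g - b G v - alpha v(xi) kappa]
   integrate the equations [v = f] (with [phi = f_xx]) and
   [- a u_xxxx - b v - alpha v(xi) delta_xi = g] twice, and [v(xi) = <kappa, phi>]. *)
Definition beam_inv x : E * E :=
  (- a^-1 *: (G x.2 + b *: G (G x.1) + (alpha * ip kappa x.1) *: kappa), G x.1).

Local Ltac lmod := apply: (ip_inj H) => ?;
  rewrite ?(ipBl H, ipNl H, ipDl H, ipZl H, ip0l H); by first [ring | field].

Lemma beam_inv_linear : linear beam_inv.
Proof.
move=> k x y; rewrite /beam_inv; congr pair; rewrite /= ?(GD, GZ) //.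
by rewrite (ipDr H) (ipZr H); lmod.
Qed.

HB.instance Definition _ :=
  GRing.isLinear.Build R (E * E)%type (E * E)%type _ beam_inv beam_inv_linear.

(** The adjoint for [energy]: compared with [beam_inv], the coupling terms, which are skew, change
    sign, while the damping terms in [b] and [alpha], which are symmetric, keep theirs. *)
Definition beam_inv_adj x : E * E :=
  (a^-1 *: (G x.2 - b *: G (G x.1) - (alpha * ip kappa x.1) *: kappa), - G x.1).

Lemma beam_inv_adjE x : beam_inv_adj x =
  ((beam_inv (x.1, - x.2)).1, - (beam_inv (x.1, - x.2)).2).
Proof.
rewrite /beam_inv_adj /beam_inv /=; congr pair.
by rewrite -(scaleN1r x.2) GZ scaleN1r; lmod.
Qed.

Lemma energy_adj x y : energy x (beam_inv y) = energy (beam_inv_adj x) y.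
Proof.
have a_neq0 : a != 0 by rewrite gt_eqF.
rewrite /energy /= !(ipZl H, ipZr H, ipDr H, ipBl H, ipNl H) -!Gsym (ipC H x.1 kappa).
by field.
Qed.

Lemma beam_inv_inj x : beam_inv x = 0 -> x = 0.
Proof.
case: x => x1 x2 [] /= e1 /Ginj x10; rewrite x10 in e1 *.
have G0 : G 0 = 0 by have := GZ 0 0; rewrite !scale0r.
move: e1; rewrite !G0 scaler0 addr0 (ip0r H) mulr0 scale0r addr0 => /eqP.
by rewrite scaler_eq0 oppr_eq0 invr_eq0 gt_eqF //= => /eqP/Ginj ->.
Qed.

Lemma beam_inv_dissipative : dissipative_inverse energy beam_inv.
Proof.
have a_neq0 : a != 0 by rewrite gt_eqF.
split.
- have [K K0 hK] := Gbounded; set c := (Num.sqrt a)^-1; set n := nrm ip kappa.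
  have c0 : 0 <= c by rewrite invr_ge0 sqrtr_ge0.
  have n0 : 0 <= n by exact: nrm_ge0.
  (* One summand for each of the three terms of the first component; [c] compares the norm of [x.1]
     with the energy norm, and [n] is the norm of [kappa], counted once as a vector and once as a
     functional. *)
  pose M1 : R := a^-1 * (K + b * (K * (K * c)) + alpha * (n * (n * c))).
  exists (Num.sqrt a * M1 + K * c).
    have ai : 0 <= a^-1 by rewrite invr_ge0 ltW.
    have [bge age] := (ltW b0, ltW alpha0); have sa := sqrtr_ge0 a.
    by rewrite /M1; do ?[assumption|apply: addr_ge0|apply: mulr_ge0].
  move=> x; apply: le_trans (nrm_energy_le _) _; set N := nrm energy x.
  have x1 : nrm ip x.1 <= c * N by exact: nrm_energy1.
  have x2 : nrm ip x.2 <= N by exact: nrm_energy2.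
  have Gx1 : nrm ip (G x.1) <= K * (c * N) by apply: le_trans (hK _) _; rewrite ler_wpM2l.
  rewrite mulrDl -!mulrA; apply: lerD => //; rewrite ler_wpM2l ?sqrtr_ge0 //.
  rewrite /= (nrmZ H) normrN ger0_norm ?invr_ge0 ?(ltW a0) //.
  rewrite ler_wpM2l ?invr_ge0 ?(ltW a0) // !mulrDl -!mulrA.
  apply: le_trans (nrmD H _ _) _; apply: lerD.
    apply: le_trans (nrmD H _ _) _; apply: lerD.
      by apply: le_trans (hK _) _; rewrite ler_wpM2l.
    rewrite (nrmZ H) gtr0_norm // ler_wpM2l ?(ltW b0) //.
    by apply: le_trans (hK _) _; rewrite ler_wpM2l.
  rewrite (nrmZ H) normrM gtr0_norm // -!mulrA ler_wpM2l ?(ltW alpha0) // mulrC.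
  by rewrite ler_wpM2l //; apply: le_trans (cauchy_schwarz H _ _) _; rewrite ler_wpM2l.
- move=> x; rewrite /energy /= (ipZl H) !(ipDl H) !(ipZl H) (Gsym x.2) (Gsym (G _)).
  rewrite (ipC H (G x.1) x.2).
  (* The coupling terms cancel by symmetry of [G]. With [v = G x.1] what remains is the power lost
     to the distributed and the pointwise damping. *)
  rewrite [leLHS](_ : _ = - (b * ip (G x.1) (G x.1)) - alpha * ip kappa x.1 ^+ 2).
    have h1 : 0 <= b * ip (G x.1) (G x.1) by rewrite mulr_ge0 ?(ltW b0) ?(ip_ge0 H).
    have h2 : 0 <= alpha * ip kappa x.1 ^+ 2 by rewrite mulr_ge0 ?(ltW alpha0) ?sqr_ge0.
    by rewrite -opprD oppr_le0 addr_ge0.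
  by field.
- move=> z hz; have z0 : beam_inv_adj z = 0.
    by apply: (ip_inj hilbert_energy) => y; rewrite -energy_adj hz (ip0l hilbert_energy).
  move: z0; rewrite beam_inv_adjE => -[z1 /eqP]; rewrite oppr_eq0 => /eqP z2.
  have : beam_inv (z.1, - z.2) = 0 by rewrite /beam_inv /= z1 z2.
  move/beam_inv_inj => -[z10 /eqP]; rewrite oppr_eq0 => /eqP z20.
  by rewrite [LHS]surjective_pairing z10 z20.
- exact: beam_inv_inj.
Qed.

End AbstractBeam.

(** * The Green operator of the second derivative on functions *)

Section Green.
Context {R : realType}.
Notation mu := (@lebesgue_measure R).
Implicit Types (x y c k xi : R) (f g h phi : R -> R).
Local Notation D := [set` `](0 : R), 1[].
Local Notation L2 := (L2r (0 : R) 1).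
Local Notation int f := (mu.-integrable D (EFin \o f)).
Local Notation test := (test_function (0 : R) 1).

Lemma prim_cst c x : 0 <= x -> prim 0 (fun=> c) x = c * x.
Proof. by move=> x0; rewrite /prim Rintegral_cst_itv // subr0. Qed.

Lemma prim01_continuous f : int f -> {within `[0, 1], continuous (prim 0 f)}.
Proof. exact: prim_continuous ltr01. Qed.

Lemma prim_L2 f : int f -> L2 (prim 0 f).
Proof. by move=> intf; exact/L2r_continuous/prim01_continuous. Qed.

Lemma prim_integrable f : int f -> int (prim 0 f).
Proof. by move=> intf; exact/L2r_integrable/prim_L2. Qed.

(* The Green operator of the second derivative with Dirichlet conditions at 0
   and 1; [kern xi] below is its kernel. *)
Definition green h x := prim 0 (prim 0 h) x - x * prim 0 (prim 0 h) 1.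

(** The derivative of [green h]; its zero mean is what removes the boundary terms in the
    integrations by parts below. *)
Definition green_slope h x := prim 0 h x - prim 0 (prim 0 h) 1.

Lemma within_continuousD (p q : R) f g : {within `[p, q], continuous f} ->
  {within `[p, q], continuous g} -> {within `[p, q], continuous (fun x => f x + g x)}.
Proof. by move=> cf cg x; apply: cvgD; [exact: cf|exact: cg]. Qed.

Lemma within_continuousZ (p q : R) k f : {within `[p, q], continuous f} ->
  {within `[p, q], continuous (fun x => k * f x)}.
Proof. by move=> cf x; apply: cvgM; [exact: cvg_cst|exact: cf]. Qed.

Lemma within_continuous_cst (p q : R) k : {within `[p, q], continuous (fun=> k : R)}.
Proof. by move=> x; exact: cvg_cst. Qed.

Lemma within_continuous_id (p q : R) : {within `[p, q], continuous (fun x : R => x)}.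
Proof. by apply: continuous_subspaceT => x; exact: cvg_id. Qed.

Lemma green_slope_continuous h : int h -> {within `[0, 1], continuous (green_slope h)}.
Proof.
move=> inth; apply: within_continuousD; last exact: within_continuous_cst.
exact: prim01_continuous.
Qed.

Lemma green_slope_integrable h : int h -> int (green_slope h).
Proof. by move=> inth; exact/L2r_integrable/L2r_continuous/green_slope_continuous. Qed.

Lemma prim_add_cst f c x : int f -> x \in `[0, 1] ->
  prim 0 (fun t => f t + c) x = prim 0 f x + c * x.
Proof.
rewrite in_itv /= => intf /andP[x0 x1].
rewrite (primD x1 intf) ?prim_cst //; exact: (L2r_integrable (L2r_cst _ _ _)).
Qed.

Lemma green_prim h x : int h -> x \in `[0, 1] -> green h x = prim 0 (green_slope h) x.
Proof.
move=> inth x01; rewrite /green_slope prim_add_cst //; last exact: prim_integrable.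
by rewrite /green mulNr mulrC.
Qed.

Lemma green_left h : green h 0 = 0.
Proof. by rewrite /green prim_left mul0r subr0. Qed.

Lemma green_right h : green h 1 = 0.
Proof. by rewrite /green mul1r subrr. Qed.

Lemma green_continuous h : int h -> {within `[0, 1], continuous (green h)}.
Proof.
move=> inth; apply: within_continuousD.
  exact/prim01_continuous/prim_integrable.
have -> : (fun x => - (x * prim 0 (prim 0 h) 1)) = (fun x => - prim 0 (prim 0 h) 1 * x).
  by apply/funext => x; rewrite mulNr mulrC.
exact/within_continuousZ/within_continuous_id.
Qed.

Lemma L2_green h : int h -> L2 (green h).
Proof. by move=> inth; exact/L2r_continuous/green_continuous. Qed.

Lemma prim2D f g x : int f -> int g -> x <= 1 ->
  prim 0 (prim 0 (fun t => f t + g t)) x = prim 0 (prim 0 f) x + prim 0 (prim 0 g) x.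
Proof.
move=> intf intg x1; rewrite -(primD x1 (prim_integrable intf) (prim_integrable intg)).
apply: eq_Rintegral => t; rewrite inE /= in_itv /= => /andP[_ tx].
by rewrite (primD _ intf intg) // (le_trans (ltW tx)).
Qed.

Lemma prim2Z k f x : int f -> x <= 1 ->
  prim 0 (prim 0 (fun t => k * f t)) x = k * prim 0 (prim 0 f) x.
Proof.
move=> intf x1; rewrite -(primZ k x1 (prim_integrable intf)).
apply: eq_Rintegral => t; rewrite inE /= in_itv /= => /andP[_ tx].
by rewrite (primZ _ _ intf) // (le_trans (ltW tx)).
Qed.

Lemma greenD f g x : int f -> int g -> x <= 1 ->
  green (fun t => f t + g t) x = green f x + green g x.
Proof. move=> intf intg x1; rewrite /green (prim2D intf intg x1) (prim2D intf intg (lexx 1)).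
by move: (prim 0 (prim 0 f)) (prim 0 (prim 0 g)) => F G; ring. Qed.

Lemma greenZ k f x : int f -> x <= 1 -> green (fun t => k * f t) x = k * green f x.
Proof. move=> intf x1; rewrite /green (prim2Z k intf x1) (prim2Z k intf (lexx 1)).
by move: (prim 0 (prim 0 f)) => F; ring. Qed.

Lemma eq_green f g x : L2 f -> L2 g -> eqr_ae 0 1 f g -> x <= 1 -> green f x = green g x.
Proof.
move=> Lf Lg fg x1.
have e y : y <= 1 -> prim 0 f y = prim 0 g y.
  by move=> y1; apply: (eq_prim y1) => //; [exact: Lf.1|exact: Lg.1].
have e2 y : y <= 1 -> prim 0 (prim 0 f) y = prim 0 (prim 0 g) y.
  move=> y1; apply: eq_Rintegral => t; rewrite inE /= in_itv /= => /andP[_ ty].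
  by apply: e; rewrite (le_trans (ltW ty)).
by rewrite /green !e2.
Qed.

Lemma green_test phi x : test phi -> 0 <= x -> green (derive1 (derive1 phi)) x = phi x.
Proof.
move=> tphi; have tphi' := test_derive tphi.
have e y : 0 <= y -> prim 0 (prim 0 (derive1 (derive1 phi))) y = phi y.
  move=> y0; rewrite -(prim_test tphi y0); apply: eq_Rintegral => t.
  by rewrite inE /= in_itv /= => /andP[t0 _]; rewrite (prim_test tphi') // ltW.
by move=> x0; rewrite /green !e // (test_right tphi (lexx _)) mulr0 subr0.
Qed.

(** The condition [prim 0 f 1 = 0] cancels the boundary term and also leaves the constant [c] free;
    a suitable [c] turns a primitive into a [green_slope]. *)
Lemma prim_by_parts0 f h c : int f -> int h -> prim 0 f 1 = 0 ->
  \int[mu]_(x in D) (prim 0 f x * h x) = - \int[mu]_(x in D) (f x * (prim 0 h x + c)).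
Proof.
move=> intf inth f1; apply/eqP; rewrite -addr_eq0; apply/eqP.
have cp := prim01_continuous inth.
have -> : \int[mu]_(x in D) (f x * (prim 0 h x + c)) =
    \int[mu]_(x in D) (f x * prim 0 h x) + c * prim 0 f 1.
  rewrite -RintegralZl // -RintegralD //.
  - by apply: eq_Rintegral => x _; rewrite mulrDr (mulrC c).
  - exact: integrableM_continuous.
  - apply: integrable_ext (integrableZl _ c intf) => //.
by rewrite addrA prim_by_parts // f1 mul0r mulr0 addr0.
Qed.

Lemma green_slope_mass h : int h -> prim 0 (green_slope h) 1 = 0.
Proof. by move=> inth; rewrite -green_prim ?green_right // in_itv /= ler01 lexx. Qed.

(** The right-hand side is symmetric in [f] and [h], which yields [green_sym]. *)
Lemma green_by_parts f h : int f -> int h ->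
  \int[mu]_(x in D) (green f x * h x) =
  - \int[mu]_(x in D) (green_slope f x * green_slope h x).
Proof.
move=> intf inth.
rewrite -(@prim_by_parts0 _ _ (- prim 0 (prim 0 h) 1)) //.
- apply: eq_Rintegral => x; rewrite inE /= in_itv /= => /andP[x0 x1].
  by rewrite green_prim // in_itv /= !ltW.
- exact: green_slope_integrable.
- exact: green_slope_mass.
Qed.

Lemma green_sym f h : int f -> int h ->
  \int[mu]_(x in D) (green f x * h x) = \int[mu]_(x in D) (f x * green h x).
Proof.
move=> intf inth; rewrite (green_by_parts intf inth).
have -> : \int[mu]_(x in D) (f x * green h x) = \int[mu]_(x in D) (green h x * f x).
  by apply: eq_Rintegral => x _; rewrite mulrC.
have -> : \int[mu]_(x in D) (green_slope f x * green_slope h x) =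
    \int[mu]_(x in D) (green_slope h x * green_slope f x).
  by apply: eq_Rintegral => x _; rewrite mulrC.
exact: esym (green_by_parts inth intf).
Qed.

(** The positive part of [x - xi] has the Dirac mass at [xi] as second derivative, and the linear
    term restores the zero boundary values: this is the Green transform of the Dirac mass. *)
Definition kern xi x := Num.max (x - xi) 0 - x * (1 - xi).

Definition kern_slope xi x := (if xi < x then 1 else 0) - (1 - xi).

Section Kernel.
Context (xi : R) (xi0 : 0 < xi) (xi1 : xi < 1).

Lemma kern_le x : x <= xi -> kern xi x = - (1 - xi) * x.
Proof. by move=> xxi; rewrite /kern max_r ?subr_le0 //; ring. Qed.

Lemma kern_ge x : xi <= x -> kern xi x = xi * x - xi.
Proof. by move=> xxi; rewrite /kern max_l ?subr_ge0 //; ring. Qed.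

Lemma kern_slope_L2 : L2 (kern_slope xi).
Proof.
apply: L2rB; last exact: L2r_cst.
apply: (@L2r_split _ 0 xi 1) => //.
  apply: L2r_ext (L2r_cst _ _ 0) => x /=; rewrite in_itv /= => /andP[_ x1].
  by rewrite ltNge (ltW x1).
by apply: L2r_ext (L2r_cst _ _ 1) => x /=; rewrite in_itv /= => /andP[-> _].
Qed.

Lemma kern_prim x : x \in `[0, 1] -> kern xi x = prim 0 (kern_slope xi) x.
Proof.
rewrite in_itv /= => /andP[x0 x1]; have ints := L2r_integrable kern_slope_L2.
have low y : 0 <= y -> y <= xi -> prim 0 (kern_slope xi) y = - (1 - xi) * y.
  move=> y0 yxi; rewrite -prim_cst //; apply: eq_Rintegral => t.
  rewrite inE /= in_itv /= => /andP[_ ty]; rewrite /kern_slope ltNge.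
  by rewrite (le_trans (ltW ty)) //= sub0r.
have [xxi|xxi] := leP x xi; first by rewrite kern_le ?low.
rewrite kern_ge ?(ltW xxi) // (prim_split (ltW xi0) (ltW xxi) x1 ints) low ?(ltW xi0) //.
have -> : prim xi (kern_slope xi) x = \int[mu]_(t in `]xi, x[) (xi : R).
  apply: eq_Rintegral => t; rewrite inE /= in_itv /= => /andP[txi _].
  by rewrite /kern_slope txi; ring.
by rewrite Rintegral_cst_itv ?(ltW xxi) //; ring.
Qed.

Lemma kern_left : kern xi 0 = 0.
Proof. by rewrite kern_le ?ltW // mulr0. Qed.

Lemma kern_right : kern xi 1 = 0.
Proof. by rewrite kern_ge ?ltW // mulr1 subrr. Qed.

Lemma kern_continuous : {within `[0, 1], continuous (kern xi)}.
Proof.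
have ints := L2r_integrable kern_slope_L2.
apply: (@subspace_eq_continuous _ _ _ (prim 0 (kern_slope xi))).
  by move=> x /set_mem /= x01; exact: esym (kern_prim x01).
exact: prim01_continuous.
Qed.

Lemma L2_kern : L2 (kern xi).
Proof. exact/L2r_continuous/kern_continuous. Qed.

(** Reproducing property: the value at [xi] of a Green transform becomes a bounded functional of
    [h]. In this way [v(xi)] enters the inverse of the generator. *)
Lemma green_at h : int h -> \int[mu]_(x in D) (kern xi x * h x) = green h xi.
Proof.
move=> inth; have ints := L2r_integrable kern_slope_L2.
have -> : \int[mu]_(x in D) (kern xi x * h x) =
    \int[mu]_(x in D) (prim 0 (kern_slope xi) x * h x).
  apply: eq_Rintegral => x; rewrite inE /= in_itv /= => /andP[x0 x1].
  by rewrite kern_prim // in_itv /= !ltW.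
rewrite (@prim_by_parts0 _ _ 0) //; last first.
  by rewrite -kern_prim ?kern_right // in_itv /= ler01 lexx.
have intp := prim_integrable inth.
have intps : int (fun x => kern_slope xi x * prim 0 h x).
  exact: integrableM_continuous (prim01_continuous inth).
under eq_Rintegral do rewrite addr0.
rewrite (Rintegral_split xi0 xi1) //.
have -> : \int[mu]_(x in `]0, xi[) (kern_slope xi x * prim 0 h x) =
    - (1 - xi) * prim 0 (prim 0 h) xi.
  rewrite -(primZ _ (ltW xi1) intp); apply: eq_Rintegral => t.
  rewrite inE /= in_itv /= => /andP[_ txi].
  by rewrite /kern_slope ltNge (ltW txi) /= sub0r.
have -> : \int[mu]_(x in `]xi, 1[) (kern_slope xi x * prim 0 h x) =
    xi * prim xi (prim 0 h) 1.
  have intp' : mu.-integrable `]xi, 1[ (EFin \o prim 0 h).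
    exact/L2r_integrable/(L2rS (ltW xi0) (lexx _))/prim_L2.
  rewrite -(primZ _ (lexx 1) intp'); apply: eq_Rintegral => t.
  rewrite inE /= in_itv /= => /andP[txi _].
  by rewrite /kern_slope txi; congr (_ * _); ring.
have := prim_split (ltW xi0) (ltW xi1) (lexx 1) intp; rewrite /green => ->; ring.
Qed.

End Kernel.

Lemma prim_le f x : L2 f -> x \in `[0, 1] ->
  `|prim 0 f x| <= Num.sqrt (\int[mu]_(t in D) f t ^+ 2).
Proof.
rewrite in_itv /= => Lf /andP[x0 x1]; apply: le_trans (Rintegral_norm_le Lf).
have intf := L2r_integrable Lf.
have intn : int (fun t => `|f t|) by exact: (integrable_norm intf).
apply: le_trans (le_normr_Rintegral _ _) _ => //.
  exact: integrable_le x1 intf.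
have [->|x0'] := eqVneq x 0.
  by rewrite (_ : \int[mu]_(t in `]0, 0[) _ = prim 0 (fun t => `|f t|) 0) //
    prim_left; apply: Rintegral_ge0 => t _.
have := @prim_split _ 0 1 x 1 (fun t => `|f t|) x0 x1 (lexx _) intn.
rewrite /prim => ->; rewrite lerDl; apply: Rintegral_ge0 => t _; exact: normr_ge0.
Qed.

Lemma Rintegral_sqr_le f k : L2 f -> 0 <= k -> (forall x, D x -> `|f x| <= k) ->
  \int[mu]_(x in D) f x ^+ 2 <= k ^+ 2.
Proof.
move=> Lf k0 fk; have -> : k ^+ 2 = \int[mu]_(x in D) (k ^+ 2).
  by rewrite Rintegral_cst_itv // subr0 mulr1.
apply: le_Rintegral => //; first exact: Lf.2.
- exact: (L2r_integrable (L2r_cst _ _ _)).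
- by move=> x xD; rewrite -(real_normK (num_real (f x))) lerXn2r ?nnegrE ?fk.
Qed.

Lemma prim2_le h x : L2 h -> x \in `[0, 1] -> `|prim 0 (prim 0 h) x| <= Num.sqrt (\int[mu]_(t in D) h t ^+ 2).
Proof.
move=> Lh x01; have inth := L2r_integrable Lh.
apply: le_trans (prim_le (prim_L2 inth) x01) _.
rewrite -[leRHS]ger0_norm ?sqrtr_ge0 // -sqrtr_sqr; apply: ler_wsqrtr.
apply: Rintegral_sqr_le; rewrite ?sqrtr_ge0 //; first exact: prim_L2.
by move=> t /= t01; apply: (prim_le Lh); apply: subset_itv_oo_cc.
Qed.

Lemma green_le h x : L2 h -> x \in `[0, 1] ->
  `|green h x| <= 2 * Num.sqrt (\int[mu]_(t in D) h t ^+ 2).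
Proof.
move=> Lh; set N := Num.sqrt _.
have p2 y : y \in `[0, 1] -> `|prim 0 (prim 0 h) y| <= N by exact: prim2_le.
move=> x01; apply: le_trans (ler_normB _ _) _; rewrite normrM mulr_natl mulr2n.
apply: lerD; first exact: p2.
have := p2 1; rewrite in_itv /= ler01 lexx => /(_ isT) p21.
move: x01; rewrite in_itv /= => /andP[x0 x1].
by rewrite -[leRHS]mul1r ler_pM // ger0_norm.
Qed.

End Green.

(** * The Green operator and the inverse of the generator on classes *)

Section GreenOperator.
Context {R : realType}.
Notation mu := (@lebesgue_measure R).
Implicit Types (f g h phi : R -> R) (F G : @L2space R).
Local Notation D := [set` `](0 : R), 1[].
Local Notation L2 := (L2r (0 : R) 1).
Local Notation int f := (mu.-integrable D (EFin \o f)).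

Definition gl F : L2space := cls (green (rep F)).

Lemma rep_int F : int (rep F).
Proof. exact/L2r_integrable/L2_rep. Qed.

Lemma gl_cls f : L2 f -> gl (cls f) = cls (green f).
Proof.
move=> Lf; have intf := L2r_integrable Lf.
apply: cls_eq; [exact/L2_green/rep_int|exact: L2_green|].
apply: eqr_aeW => x /=; rewrite in_itv /= => /andP[_ x1].
by apply: eq_green; [exact: L2_rep|exact: Lf|exact: rep_cls|exact: ltW].
Qed.

Lemma L2_oo_ext (f g : R -> R) : (forall x, x <= 1 -> f x = g x) -> L2 f -> L2 g ->
  cls f = cls g.
Proof.
move=> fg Lf Lg; apply: cls_eq Lf Lg _; apply: eqr_aeW => x /=.
by rewrite in_itv /= => /andP[_ /ltW /fg].
Qed.

Lemma glD F G : gl (F + G) = gl F + gl G.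
Proof.
have [LF LG] := (L2_rep F, L2_rep G); have [iF iG] := (rep_int F, rep_int G).
rewrite -{1}(cls_rep F) -{1}(cls_rep G) -clsD // gl_cls; last exact: L2rD.
rewrite /gl -clsD; [|exact: L2_green..].
apply: L2_oo_ext => [x x1||]; first exact: greenD.
  exact/L2_green/L2r_integrable/L2rD.
by apply: L2rD; exact: L2_green.
Qed.

Lemma glZ k F : gl (k *: F) = k *: gl F.
Proof.
have LF := L2_rep F; have iF := rep_int F.
rewrite -{1}(cls_rep F) -clsZ // gl_cls; last exact: L2rZ.
rewrite /gl -clsZ; last exact: L2_green.
apply: L2_oo_ext => [x x1||]; first exact: greenZ.
  exact/L2_green/L2r_integrable/L2rZ.
by apply: L2rZ; exact: L2_green.
Qed.

Lemma gl_sym F G : ipL2 (gl F) G = ipL2 F (gl G).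
Proof.
have [LF LG] := (L2_rep F, L2_rep G); have [iF iG] := (rep_int F, rep_int G).
rewrite (@ipL2E _ (gl F) G (green (rep F)) (rep G)) ?cls_rep //; last exact: L2_green.
rewrite (@ipL2E _ F (gl G) (rep F) (green (rep G))) ?cls_rep //; last exact: L2_green.
exact: green_sym.
Qed.

Lemma cls0 : cls (fun=> 0 : R) = 0.
Proof.
rewrite -[RHS](scale0r (cls (fun=> 0))) -clsZ; last exact: L2r_cst.
congr cls.
by apply/funext => x; rewrite mul0r.
Qed.

(** A test function is the Green transform of its second derivative, so by symmetry the integral of
    [F] against it is the integral of [gl F] against that second derivative. *)
Lemma gl_inj F : gl F = 0 -> F = 0.
Proof.
have LF := L2_rep F; have iF := rep_int F.
have LG := L2_green iF; have L0 := L2r_cst (0 : R) 1 0.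
rewrite -cls0 => /(cls_inj LG L0) GF.
rewrite -{1}(cls_rep F); apply: cls_eq => //.
apply: test_orthogonal_eq0 => // phi tphi.
have Lphi := L2r_test (test_derive (test_derive tphi)).
have iphi := L2r_integrable Lphi.
transitivity (\int[mu]_(x in D) (rep F x * green (derive1 (derive1 phi)) x)).
  apply: eq_Rintegral => x; rewrite inE /= in_itv /= => /andP[x0 _].
  by rewrite green_test // ltW.
rewrite -green_sym //.
transitivity (\int[mu]_(x in D) (0 : R)); last by rewrite Rintegral_cst_itv // mul0r.
apply: eq_Rintegral_ae.
- exact: measurable_funM LG.1 Lphi.1.
- exact: L0.1.
by apply: ae_imp GF => x Gx xD; rewrite Gx // mul0r.
Qed.

Lemma nrm_cls f : L2 f -> nrm ipL2 (cls f) = Num.sqrt (\int[mu]_(x in D) f x ^+ 2).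
Proof. by move=> Lf; rewrite /nrm (@ipL2E _ _ _ f f). Qed.

Lemma nrm_rep F : nrm ipL2 F = Num.sqrt (\int[mu]_(x in D) rep F x ^+ 2).
Proof. by rewrite -nrm_cls ?cls_rep //; exact: L2_rep. Qed.

Lemma gl_bounded : exists2 K : R, 0 <= K & forall F, nrm ipL2 (gl F) <= K * nrm ipL2 F.
Proof.
exists 2 => // F; have LF := L2_rep F; have iF := rep_int F; have LG := L2_green iF.
have n0 : 0 <= 2 * nrm ipL2 F by rewrite mulr_ge0 ?sqrtr_ge0.
rewrite nrm_cls // -[leRHS]ger0_norm // -sqrtr_sqr; apply: ler_wsqrtr.
apply: Rintegral_sqr_le => // x xD; rewrite nrm_rep.
by apply: green_le => //; apply: subset_itv_oo_cc.
Qed.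

Context (a b alpha xi : R).
Hypotheses (a0 : 0 < a) (b0 : 0 < b) (alpha0 : 0 < alpha).
Hypotheses (xi0 : 0 < xi) (xi1 : xi < 1).
Local Notation X := (@L2space R * @L2space R)%type.

Definition kap : L2space := cls (kern xi).

Lemma kapE F : ipL2 kap F = green (rep F) xi.
Proof.
rewrite (@ipL2E _ kap F (kern xi) (rep F)) ?cls_rep //; last 2 first.
- exact: L2_kern.
- exact: L2_rep.
by apply: green_at => //; exact: rep_int.
Qed.

Lemma kap_cls f : L2 f -> ipL2 kap (cls f) = green f xi.
Proof.
move=> Lf; rewrite (@ipL2E _ kap _ (kern xi) f) //; last exact: L2_kern.
by apply: green_at => //; exact: L2r_integrable.
Qed.

Definition ipH : X -> X -> R := energy ipL2 a.

Definition opT : X -> X := beam_inv ipL2 gl kap a b alpha.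

Definition opTadj : X -> X := beam_inv_adj ipL2 gl kap a b alpha.

Lemma hilbert_H : hilbert ipH.
Proof. exact: hilbert_energy hilbert_L2 a0. Qed.

Lemma opT_adj x y : ipH x (opT y) = ipH (opTadj x) y.
Proof. exact: (energy_adj kap b alpha hilbert_L2 a0 gl_sym). Qed.

Lemma opT_inj x : opT x = 0 -> x = 0.
Proof. exact: (beam_inv_inj hilbert_L2 a0 glZ gl_inj). Qed.

Lemma opT_flow_exists x : exists Z : R -> X,
  [/\ Z 0 = x, curve_continuous ipH Z & curve_derivative ipH (fun t => opT (Z t)) Z].
Proof.
exact: (flow_exists hilbert_H (beam_inv_dissipative kap hilbert_L2 a0 b0 alpha0
  glD glZ gl_sym gl_inj gl_bounded)).
Qed.

Lemma opT_flow_unique (Z : R -> X) :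
  curve_derivative ipH (fun t => opT (Z t)) Z -> opT (Z 0) = 0 ->
  forall t, 0 <= t -> Z t = 0.
Proof.
move=> dZ Z0 t t0; apply: opT_inj; move: t t0.
exact: (flow_unique hilbert_H (beam_inv_dissipative kap hilbert_L2 a0 b0 alpha0
  glD glZ gl_sym gl_inj gl_bounded)).
Qed.

Lemma opTB x y : opT (x - y) = opT x - opT y.
Proof.
have := beam_inv_linear kap a b alpha hilbert_L2 glD glZ (- 1) y x.
by rewrite !scaleN1r ![- _ + _]addrC.
Qed.

End GreenOperator.

(** * Weak derivatives and the energy space *)

Section RealWeakDerivative.
Context {R : realType}.
Notation mu := (@lebesgue_measure R).
Implicit Types (p q x y c k : R) (n : nat) (f g h phi : R -> R).

Definition rweak p q n f g : Prop := L2r p q g /\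
  forall phi, test_function p q phi ->
    (-1) ^+ n * \int[mu]_(x in `]p, q[) (f x * derive1n n phi x) =
    \int[mu]_(x in `]p, q[) (g x * phi x).

Lemma testn p q n phi : test_function p q phi -> test_function p q (derive1n n phi).
Proof. by move=> tphi; elim: n => //= n; exact: test_derive. Qed.

Lemma L2r_testM p q f phi : L2r p q f -> test_function p q phi ->
  mu.-integrable `]p, q[ (EFin \o (fun x => f x * phi x)).
Proof. by move=> Lf tphi; exact: L2r_mul Lf (L2r_test tphi). Qed.

Lemma rweak_unique p q n f g h : p < q -> rweak p q n f g -> rweak p q n f h ->
  eqr_ae p q g h.
Proof.
move=> pq [Lg gP] [Lh hP].
have gh0 : eqr_ae p q (fun x => g x - h x) (fun=> 0).
  apply: test_orthogonal_eq0 => // [|phi tphi]; first exact/L2r_integrable/L2rB.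
  transitivity (\int[mu]_(x in `]p, q[) (g x * phi x) -
                \int[mu]_(x in `]p, q[) (h x * phi x)).
    rewrite -RintegralB //; [|exact: L2r_testM..].
    by apply: eq_Rintegral => x _; rewrite mulrBl.
  by rewrite -(gP _ tphi) -(hP _ tphi) subrr.
by apply: ae_imp gh0 => x e xD; apply/eqP; rewrite -subr_eq0 e.
Qed.

Lemma rweak0 p q f : L2r p q f -> rweak p q 0 f f.
Proof.
move=> Lf; split; first exact: Lf.
by move=> phi _; rewrite expr0 mul1r.
Qed.

Lemma rweak_step p q n f g h : rweak p q n f g -> rweak p q n.+1 f h ->
  rweak p q 1 g h.
Proof.
move=> [_ gP] [Lh hP]; split; first exact: Lh.
move=> phi tphi; have := gP _ (test_derive tphi); have := hP _ tphi.
by rewrite derive1Sn exprS -mulrA expr1 => <- ->.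
Qed.

Lemma rweak_comp p q n f g h : rweak p q n f g -> rweak p q 1 g h ->
  rweak p q n.+1 f h.
Proof.
move=> [_ gP] [Lh hP]; split; first exact: Lh.
move=> phi tphi; have := gP _ (test_derive tphi); have := hP _ tphi.
by rewrite [derive1n n.+1 _]derive1Sn [_ ^+ n.+1]exprS -mulrA => <- ->; rewrite expr1.
Qed.

Lemma rweak_prim p q f g : p < q -> L2r p q f -> rweak p q 1 f g ->
  exists c, eqr_ae p q f (fun x => c + prim p g x).
Proof.
move=> pq Lf [Lg gP]; apply: prim_weak_derive; [exact: pq|exact: L2r_integrable|exact: L2r_integrable|].
by move=> phi tphi; rewrite -(gP _ tphi) expr1 mulN1r opprK.
Qed.

Lemma prim_rweak p q c f g : p < q -> L2r p q f -> L2r p q g ->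
  eqr_ae p q f (fun x => c + prim p g x) -> rweak p q 1 f g.
Proof.
move=> pq Lf Lg fg; split; first exact: Lg.
move=> phi tphi; rewrite expr1 mulN1r.
by rewrite (weak_derive_prim pq Lf.1 (L2r_integrable Lg) fg tphi) opprK.
Qed.

Lemma rweakD p q n f g f' g' : L2r p q f -> L2r p q f' -> rweak p q n f g ->
  rweak p q n f' g' -> rweak p q n (fun x => f x + f' x) (fun x => g x + g' x).
Proof.
move=> Lf Lf' [Lg gP] [Lg' gP']; split; first exact: L2rD.
move=> phi tphi; have tn := testn n tphi.
have eD (u v w : R -> R) : L2r p q u -> L2r p q v -> test_function p q w ->
    \int[mu]_(x in `]p, q[) ((u x + v x) * w x) =
    \int[mu]_(x in `]p, q[) (u x * w x) + \int[mu]_(x in `]p, q[) (v x * w x).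
  move=> Lu Lv tw; rewrite -RintegralD //; [|exact: L2r_testM..].
  by apply: eq_Rintegral => x _; rewrite mulrDl.
by rewrite (eD _ _ _ Lf Lf' tn) (eD _ _ _ Lg Lg' tphi) mulrDr (gP _ tphi) (gP' _ tphi).
Qed.

Lemma rweakZ p q n k f g : L2r p q f -> rweak p q n f g ->
  rweak p q n (fun x => k * f x) (fun x => k * g x).
Proof.
move=> Lf [Lg gP]; split; first exact: L2rZ.
move=> phi tphi; have tn := testn n tphi.
have eZ (u w : R -> R) : L2r p q u -> test_function p q w ->
    \int[mu]_(x in `]p, q[) ((k * u x) * w x) = k * \int[mu]_(x in `]p, q[) (u x * w x).
  move=> Lu tw; rewrite -RintegralZl //; last exact: L2r_testM.
  by apply: eq_Rintegral => x _; rewrite mulrA.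
by rewrite (eZ _ _ Lf tn) (eZ _ _ Lg tphi) mulrCA (gP _ tphi).
Qed.

Lemma rweak_ae p q n f f' g : L2r p q f -> L2r p q f' -> eqr_ae p q f f' ->
  rweak p q n f g -> rweak p q n f' g.
Proof.
move=> Lf Lf' ff' [Lg gP]; split; first exact: Lg.
move=> phi tphi; rewrite -(gP _ tphi).
have -> // : \int[mu]_(x in `]p, q[) (f' x * derive1n n phi x) =
    \int[mu]_(x in `]p, q[) (f x * derive1n n phi x).
have Lphi := L2r_test (testn n tphi).
apply: eq_Rintegral_ae; [exact: measurable_funM Lf'.1 Lphi.1|
  exact: measurable_funM Lf.1 Lphi.1|].
by apply: ae_imp ff' => x e xD; rewrite e.
Qed.

Lemma rweak_ae_r p q n f g g' : L2r p q g' -> eqr_ae p q g g' ->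
  rweak p q n f g -> rweak p q n f g'.
Proof.
move=> Lg' gg' [Lg gP]; split; first exact: Lg'.
move=> phi tphi; rewrite (gP _ tphi).
have Lphi := L2r_test tphi.
apply: eq_Rintegral_ae; [exact: measurable_funM Lg.1 Lphi.1|
  exact: measurable_funM Lg'.1 Lphi.1|].
by apply: ae_imp gg' => x e xD; rewrite e.
Qed.

Lemma testS p q p' q' phi : p <= p' -> q' <= q -> test_function p' q' phi ->
  test_function p q phi.
Proof.
move=> pp qq [sm [c [d [pc cd dq z]]]]; split=> //; exists c, d; split=> //.
- exact: le_lt_trans pp pc.
- exact: lt_le_trans dq qq.
Qed.

Lemma Rintegral_testS p q p' q' f phi : p <= p' -> q' <= q ->
  test_function p' q' phi ->
  \int[mu]_(x in `]p, q[) (f x * phi x) = \int[mu]_(x in `]p', q'[) (f x * phi x).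
Proof.
move=> pp qq tphi; rewrite Rintegral_mkcond [RHS]Rintegral_mkcond.
apply: eq_Rintegral => x _; rewrite /patch.
have [xin|xin] := boolP (x \in `]p', q'[%classic).
  rewrite ifT //; move: xin; rewrite !inE /= !in_itv /= => /andP[x0 x1].
  by rewrite (le_lt_trans pp x0) (lt_le_trans x1 qq).
case: ifP => // _; have -> : phi x = 0; last by rewrite mulr0.
have [h|h] := leP x p'; first exact: test_left tphi h.
have [h'|h'] := leP q' x; first exact: test_right tphi h'.
by case/negP: xin; rewrite inE /= in_itv /= h h'.
Qed.

Lemma rweakS p q p' q' n f g : p <= p' -> q' <= q -> rweak p q n f g ->
  rweak p' q' n f g.
Proof.
move=> pp qq [Lg gP]; split; first exact: L2rS Lg.
move=> phi tphi; rewrite -(Rintegral_testS _ pp qq (testn n tphi)).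
by rewrite -(Rintegral_testS _ pp qq tphi) (gP _ (testS pp qq tphi)).
Qed.

End RealWeakDerivative.

(** * Reduction to real and imaginary parts *)

Section ComplexParts.
Context {R : realType}.
Notation mu := (@lebesgue_measure R).
Implicit Types (p q x y c k : R) (n : nat) (f g : R -> R[i]) (z w : R[i]) (s : bool).

(* All coefficients are real, so that the real part ([s = false]) and the
   imaginary part ([s = true]) decouple. *)
Definition part s z : R := if s then complex.Im z else complex.Re z.

Definition fpart s f x : R := part s (f x).

Definition mkC (g : bool -> R -> R) x : R[i] := Complex (g false x) (g true x).

Lemma fpart_mkC s (g : bool -> R -> R) : fpart s (mkC g) = g s.
Proof. by case: s. Qed.

Lemma part_eq z w : (forall s, part s z = part s w) -> z = w.
Proof. by case: z w => [z1 z2] [w1 w2] e; rewrite (e false : z1 = w1) (e true : z2 = w2). Qed.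

Lemma partD s z w : part s (z + w) = part s z + part s w.
Proof. by case: s z w => [] [z1 z2] [w1 w2]. Qed.

Lemma partN s z : part s (- z) = - part s z.
Proof. by case: s z => [] [z1 z2]. Qed.

Lemma partB s z w : part s (z - w) = part s z - part s w.
Proof. by rewrite partD partN. Qed.

Lemma part0 s : part s 0 = 0.
Proof. by case: s. Qed.

Lemma partZ s k z : part s (k%:C%C * z) = k * part s z.
Proof. by case: s z => [] [z1 z2] /=; rewrite mul0r ?addr0 ?subr0. Qed.

Lemma partZr s z k : part s (z * k%:C%C) = part s z * k.
Proof. by rewrite mulrC partZ mulrC. Qed.

Lemma part_sign s n z : part s ((-1) ^+ n * z) = (-1) ^+ n * part s z.
Proof.
elim: n z => [|n IHn] z; first by rewrite !expr0 !mul1r.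
by rewrite !exprS -!mulrA !mulN1r partN IHn.
Qed.

Lemma part_integralC s (D : set R) f :
  part s (integralC D f) = \int[mu]_(x in D) fpart s f x.
Proof. by case: s. Qed.

Lemma L2P p q f : L2 p q f <-> forall s, L2r p q (fpart s f).
Proof.
split=> [[mR mI intf] s|Lf].
  have ms : measurable_fun `]p, q[ (fpart s f) by case: s.
  split=> //; apply: le_integrable intf => //.
    by apply/measurable_EFinP; exact: measurable_funX.
  move=> x _; rewrite !gee0_abs ?lee_fin ?addr_ge0 ?sqr_ge0 //.
  by case: s {ms}; rewrite /fpart /part ?lerDl ?lerDr sqr_ge0.
have [m0 i0] := Lf false; have [m1 i1] := Lf true; split=> //.
exact: integrable_ext (integrableD _ i0 i1).
Qed.

Lemma eq_aeP p q f g : eq_ae p q f g <-> forall s, eqr_ae p q (fpart s f) (fpart s g).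
Proof.
split=> [fg s|fg]; first by apply: ae_imp fg => x e xD; rewrite /fpart e.
apply: ae_imp (ae_and (fg false) (fg true)) => x [e0 e1] xD.
by apply: part_eq => -[]; [exact: e1|exact: e0].
Qed.

Lemma is_weak_derivP p q n f g : is_weak_deriv p q n f g <->
  forall s, rweak p q n (fpart s f) (fpart s g).
Proof.
have e s (h : R -> R[i]) phi : part s (dist_fun p q h phi) =
    \int[mu]_(x in `]p, q[) (fpart s h x * phi x).
  by rewrite part_integralC; apply: eq_Rintegral => x _; rewrite /fpart partZr.
split=> [[/L2P Lg gP] s|fg].
  split; first exact: Lg.
  by move=> phi tphi; have := congr1 (part s) (gP phi tphi); rewrite part_sign !e.
split; first by apply/L2P => s; exact: (fg s).1.
by move=> phi tphi; apply: part_eq => s; rewrite part_sign !e (fg s).2.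
Qed.

(** Once weak derivatives of both parts are exhibited, the choice in [weak_deriv] is a genuine weak
    derivative, and uniqueness identifies it almost everywhere with them. *)
Lemma weak_deriv_eq p q n f (g : bool -> R -> R) : p < q ->
  (forall s, rweak p q n (fpart s f) (g s)) ->
  forall s, rweak p q n (fpart s f) (fpart s (weak_deriv p q n f)) /\
    eqr_ae p q (g s) (fpart s (weak_deriv p q n f)).
Proof.
move=> pq fg.
have /is_weak_derivP wf : is_weak_deriv p q n f (weak_deriv p q n f).
  apply: (@xgetPex _ (fun=> 0) [set g | is_weak_deriv p q n f g]).
  by exists (mkC g); apply/is_weak_derivP => s; rewrite fpart_mkC.
by move=> s; split; [exact: wf|exact: rweak_unique pq (fg s) (wf s)].
Qed.

Lemma sobolev_rweak (k : nat) p q f n s : sobolev k p q f -> (n <= k)%N ->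
  rweak p q n (fpart s f) (fpart s (weak_deriv p q n f)).
Proof.
move=> [Lf Hf] nk; move: s; apply/is_weak_derivP.
exact: (@xgetPex _ (fun=> 0) [set g | is_weak_deriv p q n f g] (Hf n nk)).
Qed.

Lemma rweak_sobolev (k : nat) p q f : (forall s, L2r p q (fpart s f)) ->
  (forall n s, (0 < n <= k)%N -> exists g : R -> R, rweak p q n (fpart s f) g) -> sobolev k p q f.
Proof.
move=> Lf Hf; split; first exact/L2P.
move=> [|n] nk.
  by exists f; apply/is_weak_derivP => s; apply: rweak0.
have /choice[g gP] s : exists g : R -> R, rweak p q n.+1 (fpart s f) g by exact: Hf.
by exists (mkC g); apply/is_weak_derivP => s; rewrite fpart_mkC.
Qed.

(** Continuous functions that agree almost everywhere agree on the closed interval, so the chosen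
    representative has the values of any explicit continuous one, end points included. *)
Lemma cont_repE p q f (g : bool -> R -> R) : p < q ->
  (forall s, {within `[p, q], continuous (g s)}) ->
  (forall s, eqr_ae p q (g s) (fpart s f)) ->
  forall s x, x \in `[p, q] -> part s (cont_rep p q f x) = g s x.
Proof.
move=> pq cg gf s x xpq.
have [cR cI /eq_aeP rf] : [/\ {within `[p, q], continuous (fpart false (cont_rep p q f))},
    {within `[p, q], continuous (fpart true (cont_rep p q f))} &
    eq_ae p q (cont_rep p q f) f].
  apply: (@xgetPex _ (fun=> 0)
    [set g | [/\ {within `[p, q], continuous (fpart false g)},
    {within `[p, q], continuous (fpart true g)} & eq_ae p q g f]]).
  exists (mkC g); split; rewrite ?fpart_mkC //.
  by apply/eq_aeP => s'; rewrite fpart_mkC.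
have cs : {within `[p, q], continuous (fpart s (cont_rep p q f))} by case: s.
apply: (continuous_ae_eq pq cs (cg s)) xpq.
exact: eqr_ae_trans (rf s) (eqr_ae_sym (gf s)).
Qed.

End ComplexParts.

(** * Boundary traces, H^1_0 and the energy space *)

Section EnergySpace.
Context {R : realType}.
Notation mu := (@lebesgue_measure R).
Implicit Types (p q x y c k : R) (s : bool) (h phi : R -> R).
Local Notation D := [set` `](0 : R), 1[].
Local Notation L2 := (L2r (0 : R) 1).
Local Notation "''|' h |" := (Num.sqrt (\int[mu]_(x in D) h x ^+ 2)) (at level 0, h at level 99).
Local Notation int f := (mu.-integrable D (EFin \o f)).
Local Notation test := (test_function (0 : R) 1).

Lemma green_rweak1 h : int h -> rweak 0 1 1 (green h) (green_slope h).
Proof.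
move=> inth; apply: (@prim_rweak _ _ _ 0) ltr01 (L2_green inth) _ _.
  exact/L2r_continuous/green_slope_continuous.
apply: eqr_aeW => x /subset_itv_oo_cc x01; rewrite add0r; exact: green_prim.
Qed.

Lemma green_slope_rweak1 h : L2 h -> rweak 0 1 1 (green_slope h) h.
Proof.
move=> Lh; have inth := L2r_integrable Lh.
apply: (@prim_rweak _ _ _ (- prim 0 (prim 0 h) 1)) ltr01 _ Lh _.
  exact/L2r_continuous/green_slope_continuous.
by apply: eqr_aeW => x _; rewrite /green_slope addrC.
Qed.

Lemma green_rweak2 h : L2 h -> rweak 0 1 2 (green h) h.
Proof.
move=> Lh; apply: rweak_comp (green_slope_rweak1 Lh).
exact/green_rweak1/L2r_integrable.
Qed.

Lemma rweak2_prim p q (f f1 h : R -> R) : p < q -> L2r p q f -> rweak p q 1 f f1 ->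
  rweak p q 2 f h -> exists c d : R,
  eqr_ae p q f (fun x => c + prim p (fun t => d + prim p h t) x) /\
  eqr_ae p q f1 (fun t => d + prim p h t).
Proof.
move=> pq Lf wf wh; have w1 := rweak_step wf wh.
have [c fc] := rweak_prim pq Lf wf; have [d f1d] := rweak_prim pq wf.1 w1.
exists c, d; split=> //; apply: eqr_ae_trans fc _; apply: eqr_aeW => x /=.
rewrite in_itv /= => /andP[_ /ltW xq]; congr (_ + _).
apply: (eq_prim xq) f1d; first exact: wf.1.1.
apply: (L2r_continuous _).1; apply: within_continuousD; first exact: within_continuous_cst.
by apply: prim_continuous => //; apply: L2r_integrable wh.1.
Qed.

(** The value at 0 forces [c = 0], and the value at 1 forces [d] to be minus the double primitive of
    [h] at 1. *)
Lemma prim_affine_green c d h : int h ->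
  c + prim 0 (fun t => d + prim 0 h t) 0 = 0 ->
  c + prim 0 (fun t => d + prim 0 h t) 1 = 0 ->
  forall x, x \in `[0, 1] -> c + prim 0 (fun t => d + prim 0 h t) x = green h x.
Proof.
move=> inth; have e x : x \in `[0, 1] ->
    prim 0 (fun t => d + prim 0 h t) x = d * x + prim 0 (prim 0 h) x.
  move=> x01; rewrite addrC -prim_add_cst //; last exact: prim_integrable.
  by apply: eq_Rintegral => t _; rewrite addrC.
rewrite prim_left addr0 => ->; rewrite add0r e ?in_itv /= ?ler01 ?lexx // mulr1 => d0.
move=> x x01; rewrite add0r e // /green; move: d0; move: (prim 0 _) => F d0.
by rewrite -(addr0_eq d0); ring.
Qed.

(** Integrating the relation over an interval of length 1 expresses [c] through mean values, which
    are bounded by the quadratic norms. *)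
Lemma trace_le c (g g' : R -> R) : L2 g -> L2 g' ->
  eqr_ae 0 1 g (fun x => c + prim 0 g' x) ->
  `|c| <= '|g| + '|g'| /\ `|c + prim 0 g' 1| <= '|g| + '|g'| + '|g'|.
Proof.
move=> Lg Lg' gc; have ig' := L2r_integrable Lg'.
have e1 : (1 : R) \in `[0, 1] by rewrite in_itv /= ler01 lexx.
have hc : `|c| <= '|g| + '|g'|.
  have -> : c = prim 0 g 1 - prim 0 (prim 0 g') 1.
    have -> : prim 0 g 1 = prim 0 (fun x => prim 0 g' x + c) 1.
      apply: (eq_prim (lexx _)); first exact: Lg.1.
        apply: measurable_funD; [exact: (prim_L2 ig').1|exact: measurable_cst].
      by apply: ae_imp gc => x e xD; rewrite e // addrC.
    rewrite prim_add_cst //; last exact: prim_integrable.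
    by rewrite mulr1 addrAC subrr add0r.
  apply: le_trans (ler_normB _ _) _; apply: lerD; first exact: prim_le.
  exact: prim2_le.
split=> //; apply: le_trans (ler_normD _ _) _; apply: lerD => //; exact: prim_le.
Qed.

Lemma test_rweak1 phi : test phi -> rweak 0 1 1 phi (derive1 phi).
Proof.
move=> tphi; apply: (@prim_rweak _ _ _ 0) ltr01 (L2r_test tphi) _ _.
  exact/L2r_test/test_derive.
apply: eqr_aeW => x /=; rewrite in_itv /= => /andP[/ltW x0 _].
by rewrite add0r (prim_test tphi x0).
Qed.

Lemma norm_H1_sqr (g : R -> R[i]) (g' : bool -> R -> R) : (forall s, L2 (fpart s g)) ->
  (forall s, rweak 0 1 1 (fpart s g) (g' s)) ->
  norm_H1 0 1 g ^+ 2 = ('|fpart false g| ^+ 2 + '|g' false| ^+ 2) +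
                       ('|fpart true g| ^+ 2 + '|g' true| ^+ 2).
Proof.
move=> Lg wg; have wd := weak_deriv_eq ltr01 wg.
have sq_ge0 (h : R -> R) : 0 <= \int[mu]_(x in D) h x ^+ 2.
  by apply: Rintegral_ge0 => x _; exact: sqr_ge0.
have ge s : '|g' s| = '|fpart s (weak_deriv 0 1 1 g)|.
  have [w e] := wd s; congr Num.sqrt; apply: eq_Rintegral_ae.
  - by apply: measurable_funX; exact: (wg s).1.1.
  - by apply: measurable_funX; exact: w.1.1.
  - by apply: ae_imp e => x e xD; rewrite e.
have Lw s := (wd s).1.1; rewrite !ge /norm_H1.
move: (weak_deriv 0 1 1 g) Lw => w Lw.
have e : complex.Re (integralC `]0, 1[ (fun x => g x * conjc (g x) + w x * conjc (w x))) =
  (\int[mu]_(x in D) fpart false g x ^+ 2 + \int[mu]_(x in D) fpart false w x ^+ 2) +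
  (\int[mu]_(x in D) fpart true g x ^+ 2 + \int[mu]_(x in D) fpart true w x ^+ 2).
  have i2 h : L2 h -> int (fun x => h x ^+ 2) by case.
  have i4 s : int (fun x => fpart s g x ^+ 2 + fpart s w x ^+ 2).
    by apply: integrable_ext (integrableD _ (i2 _ (Lg s)) (i2 _ (Lw s))).
  rewrite -!RintegralD //; try exact: i2.
  rewrite [LHS]/=; apply: eq_Rintegral => x _; rewrite /fpart /part.
  by case: (g x) (w x) => [? ?] [? ?] /=; ring.
by rewrite e !sqr_sqrtr ?addr_ge0.
Qed.

Lemma sqr_sum4_le (N : R) (A B : bool -> R) : 0 <= N -> (forall s, 0 <= A s) ->
  (forall s, 0 <= B s) ->
  N ^+ 2 = (A false ^+ 2 + B false ^+ 2) + (A true ^+ 2 + B true ^+ 2) ->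
  forall s, A s <= N /\ B s <= N.
Proof.
move=> N0 A0 B0 NE s.
have le_N r : 0 <= r -> r ^+ 2 <= N ^+ 2 -> r <= N.
  by move=> r0; rewrite ler_pXn2r ?nnegrE.
have := sqr_ge0 (A false); have := sqr_ge0 (B false).
have := sqr_ge0 (A true); have := sqr_ge0 (B true).
by split; apply: le_N; rewrite ?NE //; case: s; lra.
Qed.

Lemma thirds_le (A B e : R) : A <= e / 3 -> B <= e / 3 -> 0 < e ->
  A + B <= e /\ A + B + B <= e.
Proof. by move=> ? ? ?; split; lra. Qed.

(** Test functions have zero traces, so subtracting them leaves the traces of [f] unchanged, while
    the difference is small in H^1 and [trace_le] bounds its traces. *)
Lemma sobolev10_trace (f : R -> R[i]) (f' : R -> R) c s : sobolev10 0 1 f ->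
  rweak 0 1 1 (fpart s f) f' -> eqr_ae 0 1 (fpart s f) (fun x => c + prim 0 f' x) ->
  c = 0 /\ c + prim 0 f' 1 = 0.
Proof.
move=> [sf apx] wf fc.
suff small (e : R) : 0 < e -> `|c| <= e /\ `|c + prim 0 f' 1| <= e.
  have z (r : R) : (forall e, 0 < e -> `|r| <= e) -> r = 0.
    move=> hr; apply/eqP; rewrite -normr_le0; apply/ler_addgt0Pr => e e0.
    by rewrite add0r hr.
  by split; apply: z => e e0; have [] := small e e0.
move=> e0; have e3 : 0 < e / 3 by rewrite divr_gt0.
have [phi [psi [tphi tpsi]]] := apx (e / 3) e3.
pose t s' := if s' then psi else phi; have tt s' : test (t s') by case: s'.
set g := (fun x => _).
have gE s' : fpart s' g = (fun x => fpart s' f x + - 1 * t s' x).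
  by apply/funext => x; rewrite /fpart /g partB mulN1r; congr (_ - _); case: s'.
have Lf s' : L2 (fpart s' f) by have /L2P := sf.1.
pose f1 s' := fpart s' (weak_deriv 0 1 1 f).
have wf1 s' : rweak 0 1 1 (fpart s' f) (f1 s') by apply: (sobolev_rweak s' sf).
have Lt s' : L2 (t s') := L2r_test (tt s').
have LNt s' : L2 (fun x => - 1 * t s' x) := L2rZ _ (Lt s').
have Lg s' : L2 (fpart s' g) by rewrite gE; exact: L2rD.
(* On part [s] the given derivative is used, since [c] refers to its primitive; on the other part
   the chosen weak derivative serves. *)
pose g1 s' x := (if s' == s then f' x else f1 s' x) + - 1 * derive1 (t s') x.
have wg s' : rweak 0 1 1 (fpart s' g) (g1 s').
  rewrite gE /g1; apply: rweakD => //.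
    by case: eqVneq => [->|_] //; exact: wf.
  by apply: rweakZ => //; exact: test_rweak1.
have := norm_H1_sqr Lg wg; set N := norm_H1 0 1 g => NE NE3.
have N0 : 0 <= N by exact: sqrtr_ge0.
have [gN g1N] := sqr_sum4_le N0 (fun s => sqrtr_ge0 _) (fun s => sqrtr_ge0 _) NE s.
have gs : '|fpart s g| <= e / 3 := le_trans gN (ltW NE3).
have g1s : '|g1 s| <= e / 3 := le_trans g1N (ltW NE3).
have g1E : g1 s = (fun x => f' x + - 1 * derive1 (t s) x).
  by apply/funext => x; rewrite /g1 eqxx.
have Lt' : L2 (fun x => - 1 * derive1 (t s) x) by exact/L2rZ/L2r_test/test_derive.
have if' := L2r_integrable wf.1; have it' := L2r_integrable (L2r_test (test_derive (tt s))).
have pg x : 0 <= x -> x <= 1 -> prim 0 (g1 s) x = prim 0 f' x - t s x.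
  move=> x0 x1; rewrite g1E (primD x1 if' (L2r_integrable Lt')) (primZ _ x1 it').
  by rewrite (prim_test (tt s) x0) mulN1r.
have [|h1 h2] := trace_le (Lg s) (wg s).1 (c := c).
  apply: ae_imp fc => x fx xD; rewrite gE fx //.
  move: xD; rewrite /= in_itv /= => /andP[/ltW x0 /ltW x1].
  by rewrite pg // mulN1r addrA.
rewrite pg // (test_right (tt s) (lexx _)) subr0 in h2.
have [a1 a2] := thirds_le gs g1s e0.
by split; [exact: le_trans h1 a1|exact: le_trans h2 a2].
Qed.

(** Functions orthogonal to all derivatives of test functions are constant, so these derivatives
    together with the constants span a dense space. In an approximation of [h] the constant is then
    small, because [h] has zero mean. *)
Lemma test_derive_dense h e : L2 h -> prim 0 h 1 = 0 -> 0 < e ->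
  exists2 phi, test phi & '|fun x => h x - derive1 phi x| <= e.
Proof.
move=> Lh h1 e0; have ih := L2r_integrable Lh.
pose M (F : @L2space R) := exists phi, exists2 c, test phi &
  F = cls (fun x => derive1 phi x + c).
have Lm phi c : test phi -> L2 (fun x => derive1 phi x + c).
  by move=> tphi; apply: L2rD; [exact/L2r_test/test_derive|exact: L2r_cst].
have t0 : test (cst 0 : R -> R).
  have [phi tphi _] := test_unit_mass (ltr01 : (0 : R) < 1).
  have := testZ 0 tphi; congr test_function; apply/funext => x.
  by rewrite /= mul0r.
have d0 : derive1 (cst 0 : R -> R) = cst 0.
  by apply/funext => x; rewrite derive1_cst.
have M0 : M 0.
  exists (cst 0), 0 => //; rewrite -cls0 d0; congr cls.
  by apply/funext => x; rewrite addr0.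
have MD F G : M F -> M G -> M (F + G).
  move=> [phi [c tphi ->]] [psi [d tpsi ->]]; exists (phi + psi), (c + d); first exact: testD.
  rewrite -clsD; [|exact: Lm..]; congr cls; apply/funext => x.
  rewrite (derivable_derive1D (smooth_derivable (test_smooth tphi))
    (smooth_derivable (test_smooth tpsi))).
  transitivity ((derive1 phi x + derive1 psi x) + (c + d)); last by [].
  by rewrite addrACA.
have MZ k F : M F -> M (k *: F).
  move=> [phi [c tphi ->]]; exists (cst k * phi), (k * c); first exact: testZ.
  rewrite -clsZ; last exact: Lm.
  have sk : smooth (cst k : R -> R) by exact: smooth_cst.
  congr cls; apply/funext => x; rewrite (derivable_derive1M (smooth_derivable sk)
    (smooth_derivable (test_smooth tphi))).
  have -> : derive1 (cst k : R -> R) = cst 0 by apply/funext => y; rewrite derive1_cst.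
  transitivity ((0 * phi x + k * derive1 phi x) + k * c); last by [].
  by rewrite mul0r add0r mulrDr.
have Mo F : (forall m, M m -> ipL2 F m = 0) -> F = 0.
  move=> FM; have LF := L2_rep F.
  have FE phi c : test phi -> \int[mu]_(x in D) (rep F x * (derive1 phi x + c)) = 0.
    move=> tphi; rewrite -(@ipL2E _ F (cls (fun x => derive1 phi x + c))) ?cls_rep //.
      by apply: FM; exists phi, c.
    exact: Lm.
  have [|c Fc] := test_derive_orthogonal_cst ltr01 (rep_int F) (f := rep F).
    move=> phi tphi; rewrite -[RHS](FE phi 0 tphi).
    by apply: eq_Rintegral => x _; rewrite addr0.
  have c0 : c = 0.
    rewrite -[RHS](FE (cst 0) 1 t0); symmetry.
    rewrite -[RHS](mulr1 c) -[in RHS](subr0 1) -Rintegral_cst_itv // d0.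
    apply: eq_Rintegral_ae; [|exact: measurable_cst|].
      by apply: measurable_funM; [exact: LF.1|exact: (L2rD (L2r_cst 0 1 0) (L2r_cst 0 1 1)).1].
    by apply: ae_imp Fc => x e' xD; rewrite e' //= add0r mulr1.
  rewrite -(cls_rep F) -cls0; apply: cls_eq => //; first exact: L2r_cst.
  by rewrite c0 in Fc.
have e2 : 0 < e / 2 by rewrite divr_gt0.
have [_ [phi [c tphi ->]]] := dense_of_orthogonal (@hilbert_L2 R) M0 MD MZ Mo (cls h) e2.
have Lr := L2rB Lh (Lm phi c tphi); rewrite -clsB //; last exact: Lm.
rewrite nrm_cls // => hr.
have Lhp : L2 (fun x => h x - derive1 phi x) by exact/L2rB/L2r_test/test_derive.
have Lc := L2r_cst (0 : R) 1 c.
have ce : `|c| <= e / 2.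
  apply: le_trans hr; rewrite -normrN.
  have -> : - c = prim 0 (fun x => h x - (derive1 phi x + c)) 1.
    have id := L2r_integrable (L2r_test (test_derive tphi)).
    have Ld : L2 (fun x => - 1 * derive1 phi x) by exact/L2rZ/L2r_test/test_derive.
    have -> : (fun x => h x - (derive1 phi x + c)) =
        (fun x => (h x + - 1 * derive1 phi x) + - c) by apply/funext => x; ring.
    have e1 : (1 : R) \in `[0, 1] by rewrite in_itv /= ler01 lexx.
    rewrite prim_add_cst //; last exact/L2r_integrable/L2rD.
    rewrite (primD (lexx 1) ih (L2r_integrable Ld)) (primZ _ (lexx 1) id) h1.
    by rewrite (prim_test tphi ler01) (test_right tphi (lexx _)) mulr0 addr0 add0r mulr1.
  by apply: prim_le => //; rewrite in_itv /= ler01 lexx.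
exists phi => //; rewrite -nrm_cls //.
have -> : cls (fun x => h x - derive1 phi x) =
    cls (fun x => h x - (derive1 phi x + c)) + cls (fun=> c).
  by rewrite -clsD //; congr cls; apply/funext => x; ring.
apply: le_trans (nrmD (@hilbert_L2 R) _ _) _; rewrite !nrm_cls // [leRHS]splitr.
apply: lerD => //; rewrite Rintegral_cst_itv // subr0 mulr1 sqrtr_sqr //.
Qed.

Lemma sqr_sum_lt (A B C E e : R) : 0 < e -> A <= e ^+ 2 / 9 -> B <= e ^+ 2 / 9 ->
  C <= e ^+ 2 / 9 -> E <= e ^+ 2 / 9 -> (A + B) + (C + E) < e ^+ 2.
Proof. by move=> e0; have := exprn_gt0 2 e0; move: (e ^+ 2) => E2; lra. Qed.

(** Approximating the derivatives suffices, since on the unit interval a primitive is bounded by the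
    norm of its integrand. Four squares of numbers at most [e / 3] add up to less than [e ^+ 2]. *)
Lemma prim_sobolev10 (f : R -> R[i]) (f' : bool -> R -> R) :
  (forall s, L2 (fpart s f)) -> (forall s, L2 (f' s)) ->
  (forall s, eqr_ae 0 1 (fpart s f) (prim 0 (f' s))) -> (forall s, prim 0 (f' s) 1 = 0) ->
  sobolev10 0 1 f.
Proof.
move=> Lf Lf' ff' f'1.
have wf s : rweak 0 1 1 (fpart s f) (f' s).
  apply: (@prim_rweak _ _ _ 0) => //; apply: ae_imp (ff' s) => x fx xD.
  by rewrite add0r fx.
split.
  by apply: rweak_sobolev Lf _ => -[|[|n]] // s _; exists (f' s).
move=> e e0; have e3 : 0 < e / 3 by rewrite divr_gt0.
have /choice[t tP] s : exists phi, test phi /\ '|fun x => f' s x - derive1 phi x| <= e / 3.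
  by have [phi tphi phiP] := test_derive_dense (Lf' s) (f'1 s) e3; exists phi.
exists (t false), (t true); split; [exact: (tP _).1|exact: (tP _).1|].
set g := (fun x => _).
have gE s : fpart s g = (fun x => fpart s f x + - 1 * t s x).
  by apply/funext => x; rewrite /fpart /g partB mulN1r; congr (_ - _); case: s.
pose g1 s x := f' s x + - 1 * derive1 (t s) x.
have Lt s : L2 (t s) := L2r_test (tP s).1.
have LNt s : L2 (fun x => - 1 * t s x) := L2rZ _ (Lt s).
have Lg s : L2 (fpart s g) by rewrite gE; exact: L2rD.
have wg s : rweak 0 1 1 (fpart s g) (g1 s).
  rewrite gE /g1; apply: rweakD => //.
  by apply: rweakZ => //; exact: test_rweak1 (tP s).1.
have g1e s : '|g1 s| <= e / 3.
  have -> : g1 s = (fun x => f' s x - derive1 (t s) x).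
    by apply/funext => x; rewrite /g1 mulN1r.
  exact: (tP s).2.
have Lg1 s : L2 (g1 s) := (wg s).1.
have ge s : '|fpart s g| <= e / 3.
  have pg x : 0 <= x -> x <= 1 -> prim 0 (g1 s) x = prim 0 (f' s) x + - 1 * t s x.
    move=> x0 x1; have if' := L2r_integrable (Lf' s).
    have it' := L2r_integrable (L2r_test (test_derive (tP s).1)).
    have Lt' : L2 (fun x => - 1 * derive1 (t s) x) by exact/L2rZ/L2r_test/test_derive/(tP s).1.
    rewrite /g1 (primD x1 if' (L2r_integrable Lt')) (primZ _ x1 it').
    by rewrite (prim_test (tP s).1 x0).
  apply: le_trans (g1e s); rewrite -[leRHS]ger0_norm ?sqrtr_ge0 // -sqrtr_sqr.
  have Lp := prim_L2 (L2r_integrable (Lg1 s)).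
  have -> : \int[mu]_(x in D) fpart s g x ^+ 2 = \int[mu]_(x in D) prim 0 (g1 s) x ^+ 2.
    apply: eq_Rintegral_ae.
    - by apply: measurable_funX; exact: (Lg s).1.
    - by apply: measurable_funX; exact: Lp.1.
    - apply: ae_imp (ff' s) => x fx xD; rewrite gE fx //.
      by move: xD; rewrite /= in_itv /= => /andP[/ltW x0 /ltW x1]; rewrite pg.
  apply: ler_wsqrtr; apply: Rintegral_sqr_le; rewrite ?sqrtr_ge0 //.
  by move=> x /= x01; apply: (prim_le (Lg1 s)); exact: subset_itv_oo_cc.
have := norm_H1_sqr Lg wg; set N := norm_H1 0 1 g => NE.
rewrite -(@ltr_pXn2r _ 2) ?nnegrE ?sqrtr_ge0 ?ltW // NE.
have sq (r : R) : 0 <= r -> r <= e / 3 -> r ^+ 2 <= e ^+ 2 / 9.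
  move=> r0 re; have -> : e ^+ 2 / 9 = (e / 3) ^+ 2 by field.
  by rewrite ler_pXn2r ?nnegrE // ltW.
exact: sqr_sum_lt e0 (sq _ (sqrtr_ge0 _) (ge _)) (sq _ (sqrtr_ge0 _) (g1e _))
  (sq _ (sqrtr_ge0 _) (ge _)) (sq _ (sqrtr_ge0 _) (g1e _)).
Qed.

Definition uxx s (U : state R) : R -> R := fpart s (weak_deriv 0 1 2 U.1).

Lemma green_in_H (U : state R) (h : bool -> R -> R) : (forall s, L2 (fpart s U.2)) ->
  (forall s, L2 (fpart s U.1)) -> (forall s, L2 (h s)) ->
  (forall s, eqr_ae 0 1 (fpart s U.1) (green (h s))) ->
  in_H U /\ forall s, L2 (uxx s U) /\ eqr_ae 0 1 (h s) (uxx s U).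
Proof.
move=> /L2P LU2 LU Lh Uh; have ih s := L2r_integrable (Lh s).
have w1 s : rweak 0 1 1 (fpart s U.1) (green_slope (h s)).
  exact: rweak_ae (L2_green (ih s)) (LU s) (eqr_ae_sym (Uh s)) (green_rweak1 (ih s)).
have w2 s : rweak 0 1 2 (fpart s U.1) (h s).
  exact: rweak_ae (L2_green (ih s)) (LU s) (eqr_ae_sym (Uh s)) (green_rweak2 (Lh s)).
split; last first.
  by move=> s; have [w' e] := weak_deriv_eq ltr01 w2 s; split=> //; exact: w'.1.
split=> //.
  apply: rweak_sobolev LU _ => -[|[|[|n]]] // s _.
    by exists (green_slope (h s)).
  by exists (h s).
apply: (@prim_sobolev10 _ (fun s => green_slope (h s))) => // s.
- exact: (w1 s).1.
- apply: ae_imp (Uh s) => x Ux xD; rewrite Ux // green_prim //.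
  exact: subset_itv_oo_cc.
- exact: green_slope_mass.
Qed.

(** With [green_in_H] this characterizes the energy space by the relation [u = green u_xx]: H^2
    determines [u] from [u_xx] up to an affine function, and H^1_0 fixes the latter through the
    traces. *)
Lemma in_H_green (U : state R) s : in_H U ->
  [/\ L2 (fpart s U.1), L2 (fpart s U.2), L2 (uxx s U) &
      eqr_ae 0 1 (fpart s U.1) (green (uxx s U))].
Proof.
move=> [s2 s10 /L2P L2U]; have /L2P L1U := s2.1.
have w1 := sobolev_rweak s s2 (isT : (1 <= 2)%N).
have w2 := sobolev_rweak s s2 (isT : (2 <= 2)%N).
have [c [d [Uc f1d]]] := rweak2_prim ltr01 (L1U s) w1 w2.
have Lw := w2.1; have iw := L2r_integrable Lw.
have ip : int (prim 0 (uxx s U)) by exact: prim_integrable.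
have Ld : L2 (fun t => d + prim 0 (uxx s U) t).
  by apply: L2rD; [exact: L2r_cst|exact: prim_L2].
have w1' : rweak 0 1 1 (fpart s U.1) (fun t => d + prim 0 (uxx s U) t).
  exact: rweak_ae_r Ld f1d w1.
have [c0 d0] := sobolev10_trace s10 w1' Uc.
split=> //; apply: eqr_ae_trans Uc _; apply: eqr_aeW => x /subset_itv_oo_cc x01.
by apply: prim_affine_green => //; rewrite prim_left addr0.
Qed.

End EnergySpace.

(** * Coordinates on the energy space *)

Section Coordinates.
Context {R : realType}.
Notation mu := (@lebesgue_measure R).
Implicit Types (a k : R) (s : bool) (f g h : R -> R) (U V W : state R).
Local Notation D := [set` `](0 : R), 1[].
Local Notation L2 := (L2r (0 : R) 1).
Local Notation int f := (mu.-integrable D (EFin \o f)).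
Local Notation X := (@L2space R * @L2space R)%type.

(* The energy norm of a state is the norm of the pair [(u_xx, v)], and [u] is
   recovered from [u_xx] by the Green operator. *)
Definition crd s U : X := (cls (uxx s U), cls (fpart s U.2)).

Definition st (x : bool -> X) : state R :=
  (mkC (fun s => green (rep (x s).1)), mkC (fun s => rep (x s).2)).

Lemma crd_green U (h : bool -> R -> R) : (forall s, L2 (fpart s U.2)) ->
  (forall s, L2 (fpart s U.1)) -> (forall s, L2 (h s)) ->
  (forall s, eqr_ae 0 1 (fpart s U.1) (green (h s))) ->
  in_H U /\ forall s, crd s U = (cls (h s), cls (fpart s U.2)).
Proof.
move=> LU2 LU Lh Uh; have [HU UP] := green_in_H LU2 LU Lh Uh; split=> // s.
by rewrite /crd (cls_eq (Lh s) (UP s).1 (UP s).2).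
Qed.

Lemma st_crd (x : bool -> X) : in_H (st x) /\ forall s, crd s (st x) = x s.
Proof.
have [|||s|HU UP] := @crd_green (st x) (fun s => rep (x s).1).
- by move=> s; rewrite fpart_mkC; exact: L2_rep.
- by move=> s; rewrite fpart_mkC; exact/L2_green/rep_int.
- by move=> s; exact: L2_rep.
- by rewrite fpart_mkC; exact: eqr_ae_refl.
by split=> // s; rewrite UP fpart_mkC !cls_rep; case: (x s).
Qed.

Lemma crd_eq U V : in_H U -> in_H V -> (forall s, crd s U = crd s V) -> eq_H U V.
Proof.
move=> HU HV UV; split; apply/eq_aeP => s.
  have [_ _ LU Ug] := in_H_green s HU; have [_ _ LV Vg] := in_H_green s HV.
  apply: eqr_ae_trans Ug _; apply: eqr_ae_trans (eqr_ae_sym Vg).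
  apply: eqr_aeW => x /=; rewrite in_itv /= => /andP[_ /ltW x1].
  exact: (eq_green LU LV (cls_inj LU LV (congr1 fst (UV s))) x1).
have [_ LU _ _] := in_H_green s HU; have [_ LV _ _] := in_H_green s HV.
exact: (cls_inj LU LV (congr1 snd (UV s))).
Qed.

Lemma eq_H_crd U V : in_H U -> in_H V -> eq_H U V -> forall s, crd s U = crd s V.
Proof.
move=> HU HV [/eq_aeP UV1 /eq_aeP UV2] s.
have [LU1 LU2 LU Ug] := in_H_green s HU; have [LV1 LV2 LV Vg] := in_H_green s HV.
have wU := rweak_ae LU1 LV1 (UV1 s) (sobolev_rweak s (let: And3 h _ _ := HU in h) (isT : (2 <= 2)%N)).
have wV := sobolev_rweak s (let: And3 h _ _ := HV in h) (isT : (2 <= 2)%N).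
have e1 := cls_eq LU LV (rweak_unique ltr01 wU wV).
by rewrite /crd e1 (cls_eq LU2 LV2 (UV2 s)).
Qed.

(** Covers plain differences, with [k = 1], and [difference_quotient], with [k] the inverse of the
    time increment. *)
Definition scaled_diff k U V : state R :=
  (fun x => k%:C%C * (U.1 x - V.1 x), fun x => k%:C%C * (U.2 x - V.2 x)).

Lemma scaled_diff_crd k U V : in_H U -> in_H V -> in_H (scaled_diff k U V) /\
  forall s, crd s (scaled_diff k U V) = k *: (crd s U - crd s V).
Proof.
move=> HU HV.
have e1 s : fpart s (scaled_diff k U V).1 = (fun x => k * (fpart s U.1 x - fpart s V.1 x)).
  by apply/funext => x; rewrite /fpart partZ partB.
have e2 s : fpart s (scaled_diff k U V).2 = (fun x => k * (fpart s U.2 x - fpart s V.2 x)).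
  by apply/funext => x; rewrite /fpart partZ partB.
have [|||s|HW WP] :=
  @crd_green (scaled_diff k U V) (fun s x => k * (uxx s U x - uxx s V x)).
- move=> s; rewrite e2; have [_ ? _ _] := in_H_green s HU.
  by have [_ ? _ _] := in_H_green s HV; exact/L2rZ/L2rB.
- move=> s; rewrite e1; have [? _ _ _] := in_H_green s HU.
  by have [? _ _ _] := in_H_green s HV; exact/L2rZ/L2rB.
- move=> s; have [_ _ ? _] := in_H_green s HU.
  by have [_ _ ? _] := in_H_green s HV; exact/L2rZ/L2rB.
- have [_ _ LU Ug] := in_H_green s HU; have [_ _ LV Vg] := in_H_green s HV.
  rewrite e1; apply: ae_imp (ae_and Ug Vg) => x [Ux Vx] xD.
  rewrite Ux // Vx //; move: xD; rewrite /= in_itv /= => /andP[_ /ltW x1].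
  rewrite greenZ //; last exact/L2r_integrable/L2rB.
  have -> : (fun t => uxx s U t - uxx s V t) = (fun t => uxx s U t + - 1 * uxx s V t).
    by apply/funext => t; rewrite mulN1r.
  rewrite (greenD (L2r_integrable LU) (L2r_integrable (L2rZ (-1) LV)) x1).
  by rewrite (greenZ _ (L2r_integrable LV) x1) mulN1r.
split=> // s; have [_ LU2 LU _] := in_H_green s HU; have [_ LV2 LV _] := in_H_green s HV.
rewrite WP e2; congr pair; rewrite clsZ ?clsB //; exact: L2rB.
Qed.

Lemma diff_crd U V : in_H U -> in_H V ->
  in_H (U - V) /\ forall s, crd s (U - V) = crd s U - crd s V.
Proof.
move=> HU HV; have [HW WP] := scaled_diff_crd 1 HU HV.
have e : scaled_diff 1 U V = U - V.
  rewrite [RHS]surjective_pairing /scaled_diff.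
  by congr pair; apply/funext => x; rewrite mul1r.
by rewrite -e; split=> // s; rewrite WP scale1r.
Qed.

Lemma ipL2_cls f g : L2 f -> L2 g -> ipL2 (cls f) (cls g) = \int[mu]_(x in D) (f x * g x).
Proof. by move=> Lf Lg; exact: ipL2E. Qed.

Lemma inner_H_crd a U V : in_H U -> in_H V -> inner_H a U V =
  Complex (ipH a (crd false U) (crd false V) + ipH a (crd true U) (crd true V))
          (ipH a (crd true U) (crd false V) - ipH a (crd false U) (crd true V)).
Proof.
move=> HU HV.
have LU s : L2 (uxx s U) by have [] := in_H_green s HU.
have LV s : L2 (uxx s V) by have [] := in_H_green s HV.
have LU2 s : L2 (fpart s U.2) by have [] := in_H_green s HU.
have LV2 s : L2 (fpart s V.2) by have [] := in_H_green s HV.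
have ipE s r : ipH a (crd s U) (crd r V) =
    \int[mu]_(x in D) (a * (uxx s U x * uxx r V x) + fpart s U.2 x * fpart r V.2 x).
  rewrite /ipH /energy /= !ipL2_cls // -RintegralZl //; last exact: L2r_mul.
  rewrite -RintegralD //; last exact: L2r_mul.
  by apply: integrable_ext (integrableZl _ a (L2r_mul (LU s) (LV r))).
have ipi s r : int (fun x => a * (uxx s U x * uxx r V x) + fpart s U.2 x * fpart r V.2 x).
  have i1 := L2r_mul (L2rZ a (LU s)) (LV r).
  apply: integrable_ext (integrableD _ i1 (L2r_mul (LU2 s) (LV2 r))) => //.
  by move=> x _ /=; rewrite mulrA.
apply: part_eq => s; rewrite /inner_H part_integralC; case: s => /=.
  rewrite !ipE -RintegralB //; apply: eq_Rintegral => x _.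
  rewrite /fpart /part /uxx /fpart /part.
  by case: (weak_deriv _ _ _ U.1 x) (weak_deriv _ _ _ V.1 x) (U.2 x) (V.2 x) =>
    [? ?] [? ?] [? ?] [? ?] /=; ring.
rewrite !ipE -RintegralD //; apply: eq_Rintegral => x _.
rewrite /fpart /part /uxx /fpart /part.
by case: (weak_deriv _ _ _ U.1 x) (weak_deriv _ _ _ V.1 x) (U.2 x) (V.2 x) =>
  [? ?] [? ?] [? ?] [? ?] /=; ring.
Qed.

Lemma norm_H_crd a U : 0 < a -> in_H U ->
  (forall s, nrm (ipH a) (crd s U) <= norm_H a U) /\
  norm_H a U <= nrm (ipH a) (crd false U) + nrm (ipH a) (crd true U).
Proof.
move=> a0 HU; rewrite /norm_H inner_H_crd //=.
have ge0 s : 0 <= ipH a (crd s U) (crd s U) := ip_ge0 (hilbert_H a0) _.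
split=> [s|].
  apply: ler_wsqrtr; have := ge0 (~~ s); case: s => /= h; first by rewrite lerDr.
  by rewrite lerDl.
have n0 s : 0 <= nrm (ipH a) (crd s U) by exact: sqrtr_ge0.
rewrite -[leRHS]ger0_norm ?addr_ge0 // -sqrtr_sqr; apply: ler_wsqrtr.
rewrite -!(nrm_sqr (hilbert_H a0)); have := n0 false; have := n0 true.
move: (nrm (ipH a) (crd false U)) (nrm (ipH a) (crd true U)) => n m m_ge0 n_ge0.
by rewrite sqrrD addrAC lerDl mulrn_wge0 // mulr_ge0.
Qed.

End Coordinates.

(** * The domain of the generator *)

Section Domain.
Context {R : realType}.
Notation mu := (@lebesgue_measure R).
Implicit Types (p q x y c d k : R) (s : bool) (h phi : R -> R) (U V W : state R).
Local Notation D := [set` `](0 : R), 1[].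
Local Notation L2 := (L2r (0 : R) 1).
Local Notation int f := (mu.-integrable D (EFin \o f)).
Local Notation test := (test_function (0 : R) 1).

Lemma prim_affine_continuous p q c d h : p < q -> L2r p q h ->
  {within `[p, q], continuous (fun x => c + prim p (fun t => d + prim p h t) x)} /\
  {within `[p, q], continuous (fun t => d + prim p h t)}.
Proof.
move=> pq Lh.
have cd : {within `[p, q], continuous (fun t => d + prim p h t)}.
  apply: within_continuousD; first exact: within_continuous_cst.
  exact: prim_continuous pq (L2r_integrable Lh).
split=> //; apply: within_continuousD; first exact: within_continuous_cst.
exact: prim_continuous pq (L2r_integrable (L2r_continuous cd)).
Qed.

Lemma boundary_green (f : R -> R[i]) : sobolev 2 0 1 f ->
  cont_rep 0 1 f 0 = 0 -> cont_rep 0 1 f 1 = 0 ->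
  forall s, eqr_ae 0 1 (fpart s f) (green (fpart s (weak_deriv 0 1 2 f))).
Proof.
move=> sf f0 f1; have /L2P Lf := sf.1; set h := fun s => fpart s (weak_deriv 0 1 2 f).
have w2 s : rweak 0 1 2 (fpart s f) (h s) := sobolev_rweak s sf (isT : (2 <= 2)%N).
have Lh s : L2 (h s) := (w2 s).1.
have /choice[cd cdP] s : exists cd : R * R,
    eqr_ae 0 1 (fpart s f) (fun x => cd.1 + prim 0 (fun t => cd.2 + prim 0 (h s) t) x).
  have w1 := sobolev_rweak s sf (isT : (1 <= 2)%N).
  by have [c [d [e _]]] := rweak2_prim ltr01 (Lf s) w1 (w2 s); exists (c, d).
pose F s x := (cd s).1 + prim 0 (fun t => (cd s).2 + prim 0 (h s) t) x.
have cF s := (prim_affine_continuous (cd s).1 (cd s).2 ltr01 (Lh s)).1.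
have FE := cont_repE ltr01 cF (fun s => eqr_ae_sym (cdP s)).
have e0 : (0 : R) \in `[0, 1] by rewrite in_itv /= ler01 lexx.
have e1 : (1 : R) \in `[0, 1] by rewrite in_itv /= ler01 lexx.
move=> s; apply: eqr_ae_trans (cdP s) _; apply: eqr_aeW => x /subset_itv_oo_cc x01.
apply: prim_affine_green x01; first exact: L2r_integrable (Lh s).
  by have := FE s _ e0; rewrite f0 part0 => <-.
by have := FE s _ e1; rewrite f1 part0 => <-.
Qed.

(** [f_xx] is affine plus the double primitive of [f_xxxx], so the one-sided values of [f_xx] and
    [f_xxx] can be read off from the constants of integration. *)
Lemma sobolev4_prim p q (f : R -> R[i]) : p < q -> sobolev 4 p q f ->
  exists c d : bool -> R, forall s, let m := fpart s (weak_deriv p q 4 f) in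
    let F x := c s + prim p (fun t => d s + prim p m t) x in
  [/\ L2r p q m, eqr_ae p q (fpart s (weak_deriv p q 2 f)) F,
   forall x, x \in `[p, q] -> part s (cont_rep p q (weak_deriv p q 2 f) x) = F x &
   forall x, x \in `[p, q] ->
     part s (cont_rep p q (weak_deriv p q 3 f) x) = d s + prim p m x].
Proof.
move=> pq sf; pose m s := fpart s (weak_deriv p q 4 f).
have w2 s := sobolev_rweak s sf (isT : (2 <= 4)%N).
have w3 s := sobolev_rweak s sf (isT : (3 <= 4)%N).
have w4 s := sobolev_rweak s sf (isT : (4 <= 4)%N).
have /choice[cd cdP] s : exists cd : R * R,
    eqr_ae p q (fpart s (weak_deriv p q 2 f))
      (fun x => cd.1 + prim p (fun t => cd.2 + prim p (m s) t) x) /\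
    eqr_ae p q (fpart s (weak_deriv p q 3 f)) (fun t => cd.2 + prim p (m s) t).
  have w23 := rweak_step (w2 s) (w3 s); have w34 := rweak_step (w3 s) (w4 s).
  have [c [d e]] := rweak2_prim pq (w2 s).1 w23 (rweak_comp w23 w34).
  by exists (c, d).
have Lm s : L2r p q (m s) := (w4 s).1.
have cF s := prim_affine_continuous (cd s).1 (cd s).2 pq (Lm s).
exists (fun s => (cd s).1), (fun s => (cd s).2) => s /=; split.
- exact: Lm.
- exact: (cdP s).1.
- exact: (cont_repE pq (fun s => (cF s).1) (fun s => eqr_ae_sym (cdP s).1)).
- exact: (cont_repE pq (fun s => (cF s).2) (fun s => eqr_ae_sym (cdP s).2)).
Qed.

Section Glue.
Context (xi : R) (xi0 : 0 < xi) (xi1 : xi < 1).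

(** The two pieces have second derivative [m] away from [xi], agree at [xi], vanish at 0 and 1, and
    their slopes jump by [J] at [xi]. Subtracting [J] times the kernel removes the jump and leaves
    the solution of the Dirichlet problem for [m]. *)
Lemma glue_green (ml mr : R -> R) (dl cr dr J : R) :
  L2r 0 xi ml -> L2r xi 1 mr ->
  let m x := if x < xi then ml x else mr x in
  prim 0 (fun t => dl + prim 0 ml t) xi = cr ->
  cr + prim xi (fun t => dr + prim xi mr t) 1 = 0 ->
  dr - (dl + prim 0 ml xi) = J ->
  [/\ L2 m, forall x, x \in `[0, xi] ->
    prim 0 (fun t => dl + prim 0 ml t) x = green m x + J * kern xi x &
    forall x, x \in `[xi, 1] ->
    cr + prim xi (fun t => dr + prim xi mr t) x = green m x + J * kern xi x].
Proof.
move=> Lml Lmr m hc h1 hJ.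
have Lm : L2 m.
  apply: (@L2r_split _ 0 xi 1) => //.
    by apply: L2r_ext Lml => x /=; rewrite in_itv /= /m => /andP[_ ->].
  apply: L2r_ext Lmr => x /=; rewrite in_itv /= /m => /andP[/ltW].
  by rewrite leNgt => /negbTE ->.
have im := L2r_integrable Lm; have ipm := prim_integrable im.
have pl x : x <= xi -> prim 0 m x = prim 0 ml x.
  move=> xxi; apply: eq_Rintegral => t; rewrite inE /= in_itv /= => /andP[_ tx].
  by rewrite /m (lt_le_trans tx xxi).
have pr x : xi <= x -> x <= 1 -> prim 0 m x = prim 0 m xi + prim xi mr x.
  move=> xix x1; rewrite (prim_split (ltW xi0) xix x1 im); congr (_ + _).
  apply: eq_Rintegral => t; rewrite inE /= in_itv /= => /andP[xit _].
  by rewrite /m ltNge (ltW xit).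
have FL x : 0 <= x -> x <= xi ->
    prim 0 (fun t => dl + prim 0 ml t) x = dl * x + prim 0 (prim 0 m) x.
  move=> x0 xxi; have x01 : x \in `[0, 1] by rewrite in_itv /= x0 (le_trans xxi (ltW xi1)).
  rewrite addrC -prim_add_cst //; apply: eq_Rintegral => t.
  rewrite inE /= in_itv /= => /andP[_ tx].
  by rewrite pl ?(le_trans (ltW tx)) // addrC.
have FR x : xi <= x -> x <= 1 -> prim xi (fun t => dr + prim xi mr t) x =
    (dr - prim 0 m xi) * (x - xi) + (prim 0 (prim 0 m) x - prim 0 (prim 0 m) xi).
  move=> xix x1; rewrite (prim_split (ltW xi0) xix x1 ipm) [in RHS]addrAC subrr add0r.
  rewrite -Rintegral_cst_itv // -/(prim xi (fun=> dr - prim 0 m xi) x).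
  have ipx : mu.-integrable `]xi, 1[ (EFin \o prim 0 m).
    exact/L2r_integrable/(L2rS (ltW xi0) (lexx _))/prim_L2.
  have icx := L2r_integrable (L2r_cst xi 1 (dr - prim 0 m xi)).
  rewrite -(primD x1 icx ipx); apply: eq_Rintegral => t.
  rewrite inE /= in_itv /= => /andP[xit tx].
  rewrite (pr t (ltW xit)) ?(le_trans (ltW tx)) //.
  by move: (prim 0 m xi) (prim xi mr t) => u v; ring.
have x1xi := FR 1 (ltW xi1) (lexx 1); have xixi := FL xi (ltW xi0) (lexx xi).
rewrite x1xi -hc xixi in h1; rewrite -pl // in hJ.
have drE : dr - prim 0 m xi = J + dl by rewrite -hJ; ring.
rewrite drE in h1 FR.
(* The zero value at 1 determines the slope at 0. *)
have dlE : dl = - (J * (1 - xi)) - prim 0 (prim 0 m) 1.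
  move: h1; move: (prim 0 (prim 0 m)) => F h1.
  apply/eqP; rewrite -subr_eq0 -[X in _ == X]h1; apply/eqP; ring.
split=> // x; rewrite in_itv /= => /andP[x0 x1].
  rewrite FL // kern_le // /green dlE.
  by move: (prim 0 (prim 0 m)) => F; ring.
rewrite -hc xixi FR // kern_ge // /green dlE.
by move: (prim 0 (prim 0 m)) => F; ring.
Qed.

End Glue.

End Domain.

Lemma beam_coef {R : realType} {E : lmodType R} (a b alpha k : R) (x y z : E) : a != 0 ->
  x + - (alpha / a * k) *: z =
  - a^-1 *: (- a *: x + - b *: y + b *: y + (alpha * k) *: z).
Proof.
move=> a_neq0; rewrite -[_ + _ + b *: y]addrA -scalerDl addNr scale0r addr0.
rewrite scalerDr !scalerA mulrNN mulVf // scale1r; congr (_ + _ *: _).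
by field.
Qed.

(** * From the domain conditions to coordinates *)

Section Generator.
Context {R : realType} (a b alpha xi : R).
Hypotheses (a0 : 0 < a) (b0 : 0 < b) (alpha0 : 0 < alpha).
Hypotheses (xi0 : 0 < xi) (xi1 : xi < 1).
Notation mu := (@lebesgue_measure R).
Implicit Types (p q x y c d k : R) (s : bool) (h phi : R -> R) (U V W : state R).
Local Notation D := [set` `](0 : R), 1[].
Local Notation L2 := (L2r (0 : R) 1).
Local Notation int f := (mu.-integrable D (EFin \o f)).
Local Notation test := (test_function (0 : R) 1).
Local Notation T := (opT a b alpha xi).

(* The jump at [xi] of the third derivative of [u] when [v = green phi]. *)
Definition jump phi : R := - (alpha / a * green phi xi).

(** The form of [u_xx] on the domain, with [m] the regular part of [u_xxxx]; the kernel term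
    contributes to [u_xxxx] a Dirac mass at [xi] of weight [jump phi]. *)
Definition beam_uxx phi m x : R := green m x + jump phi * kern xi x.

(** A parametrization of the domain by [phi = v_xx] and the regular part [m] of [u_xxxx]. The
    boundary, matching and jump conditions are all contained in the two identities with [green]. *)
Definition beam_repr U (phi m : bool -> R -> R) : Prop := forall s,
  [/\ L2 (phi s), L2 (m s), L2 (fpart s U.1) /\ L2 (fpart s U.2),
      eqr_ae 0 1 (fpart s U.2) (green (phi s)) &
      eqr_ae 0 1 (fpart s U.1) (green (beam_uxx (phi s) (m s)))].

Lemma beam_uxx_continuous phi m : L2 m ->
  {within `[0, 1], continuous (beam_uxx phi m)}.
Proof.
move=> Lm; apply: within_continuousD; first exact: green_continuous (L2r_integrable Lm).
exact/within_continuousZ/kern_continuous.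
Qed.

Lemma beam_uxx_L2 phi m : L2 m -> L2 (beam_uxx phi m).
Proof. by move=> Lm; exact/L2r_continuous/beam_uxx_continuous. Qed.

Lemma beam_uxx_cls phi m : L2 m ->
  cls (beam_uxx phi m) = cls (green m) + jump phi *: kap xi.
Proof.
move=> Lm; have Lk := L2_kern xi0 xi1.
by rewrite -clsZ // -clsD //; [exact: L2_green (L2r_integrable Lm)|exact: L2rZ].
Qed.

Lemma dom_beam_repr U : dom_A a alpha xi U -> exists phi m : bool -> R -> R, beam_repr U phi m.
Proof.
move=> [[s4l s4r s2u s2v] [u0 v0 u1 v1] [l0 r1] lr jmp].
have ug := boundary_green s2u u0 u1; have vg := boundary_green s2v v0 v1.
have [cl [dl Pl]] := sobolev4_prim xi0 s4l; have [cr [dr Pr]] := sobolev4_prim xi1 s4r.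
pose phi s := fpart s (weak_deriv 0 1 2 U.2).
pose m s x := if x < xi then fpart s (weak_deriv 0 xi 4 U.1) x
              else fpart s (weak_deriv xi 1 4 U.1) x.
exists phi, m => s.
have wv := sobolev_rweak s s2v (isT : (2 <= 2)%N).
have wu := sobolev_rweak s s2u (isT : (2 <= 2)%N).
have /L2P/(_ s) Lu := s2u.1; have /L2P/(_ s) Lv := s2v.1.
have Lphi : L2 (phi s) := wv.1.
have [Lml el vl2 vl3] := Pl s; have [Lmr er vr2 vr3] := Pr s.
have i0 : (0 : R) \in `[0, xi] by rewrite in_itv /= lexx ltW.
have i1 : (1 : R) \in `[xi, 1] by rewrite in_itv /= lexx ltW.
have il : xi \in `[0, xi] by rewrite in_itv /= lexx ltW.
have ir : xi \in `[xi, 1] by rewrite in_itv /= lexx ltW.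
have xi01 : xi \in `[0, 1] by rewrite in_itv /= !ltW.
have vxi : part s (cont_rep 0 1 U.2 xi) = green (phi s) xi.
  have cg s' : {within `[0, 1], continuous (green (fpart s' (weak_deriv 0 1 2 U.2)))}.
    exact/green_continuous/L2r_integrable/(sobolev_rweak s' s2v (isT : (2 <= 2)%N)).1.
  exact: (cont_repE ltr01 cg (fun s' => eqr_ae_sym (vg s')) s xi01).
have cl0 : cl s = 0.
  by have := vl2 0 i0; rewrite l0 part0 (prim_left 0) addr0 => <-.
have crE : prim 0 (fun t => dl s + prim 0 (fpart s (weak_deriv 0 xi 4 U.1)) t) xi = cr s.
  have := congr1 (part s) lr; rewrite (vl2 _ il) (vr2 _ ir) cl0 add0r => ->.
  by rewrite (prim_left xi) addr0.
have r1E := vr2 1 i1; rewrite r1 part0 in r1E.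
have jE : dr s - (dl s + prim 0 (fpart s (weak_deriv 0 xi 4 U.1)) xi) = jump (phi s).
  have := congr1 (part s) jmp; rewrite partB (vl3 _ il) (vr3 _ ir) (prim_left xi) addr0 => ->.
  by rewrite mulNr partN partZ vxi.
have [Lm hl hr] := glue_green xi0 xi1 Lml Lmr crE (esym r1E) jE.
split; [exact: Lphi|exact: Lm|by split|exact: vg|].
apply: eqr_ae_trans (ug s) _; apply: eqr_aeW => x /=; rewrite in_itv /= => /andP[_ /ltW x1].
apply: (eq_green wu.1 (beam_uxx_L2 _ Lm) _ x1).
(* The conditions of the domain concern weak derivatives on the two subintervals; uniqueness
   identifies these with the restrictions of the one on the whole interval. *)
have wul : rweak 0 xi 2 (fpart s U.1) (fpart s (weak_deriv 0 1 2 U.1)).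
  exact: rweakS (lexx _) (ltW xi1) wu.
have wur : rweak xi 1 2 (fpart s U.1) (fpart s (weak_deriv 0 1 2 U.1)).
  exact: rweakS (ltW xi0) (lexx _) wu.
apply: (@eqr_ae_split _ 0 xi 1).
  apply: eqr_ae_trans (rweak_unique xi0 wul (sobolev_rweak s s4l (isT : (2 <= 4)%N))) _.
  apply: eqr_ae_trans el _; apply: eqr_aeW => t /subset_itv_oo_cc tl.
  by rewrite cl0 add0r hl.
apply: eqr_ae_trans (rweak_unique xi1 wur (sobolev_rweak s s4r (isT : (2 <= 4)%N))) _.
by apply: eqr_ae_trans er _; apply: eqr_aeW => t /subset_itv_oo_cc tr; rewrite hr.
Qed.

Section Repr.
Context (U : state R) (phi m : bool -> R -> R) (HU : beam_repr U phi m).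

Let Lphi s : L2 (phi s). Proof. by have [] := HU s. Qed.
Let Lm s : L2 (m s). Proof. by have [] := HU s. Qed.
Let LU1 s : L2 (fpart s U.1). Proof. by have [_ _ []] := HU s. Qed.
Let LU2 s : L2 (fpart s U.2). Proof. by have [_ _ []] := HU s. Qed.
Let vg s : eqr_ae 0 1 (fpart s U.2) (green (phi s)). Proof. by have [] := HU s. Qed.
Let ug s : eqr_ae 0 1 (fpart s U.1) (green (beam_uxx (phi s) (m s))).
Proof. by have [] := HU s. Qed.
Let iphi s : int (phi s). Proof. exact: L2r_integrable (Lphi s). Qed.
Let im s : int (m s). Proof. exact: L2r_integrable (Lm s). Qed.
Let Lq s : L2 (beam_uxx (phi s) (m s)). Proof. exact: beam_uxx_L2. Qed.

Lemma beam_repr_in_H : in_H U /\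
  forall s, crd s U = (cls (beam_uxx (phi s) (m s)), cls (fpart s U.2)).
Proof. exact: crd_green LU2 LU1 Lq ug. Qed.

Lemma beam_repr_cont_rep s x : x \in `[0, 1] ->
  part s (cont_rep 0 1 U.2 x) = green (phi s) x.
Proof.
exact: (cont_repE ltr01 (fun s => green_continuous (iphi s)) (fun s => eqr_ae_sym (vg s))).
Qed.

Lemma beam_repr_rweak2 s : rweak 0 1 2 (fpart s U.1) (beam_uxx (phi s) (m s)).
Proof.
have Lg := L2_green (L2r_integrable (Lq s)).
exact: rweak_ae Lg (LU1 s) (eqr_ae_sym (ug s)) (green_rweak2 (Lq s)).
Qed.

Definition beam_image s x : R := - a * m s x + - b * green (phi s) x.

Lemma beam_image_L2 s : L2 (beam_image s).
Proof. by apply: L2rD; apply: L2rZ; [exact: Lm|exact: L2_green]. Qed.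

(** The Dirac mass in [a u_xxxx] has weight [a] times the jump, that is [- alpha v(xi)]; it cancels
    the pointwise damping term, and a square integrable function remains. *)
Lemma A_dist_image s psi : test psi ->
  part s (A_dist a b alpha xi U psi) = \int[mu]_(x in D) (beam_image s x * psi x).
Proof.
move=> tpsi; have tpsi2 := testn 2 tpsi.
have e (h : R -> R[i]) (w : R -> R) : part s (dist_fun 0 1 h w) =
    \int[mu]_(x in D) (fpart s h x * w x).
  by rewrite part_integralC; apply: eq_Rintegral => x _; rewrite /fpart partZr.
have i2 := L2r_integrable (L2r_test tpsi2).
have ipsi := L2r_integrable (L2r_test tpsi).
(* Two derivatives are moved by the weak form of [u_xx], the other two by the Green operator:
   symmetry serves for [m], the reproducing property for the kernel. *)
have h1 : (-1) ^+ 4 * \int[mu]_(x in D) (fpart s U.1 x * derive1n 4 psi x) =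
    \int[mu]_(x in D) (m s x * psi x) + jump (phi s) * psi xi.
  have := (beam_repr_rweak2 s).2 _ tpsi2.
  rewrite !exprS expr0 mulr1 !mulN1r !opprK mul1r => ->.
  have ek : \int[mu]_(x in D) (kern xi x * derive1n 2 psi x) = psi xi.
    by rewrite green_at // (green_test tpsi (ltW xi0)).
  have em : \int[mu]_(x in D) (m s x * psi x) =
      \int[mu]_(x in D) (green (m s) x * derive1n 2 psi x).
    rewrite green_sym //; apply: eq_Rintegral => x.
    rewrite inE /= in_itv /= => /andP[/ltW x0 _]; congr (_ * _).
    exact: esym (green_test tpsi x0).
  have ig := L2r_testM (L2_green (im s)) tpsi2.
  have ik := L2r_testM (L2_kern xi0 xi1) tpsi2.
  rewrite em -{1}ek -RintegralZl // -RintegralD //.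
    by apply: eq_Rintegral => x _; rewrite mulrDl mulrA.
  apply: integrable_ext (L2r_testM (L2rZ (jump (phi s)) (L2_kern xi0 xi1)) tpsi2) => x _ /=.
  by rewrite mulrA.
have xi01 : xi \in `[0, 1] by rewrite in_itv /= !ltW.
have h2 : \int[mu]_(x in D) (fpart s U.2 x * psi x) =
    \int[mu]_(x in D) (green (phi s) x * psi x).
  have Lp := L2r_test tpsi; have Lg := L2_green (iphi s).
  apply: eq_Rintegral_ae; [exact: measurable_funM (LU2 s).1 Lp.1|
    exact: measurable_funM Lg.1 Lp.1|].
  by apply: ae_imp (vg s) => x vx xD; rewrite vx.
have img := L2r_testM (Lm s) tpsi; have igg := L2r_testM (L2_green (iphi s)) tpsi.
have -> : \int[mu]_(x in D) (beam_image s x * psi x) =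
    - a * \int[mu]_(x in D) (m s x * psi x)
    + - b * \int[mu]_(x in D) (green (phi s) x * psi x).
  rewrite -RintegralZl // -RintegralZl // -RintegralD //.
  - by apply: eq_Rintegral => x _; rewrite /beam_image mulrDl !mulrA.
  - apply: integrable_ext (L2r_testM (L2rZ (- a) (Lm s)) tpsi) => x _ /=.
    by rewrite mulrA.
  - apply: integrable_ext (L2r_testM (L2rZ (- b) (L2_green (iphi s))) tpsi) => x _ /=.
    by rewrite mulrA.
rewrite /A_dist /dist_deriv /dist_dirac !(partB, partN) !partZr !partZ part_sign !e h1 h2.
rewrite beam_repr_cont_rep // /jump.
move: (\int[mu]_(x in D) (m s x * psi x)) (\int[mu]_(x in D) _) => A B.
by field; rewrite gt_eqF.
Qed.

Lemma opA_image s : L2 (fpart s (opA a b alpha xi U).2) /\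
  eqr_ae 0 1 (beam_image s) (fpart s (opA a b alpha xi U).2).
Proof.
have wP : [set w | Defs.L2 0 1 w /\ eq_dist 0 1 (A_dist a b alpha xi U) (dist_fun 0 1 w)]
    (opA a b alpha xi U).2.
  apply: (@xgetPex _ (fun=> 0) [set w | Defs.L2 0 1 w /\
    eq_dist 0 1 (A_dist a b alpha xi U) (dist_fun 0 1 w)]).
  exists (mkC beam_image); split.
    by apply/L2P => s'; rewrite fpart_mkC; exact: beam_image_L2.
  move=> psi tpsi; apply: part_eq => s'; rewrite A_dist_image // part_integralC.
  apply: eq_Rintegral => x _; rewrite /fpart partZr.
  by have := congr1 (fun f => f x) (fpart_mkC s' beam_image); rewrite /fpart => ->.
case: wP => /L2P/(_ s) Lw wP; split=> //.
(* A function representing the same distribution is a weak derivative of order 0, so uniqueness of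
   weak derivatives applies. *)
apply: (rweak_unique ltr01 (rweak0 (beam_image_L2 s))); split=> // psi tpsi.
rewrite expr0 mul1r; have := congr1 (part s) (wP psi tpsi).
rewrite A_dist_image // part_integralC => ->.
by apply: eq_Rintegral => x _; rewrite /fpart partZr.
Qed.

Lemma opA_crd : in_H (opA a b alpha xi U) /\ forall s,
  crd s (opA a b alpha xi U) = (cls (phi s), cls (beam_image s)).
Proof.
have [HW WP] := @crd_green _ (opA a b alpha xi U) phi (fun s => (opA_image s).1)
  LU2 Lphi vg.
split=> // s; rewrite WP.
by rewrite (cls_eq (beam_image_L2 s) (opA_image s).1 (opA_image s).2).
Qed.

Lemma crd_opA s : crd s U = T (crd s (opA a b alpha xi U)).
Proof.
have Lg := L2_green (iphi s).
rewrite (beam_repr_in_H).2 (opA_crd).2 /opT /beam_inv /=; congr pair; last first.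
  by rewrite gl_cls // (cls_eq (LU2 s) Lg (vg s)).
have -> : cls (beam_image s) = - a *: cls (m s) + - b *: cls (green (phi s)).
  rewrite -(clsZ _ (Lm s)) -(clsZ _ Lg).
  by rewrite -(clsD (L2rZ (- a) (Lm s)) (L2rZ (- b) Lg)).
rewrite (beam_uxx_cls _ (Lm s)) kap_cls // glD !glZ !(gl_cls (Lm s)).
rewrite !(gl_cls (Lphi s)) !(gl_cls Lg) /jump.
have a_neq0 : a != 0 by rewrite gt_eqF.
exact: beam_coef.
Qed.

End Repr.

End Generator.

(** * From coordinates back to the domain conditions *)

Section GeneratorDomain.
Context {R : realType} (a b alpha xi : R).
Hypotheses (a0 : 0 < a) (xi0 : 0 < xi) (xi1 : xi < 1).
Notation mu := (@lebesgue_measure R).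
Implicit Types (p q x y c d k : R) (s : bool) (h phi : R -> R) (U V W : state R).
Local Notation D := [set` `](0 : R), 1[].
Local Notation L2 := (L2r (0 : R) 1).
Local Notation T := (opT a b alpha xi).
Local Notation X := (@L2space R * @L2space R)%type.

Lemma within_continuousS (p q p' q' : R) h : p <= p' -> q' <= q ->
  {within `[p, q], continuous h} -> {within `[p', q'], continuous h}.
Proof.
move=> pp qq; apply: continuous_subspaceW => x /=; rewrite !in_itv /= => /andP[px xq].
by rewrite (le_trans pp px) (le_trans xq qq).
Qed.

Lemma cst_rweak1 p q k : p < q -> rweak p q 1 (fun=> k) (fun=> 0).
Proof.
move=> pq; apply: (@prim_rweak _ _ _ k) pq (L2r_cst _ _ _) (L2r_cst _ _ _) _.
by apply: eqr_aeW => x _; rewrite prim_eq0 ?addr0.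
Qed.

Lemma kern_rweak_left : rweak 0 xi 1 (kern xi) (fun=> - (1 - xi)).
Proof.
have Lk := L2rS (lexx _) (ltW xi1) (L2_kern xi0 xi1).
apply: (@prim_rweak _ _ _ 0) xi0 Lk (L2r_cst _ _ _) _.
apply: eqr_aeW => x /=; rewrite in_itv /= => /andP[/ltW x0 /ltW xxi].
by rewrite kern_le // prim_cst // add0r.
Qed.

Lemma kern_rweak_right : rweak xi 1 1 (kern xi) (fun=> xi).
Proof.
have Lk := L2rS (ltW xi0) (lexx _) (L2_kern xi0 xi1).
apply: (@prim_rweak _ _ _ (xi * xi - xi)) xi1 Lk (L2r_cst _ _ _) _.
apply: eqr_aeW => x /=; rewrite in_itv /= => /andP[/ltW xix _].
by rewrite kern_ge // /prim Rintegral_cst_itv //; ring.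
Qed.

Section Repr.
Context (U : state R) (phi m : bool -> R -> R) (HU : beam_repr a alpha xi U phi m).

Let Lphi s : L2 (phi s). Proof. by have [] := HU s. Qed.
Let Lm s : L2 (m s). Proof. by have [] := HU s. Qed.
Let LU1 s : L2 (fpart s U.1). Proof. by have [_ _ []] := HU s. Qed.
Let J s : R := jump a alpha xi (phi s).

(** Where the kernel is affine, with slope [k], the two terms of [u_xx] can be differentiated twice
    more. This is applied on either side of [xi]. *)
Lemma beam_repr_piece p q (k : R) : 0 <= p -> p < q -> q <= 1 ->
  rweak p q 1 (kern xi) (fun=> k) ->
  [/\ sobolev 4 p q U.1,
    forall s x, x \in `[p, q] -> part s (cont_rep p q (weak_deriv p q 2 U.1) x) =
      beam_uxx a alpha xi (phi s) (m s) x &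
    forall s x, x \in `[p, q] -> part s (cont_rep p q (weak_deriv p q 3 U.1) x) =
      green_slope (m s) x + J s * k].
Proof.
move=> p0 pq q1 wk.
have im s := L2r_integrable (Lm s).
have Lk := L2rS p0 q1 (L2_kern xi0 xi1).
have w2 s : rweak p q 2 (fpart s U.1) (beam_uxx a alpha xi (phi s) (m s)).
  exact: rweakS p0 q1 (beam_repr_rweak2 xi0 xi1 HU s).
have Lg s : L2r p q (green (m s)) := L2rS p0 q1 (L2_green (im s)).
have Ls s : L2r p q (green_slope (m s)) := L2rS p0 q1 (green_rweak1 (im s)).1.
have w3 s : rweak p q 3 (fpart s U.1) (fun x => green_slope (m s) x + J s * k).
  apply: rweak_comp (w2 s) _; apply: rweakD (Lg s) (L2rZ _ Lk) _ (rweakZ _ Lk wk).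
  exact: rweakS p0 q1 (green_rweak1 (im s)).
have w4 s : rweak p q 4 (fpart s U.1) (fun x => m s x + J s * 0).
  apply: rweak_comp (w3 s) _.
  have Lc := L2r_cst p q k.
  apply: rweakD (Ls s) (L2rZ (J s) Lc) _ (rweakZ (J s) Lc (cst_rweak1 k pq)).
  exact: rweakS p0 q1 (green_slope_rweak1 (Lm s)).
split.
- apply: rweak_sobolev => [s|n s]; first exact: L2rS p0 q1 (LU1 s).
  have w1 : rweak p q 1 (fpart s U.1) (fpart s (weak_deriv 0 1 1 U.1)).
    apply: (rweakS p0 q1); apply: (sobolev_rweak s _ (isT : (1 <= 2)%N)).
    by have [[]] := beam_repr_in_H xi0 xi1 HU.
  move: n => [|[|[|[|[|n]]]]] // _; [by exists (fpart s (weak_deriv 0 1 1 U.1))|..].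
  + by eexists; exact: w2.
  + by eexists; exact: w3.
  + by eexists; exact: w4.
- apply: (cont_repE pq (g := fun s => beam_uxx a alpha xi (phi s) (m s))) => s.
    exact: within_continuousS p0 q1 (beam_uxx_continuous xi0 xi1 (Lm s)).
  exact: (weak_deriv_eq pq w2 s).2.
- apply: (cont_repE pq (g := fun s x => green_slope (m s) x + J s * k)) => s.
    apply: within_continuousD; last exact: within_continuous_cst.
    exact: within_continuousS p0 q1 (green_slope_continuous (im s)).
  exact: (weak_deriv_eq pq w3 s).2.
Qed.

Lemma beam_repr_dom : dom_A a alpha xi U.
Proof.
have im s := L2r_integrable (Lm s); have iphi s := L2r_integrable (Lphi s).
have [HH _] := beam_repr_in_H xi0 xi1 HU.
(* The first component of the generator is [v] itself, so this membership in the energy space gives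
   [v] in H^2. *)
have [HW _] := opA_crd b a0 xi0 xi1 HU.
have [sl l2 l3] := beam_repr_piece (lexx _) xi0 (ltW xi1) kern_rweak_left.
have [sr r2 r3] := beam_repr_piece (ltW xi0) xi1 (lexx _) kern_rweak_right.
have i0 : (0 : R) \in `[0, xi] by rewrite in_itv /= lexx ltW.
have i1 : (1 : R) \in `[xi, 1] by rewrite in_itv /= lexx ltW.
have il : xi \in `[0, xi] by rewrite in_itv /= lexx ltW.
have ir : xi \in `[xi, 1] by rewrite in_itv /= lexx ltW.
have e0 : (0 : R) \in `[0, 1] by rewrite in_itv /= ler01 lexx.
have e1 : (1 : R) \in `[0, 1] by rewrite in_itv /= ler01 lexx.
have exi : xi \in `[0, 1] by rewrite in_itv /= !ltW.
have uE s x : x \in `[0, 1] -> part s (cont_rep 0 1 U.1 x) =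
    green (beam_uxx a alpha xi (phi s) (m s)) x.
  move: s x; pose g s' := green (beam_uxx a alpha xi (phi s') (m s')).
  apply: (cont_repE ltr01 (g := g)) => s'; last by have [_ _ _ _ /eqr_ae_sym] := HU s'.
  exact: green_continuous (L2r_integrable (beam_uxx_L2 a alpha xi0 xi1 (phi s') (Lm s'))).
have vE := beam_repr_cont_rep HU.
split.
- by split=> //; [case: HH|case: HW].
- split; apply: part_eq => s; rewrite part0.
  + by rewrite (uE _ _ e0) green_left.
  + by rewrite (vE _ _ e0) green_left.
  + by rewrite (uE _ _ e1) green_right.
  + by rewrite (vE _ _ e1) green_right.
- split; apply: part_eq => s; rewrite part0.
    by rewrite (l2 _ _ i0) /beam_uxx green_left (kern_left xi0) mulr0 addr0.
  by rewrite (r2 _ _ i1) /beam_uxx green_right (kern_right xi1) mulr0 addr0.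
- by apply: part_eq => s; rewrite (l2 _ _ il) (r2 _ _ ir).
(* The slopes of the kernel at [xi] are [xi] from the right and [- (1 - xi)] from the left. They
   differ by 1, so the jump is exactly [J s]. *)
- apply: part_eq => s; rewrite partB (l3 _ _ il) (r3 _ _ ir).
  have -> : part s (- (alpha / a)%:C%C * cont_rep 0 1 U.2 xi) = J s.
    by rewrite mulNr partN partZ (vE _ _ exi).
  by move: (green_slope _ _) (J s) => F j; ring.
Qed.

End Repr.

Lemma dom_A_crd U : dom_A a alpha xi U ->
  [/\ in_H U, in_H (opA a b alpha xi U) &
      forall s, crd s U = T (crd s (opA a b alpha xi U))].
Proof.
move=> /(dom_beam_repr xi0 xi1)[phi [m HU]]; split.
- exact: (beam_repr_in_H xi0 xi1 HU).1.
- exact: (opA_crd b a0 xi0 xi1 HU).1.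
- exact: (crd_opA b a0 xi0 xi1 HU).
Qed.

(** The converse of [dom_A_crd]: it supplies states of the domain with a prescribed image, both as
    values of solutions and as test states for the adjoint. *)
Lemma st_opT (x : bool -> X) : let U := st (fun s => T (x s)) in
  dom_A a alpha xi U /\ forall s, crd s (opA a b alpha xi U) = x s.
Proof.
move=> U; pose phi s := rep (x s).1.
(* Solves [- a m - b v = (x s).2] for the regular part [m] of the fourth derivative, with
   [v = green (phi s)]. *)
pose m s t := - a^-1 * (rep (x s).2 t + b * green (phi s) t).
have Lphi s : L2 (phi s) := L2_rep _; have Lg s := L2_green (L2r_integrable (Lphi s)).
have Lm s : L2 (m s) by apply/L2rZ/L2rD; [exact: L2_rep|exact: L2rZ].
have a_neq0 : a != 0 by rewrite gt_eqF.
have im s : (fun t => - a * m s t + - b * green (phi s) t) = rep (x s).2.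
  by apply/funext => t; rewrite /m; field.
have cx1 s : cls (phi s) = (x s).1 by exact: cls_rep.
have uxxE s : cls (beam_uxx a alpha xi (phi s) (m s)) = (T (x s)).1.
  rewrite /opT /beam_inv /= beam_uxx_cls // -(gl_cls (Lm s)) /jump.
  have -> : cls (m s) = - a^-1 *: ((x s).2 + b *: gl (x s).1).
    rewrite clsZ; last by apply: L2rD; [exact: L2_rep|exact: L2rZ].
    rewrite clsD; [|exact: L2_rep|exact: L2rZ].
    by rewrite cls_rep clsZ // -(gl_cls (Lphi s)) cx1.
  rewrite glZ glD glZ kapE // [RHS]scalerDr; congr (_ + _).
  by rewrite scalerA; congr (_ *: _); rewrite /phi; field.
have HU : beam_repr a alpha xi U phi m.
  move=> s; have Lq := beam_uxx_L2 a alpha xi0 xi1 (phi s) (Lm s).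
  have rq := rep_cls Lq; rewrite uxxE in rq.
  split; [exact: Lphi|exact: Lm|split|..]; rewrite fpart_mkC.
  - exact/L2_green/rep_int.
  - exact: L2_rep.
  - exact: rep_cls (Lg s).
  - apply: eqr_aeW => t /=; rewrite in_itv /= => /andP[_ /ltW t1].
    exact: eq_green (L2_rep _) Lq rq t1.
split; first exact: (beam_repr_dom HU).
move=> s; rewrite (opA_crd b a0 xi0 xi1 HU).2 cx1 /beam_image im cls_rep.
by case: (x s).
Qed.

End GeneratorDomain.

(** * Solutions *)

Section Curves.
Context {R : realType}.
Notation mu := (@lebesgue_measure R).
Implicit Types (p q x t r d e : R) (f g : R -> R).

Lemma cvg0_within (A : set R) f t : f s @[s --> within A (nbhs t)] --> (0 : R) <->
  forall e, 0 < e -> exists2 d : R, 0 < d &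
    forall s, A s -> `|s - t| <= d -> `|f s| <= e.
Proof.
split=> [/cvgr0Pnorm_le cf e e0|cf].
  have /nbhs_ballP[d /= d0 hd] := cf e e0.
  exists (d / 2) => [|s As sd]; first by rewrite divr_gt0.
  apply: hd As; rewrite /ball /= distrC; apply: le_lt_trans sd _.
  by rewrite ltr_pdivrMr // ltr_pMr // ltr1n.
apply/cvgr0Pnorm_le => e e0; have [d d0 hd] := cf e e0.
apply/nbhs_ballP; exists d => //= s; rewrite /ball /= distrC => sd As.
by apply: hd As (ltW sd).
Qed.

Lemma cvg0_within_dnbhs (A : set R) f t :
  f s @[s --> within A (dnbhs t)] --> (0 : R) <->
  forall e, 0 < e -> exists2 d : R, 0 < d &
    forall s, A s -> s != t -> `|s - t| <= d -> `|f s| <= e.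
Proof.
split=> [/cvgr0Pnorm_le cf e e0|cf].
  have /nbhs_ballP[d /= d0 hd] := cf e e0.
  exists (d / 2) => [|s As st sd]; first by rewrite divr_gt0.
  apply: hd st As; rewrite /ball /= distrC; apply: le_lt_trans sd _.
  by rewrite ltr_pdivrMr // ltr_pMr // ltr1n.
apply/cvgr0Pnorm_le => e e0; have [d d0 hd] := cf e e0.
apply/nbhs_ballP; exists d => //= s; rewrite /ball /= distrC => sd st As.
exact: hd As st (ltW sd).
Qed.

Definition continuous_half f : Prop := forall t e, 0 <= t -> 0 < e ->
  exists2 d : R, 0 < d & forall s, 0 <= s -> `|s - t| <= d -> `|f s - f t| <= e.

Definition derivative_half f g : Prop := forall t e, 0 <= t -> 0 < e ->
  exists2 d : R, 0 < d & forall s, 0 <= s -> `|s - t| <= d ->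
    `|f s - f t - (s - t) * g t| <= e * `|s - t|.

Lemma continuous_half_within p q f : 0 <= p -> continuous_half f ->
  {within `[p, q], continuous f}.
Proof.
move=> p0 cf; apply/subspace_continuousP => x /=; rewrite in_itv /= => /andP[px xq].
apply/cvgrPdist_le => e e0; have [d d0 hd] := cf x e (le_trans p0 px) e0.
apply/nbhs_ballP; exists d => //= s; rewrite /ball /= => sd; rewrite in_itv /= => /andP[ps _].
by rewrite distrC; apply: hd; [exact: le_trans ps|rewrite distrC ltW].
Qed.

Lemma derivative_half_continuous f g : derivative_half f g -> continuous_half f.
Proof.
move=> df t e t0 e0; have [d d0 hd] := df t 1 t0 ltr01.
have c0 : 0 < 1 + `|g t| by rewrite ltr_wpDr.
exists (Num.min d (e / (1 + `|g t|))); first by rewrite lt_min d0 divr_gt0.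
move=> s s0; rewrite le_min => /andP[sd]; rewrite ler_pdivlMr // => se.
have -> : f s - f t = (f s - f t - (s - t) * g t) + (s - t) * g t by rewrite subrK.
apply: le_trans (ler_normD _ _) _; apply: le_trans (lerD (hd s s0 sd) (lexx _)) _.
by rewrite normrM mul1r -[X in X + _]mulr1 -mulrDr.
Qed.

Lemma derivative_half_derive f g t : derivative_half f g -> 0 < t ->
  derivable f t 1 /\ derive1 f t = g t.
Proof.
move=> df t0.
have cf : h^-1 *: (f (h + t) - f t) @[h --> 0^'] --> g t.
  apply/cvgrPdist_le => e e0; have [d d0 hd] := df t e (ltW t0) e0.
  apply/nbhs_ballP; exists (Num.min d t); first by rewrite /= lt_min d0.
  move=> h /=; rewrite /ball /= sub0r normrN lt_min => /andP[hd' ht] h0.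
  have ht0 : 0 <= h + t by have := ler_norm (- h); rewrite normrN; lra.
  have := hd (h + t) ht0; rewrite addrK => /(_ (ltW hd')).
  have h0' : 0 < `|h| by rewrite normr_gt0.
  have -> : f (h + t) - f t - h * g t = - h * (g t - h^-1 *: (f (h + t) - f t)).
    by rewrite /GRing.scale /=; field.
  by rewrite normrM normrN mulrC ler_pM2r.
split; last exact: (cvg_lim (@Rhausdorff R) cf).
apply/cvg_ex; exists (g t); apply: cvg_trans cf; apply: near_eq_cvg; near=> h.
by rewrite /= [h *: 1]mulr1.
Unshelve. all: by end_near.
Qed.

Lemma derivative_half_prim f g : derivative_half f g -> continuous_half g ->
  forall t, 0 <= t -> f t = f 0 + prim 0 g t.
Proof.
move=> df cg t; rewrite le_eqVlt => /predU1P[<-|t0]; first by rewrite prim_left addr0.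
have cw : {within `[0, t], continuous g} := continuous_half_within (lexx 0) cg.
have cf : {within `[0, t], continuous f} :=
  continuous_half_within (lexx 0) (derivative_half_continuous df).
have [_ cl cr] := (continuous_within_itvP f t0).1 cf.
have mg := continuous_measurable_oo cw.
rewrite /prim /Rintegral integral_itv_bndo_bndc; last exact/measurable_EFinP.
rewrite integral_itv_obnd_cbnd; last exact/measurable_EFinP/measurable_fun_itv_bndo_bndcP.
rewrite (continuous_FTC2 t0 cw (F := f)).
- by rewrite -EFinB /= addrC subrK.
- by split=> // x; rewrite in_itv /= => /andP[x0 _]; case: (derivative_half_derive df x0).
- by move=> x; rewrite in_itv /= => /andP[x0 _]; case: (derivative_half_derive df x0).
Qed.

Lemma prim_le_cst p q f k : p <= q -> {within `[p, q], continuous f} ->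
  (forall x, p <= x <= q -> f x <= k) -> prim p f q <= k * (q - p).
Proof.
move=> pq cf fk; rewrite -Rintegral_cst_itv //; apply: le_Rintegral => //.
- exact/L2r_integrable/L2r_continuous.
- exact/L2r_integrable/L2r_cst.
- by move=> x /=; rewrite in_itv /= => /andP[px xq]; apply: fk; rewrite !ltW.
Qed.

Context {X : lmodType R} (ip : X -> X -> R).
Hypothesis H : hilbert ip.
Implicit Types (Y Z : R -> X) (w : X).

Lemma curve_continuous_ip Z w : curve_continuous ip Z ->
  continuous_half (fun t => ip (Z t) w).
Proof.
move=> cZ t e t0 e0; have w0 : 0 < 1 + nrm ip w by rewrite ltr_pwDl ?sqrtr_ge0.
have [d d0 hd] := cZ t (e / (1 + nrm ip w)) t0 (divr_gt0 e0 w0).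
exists d => // s s0 sd; rewrite -(ipBl H); apply: le_trans (cauchy_schwarz H _ _) _.
have := hd s s0 sd; rewrite ler_pdivlMr //; apply: le_trans.
by rewrite ler_wpM2l ?sqrtr_ge0 // lerDr.
Qed.

Lemma curve_derivative_ip Y Z w : curve_derivative ip Y Z ->
  derivative_half (fun t => ip (Y t) w) (fun t => ip (Z t) w).
Proof.
move=> dY t e t0 e0; have w0 : 0 < 1 + nrm ip w by rewrite ltr_pwDl ?sqrtr_ge0.
have [d d0 hd] := dY t (e / (1 + nrm ip w)) t0 (divr_gt0 e0 w0).
exists d => // s s0 sd; rewrite -(ipBl H) -(ipZl H) -(ipBl H).
apply: le_trans (cauchy_schwarz H _ _) _; have := hd s s0 sd.
rewrite mulrAC ler_pdivlMr //; apply: le_trans.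
by rewrite ler_wpM2l ?sqrtr_ge0 // lerDr.
Qed.

(** The weak identity becomes a norm estimate when tested with the very vector [w] to be estimated:
    [|w|^2 <= (t - s) M |w|]. Hence [Y] is a primitive of [Z] and, [Z] being continuous,
    differentiable in norm. *)
Lemma weak_curve_primitive Y Z : curve_continuous ip Z ->
  (forall w t, 0 <= t -> ip (Y t) w = ip (Y 0) w + prim 0 (fun s => ip (Z s) w) t) ->
  curve_derivative ip Y Z.
Proof.
move=> cZ hY; apply: (curve_primitive_derivative H) (cZ).
move=> s t c M s0 st hM; set w := _ - _ - _; have t0 := le_trans s0 st.
have cw : continuous_half (fun r => ip (Z r) w) := curve_continuous_ip w cZ.
have M0 : 0 <= M by apply: le_trans (hM s _); rewrite ?sqrtr_ge0 // lexx.
have iw : mu.-integrable `]0, t[ (EFin \o (fun r => ip (Z r) w)).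
  exact/L2r_integrable/L2r_continuous/continuous_half_within.
have dY : ip (Y t - Y s) w = prim s (fun r => ip (Z r) w) t.
  rewrite (ipBl H) (hY w t t0) (hY w s s0) (prim_split s0 st (lexx t) iw).
  by rewrite opprD addrACA subrr add0r addrAC subrr add0r.
have le1 : prim s (fun r => ip (Z r) w) t <= (ip c w + M * nrm ip w) * (t - s).
  apply: prim_le_cst => //; first exact: continuous_half_within.
  move=> r /hM hr; have -> : ip (Z r) w = ip c w + ip (Z r - c) w by rewrite (ipBl H); ring.
  rewrite lerD2l; apply: le_trans (ip_le_nrm H _ _) _.
  by rewrite ler_wpM2r ?sqrtr_ge0.
have ww : ip w w <= (t - s) * M * nrm ip w.
  rewrite {1}/w (ipBl H) (ipZl H) dY; move: le1; move: (ip c w) (prim _ _ _) => u v.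
  by rewrite mulrDl; lra.
have [w0|w0] := leP (nrm ip w) 0.
  by apply: le_trans w0 _; rewrite mulr_ge0 // subr_ge0.
by rewrite -(ler_pM2r w0) -expr2 (nrm_sqr H).
Qed.

End Curves.

Lemma subr_subACA (V : zmodType) (x y z w : V) : x - y - (z - w) = x - z - (y - w).
Proof. by rewrite !opprB addrACA [- y + _]addrC [w - y]addrC addrACA [- y + w]addrC. Qed.

Lemma remainderB (K : pzRingType) (V : lmodType K) (k : K) (x y z w u v : V) :
  x - z - (y - w) - k *: (u - v) = (x - y - k *: u) - (z - w - k *: v).
Proof.
rewrite scalerBr (subr_subACA x z y w).
by rewrite (subr_subACA (x - y) (z - w) (k *: u) (k *: v)).
Qed.

Lemma sub_shift (R : pzRingType) (x d y1 y2 c1 c2 p1 p2 q : R) : x = y1 - y2 ->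
  d = c1 - c2 -> y1 = c1 + p1 -> y2 = c2 + p2 -> q = p1 - p2 -> x = d + q.
Proof. by move=> -> -> -> -> ->; rewrite opprD addrACA. Qed.

Lemma add_shift (R : pzRingType) (x d y1 y2 c1 c2 p1 p2 q : R) : x = y1 + y2 ->
  d = c1 + c2 -> y1 = c1 + p1 -> y2 = c2 + p2 -> q = p1 + p2 -> x = d + q.
Proof. by move=> -> -> -> -> ->; rewrite addrACA. Qed.

Section CurveExt.
Context {R : realType} {X : lmodType R} (ip : X -> X -> R).

Lemma curve_continuous_ext (Y Y' : R -> X) : (forall t, 0 <= t -> Y t = Y' t) ->
  curve_continuous ip Y -> curve_continuous ip Y'.
Proof.
move=> YY cY t e t0 e0; have [d d0 hd] := cY t e t0 e0; exists d => // r r0 rd.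
by rewrite -!YY // hd.
Qed.

Lemma curve_derivative_ext (Y Y' Z Z' : R -> X) : (forall t, 0 <= t -> Y t = Y' t) ->
  (forall t, 0 <= t -> Z t = Z' t) -> curve_derivative ip Y Z -> curve_derivative ip Y' Z'.
Proof.
move=> YY ZZ dY t e t0 e0; have [d d0 hd] := dY t e t0 e0; exists d => // r r0 rd.
by rewrite -!YY // -ZZ // hd.
Qed.

End CurveExt.

(** * Strong and weak solutions as curves in coordinates *)

Section Evolution.
Context {R : realType} (a b alpha xi : R).
Hypotheses (a0 : 0 < a) (b0 : 0 < b) (alpha0 : 0 < alpha).
Hypotheses (xi0 : 0 < xi) (xi1 : xi < 1).
Notation mu := (@lebesgue_measure R).
Implicit Types (t r d e : R) (s : bool).
Local Notation X := (@L2space R * @L2space R)%type.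
Local Notation T := (opT a b alpha xi).
Local Notation ip := (ipH a).
Local Notation A := (opA a b alpha xi).
Local Notation hilb := (hilbert_H a0).

Lemma opT_bounded : exists2 K : R, 0 <= K & forall x, nrm ip (T x) <= K * nrm ip x.
Proof.
exact: (dinv_bounded (beam_inv_dissipative (kap xi) (@hilbert_L2 R) a0 b0 alpha0
  (@glD R) (@glZ R) (@gl_sym R) (@gl_inj R) (@gl_bounded R))).
Qed.

Lemma opT_curve_continuous (Z : R -> X) : curve_continuous ip Z ->
  curve_continuous ip (fun t => T (Z t)).
Proof.
move=> cZ t e t0 e0; have [K K0 hK] := opT_bounded.
have K1 : 0 < 1 + K by rewrite ltr_pwDl.
have [d d0 hd] := cZ t (e / (1 + K)) t0 (divr_gt0 e0 K1).
exists d => // r r0 rd; rewrite -opTB; apply: le_trans (hK _) _.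
have := hd r r0 rd; rewrite ler_pdivlMr // mulrC; apply: le_trans.
by rewrite ler_wpM2r ?sqrtr_ge0 // lerDr.
Qed.

Lemma opT_curve_unique (Y Z : R -> X) :
  curve_derivative ip (fun t => T (Y t)) Y -> curve_derivative ip (fun t => T (Z t)) Z ->
  T (Y 0) = T (Z 0) -> forall t, 0 <= t -> Y t = Z t.
Proof.
move=> dY dZ YZ0 t t0; apply/eqP; rewrite -subr_eq0; apply/eqP.
apply: (opT_flow_unique a0 b0 alpha0 (Z := fun t => Y t - Z t) (xi := xi)) t0; last first.
  by rewrite opTB YZ0 subrr.
move=> {}t e t0 e0; have e2 : 0 < e / 2 by rewrite divr_gt0.
have [d1 d10 h1] := dY t _ t0 e2; have [d2 d20 h2] := dZ t _ t0 e2.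
exists (Num.min d1 d2); first by rewrite lt_min d10.
move=> r r0; rewrite le_min => /andP[r1 r2]; rewrite !opTB.
have -> : T (Y r) - T (Z r) - (T (Y t) - T (Z t)) - (r - t) *: (Y t - Z t) =
    (T (Y r) - T (Y t) - (r - t) *: Y t) - (T (Z r) - T (Z t) - (r - t) *: Z t).
  exact: remainderB.
apply: le_trans (nrmB hilb _ _) _; rewrite [X in X * _](splitr e) mulrDl.
by apply: lerD; [exact: h1|exact: h2].
Qed.

Lemma norm_H_cvg (W : R -> state R) (Y : bool -> R -> X) t : 0 <= t ->
  (forall r, 0 <= r -> in_H (W r) /\ forall s, crd s (W r) = Y s r - Y s t) ->
  (forall s, curve_continuous ip (Y s)) ->
  norm_H a (W r) @[r --> within [set r | 0 <= r] (nbhs t)] --> (0 : R).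
Proof.
move=> t0 HW cY; apply/cvg0_within => e e0; have e2 : 0 < e / 2 by rewrite divr_gt0.
have [d1 d10 h1] := cY false t _ t0 e2; have [d2 d20 h2] := cY true t _ t0 e2.
exists (Num.min d1 d2); first by rewrite lt_min d10.
move=> r /= r0; rewrite le_min => /andP[r1 r2]; have [HWr WP] := HW r r0.
rewrite ger0_norm ?sqrtr_ge0 //; apply: le_trans (norm_H_crd a0 HWr).2 _.
by rewrite (WP false) (WP true) (splitr e); exact: lerD (h1 r r0 r1) (h2 r r0 r2).
Qed.

Lemma continuous_curve_crd (U : R -> state R) : (forall t, 0 <= t -> in_H (U t)) ->
  continuous_curve (norm_H a) U <-> forall s, curve_continuous ip (fun t => crd s (U t)).
Proof.
move=> HU; split=> [cU s t e t0 e0|cU t t0].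
  have [d d0 hd] := (cvg0_within _ _ _).1 (cU t t0) e e0.
  exists d => // r r0 rd; have [HW WP] := diff_crd (HU r r0) (HU t t0).
  rewrite -WP; apply: le_trans (hd r r0 rd).
  by apply: le_trans ((norm_H_crd a0 HW).1 s) _; exact: ler_norm.
apply: (norm_H_cvg (W := fun r => U r - U t) (Y := fun s t => crd s (U t)) t0) cU.
by move=> r r0; exact: diff_crd (HU r r0) (HU t t0).
Qed.

Lemma derivative_curve_crd (U dU : R -> state R) : (forall t, 0 <= t -> in_H (U t)) ->
  (forall t, 0 <= t -> in_H (dU t)) ->
  derivative_curve (norm_H a) U dU <->
  forall s, curve_derivative ip (fun t => crd s (U t)) (fun t => crd s (dU t)).
Proof.
move=> HU HdU.
have dqP r t : 0 <= r -> 0 <= t -> r != t ->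
    in_H (difference_quotient U t r - dU t) /\ forall s,
    nrm ip (crd s (U r) - crd s (U t) - (r - t) *: crd s (dU t)) =
    `|r - t| * nrm ip (crd s (difference_quotient U t r - dU t)).
  move=> r0 t0 rt; have rt0 : r - t != 0 by rewrite subr_eq0.
  have [HQ QP] := scaled_diff_crd (r - t)^-1 (HU r r0) (HU t t0).
  have [HD DP] := diff_crd HQ (HdU t t0); split=> // s.
  rewrite DP QP -(nrmZ hilb); congr (nrm _ _).
  by rewrite scalerBr scalerA divff // scale1r.
split=> [dU1 s t e t0 e0|dU1 t t0].
  have [d d0 hd] := (cvg0_within_dnbhs _ _ _).1 (dU1 t t0) e e0.
  exists d => // r r0 rd; have [->|rt] := eqVneq r t.
    by rewrite !subrr scale0r subrr (nrm0 hilb) normr0 mulr0.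
  have [HD ->] := dqP r t r0 t0 rt; rewrite mulrC ler_wpM2r //.
  apply: le_trans (hd r r0 rt rd).
  by apply: le_trans ((norm_H_crd a0 HD).1 s) _; exact: ler_norm.
apply/cvg0_within_dnbhs => e e0; have e2 : 0 < e / 2 by rewrite divr_gt0.
have [d1 d10 h1] := dU1 false t _ t0 e2; have [d2 d20 h2] := dU1 true t _ t0 e2.
exists (Num.min d1 d2); first by rewrite lt_min d10.
move=> r /= r0 rt; rewrite le_min => /andP[r1 r2]; have [HD DP] := dqP r t r0 t0 rt.
have rt0 : 0 < `|r - t| by rewrite normr_gt0 subr_eq0.
rewrite ger0_norm ?sqrtr_ge0 //; apply: le_trans (norm_H_crd a0 HD).2 _.
have le_half s : nrm ip (crd s (U r) - crd s (U t) - (r - t) *: crd s (dU t)) <=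
    e / 2 * `|r - t| -> nrm ip (crd s (difference_quotient U t r - dU t)) <= e / 2.
  by rewrite DP mulrC ler_pM2r.
by rewrite (splitr e); exact: lerD (le_half _ (h1 r r0 r1)) (le_half _ (h2 r r0 r2)).
Qed.

(** The graph norm applies the generator to differences of states, which are not given in the form
    [st]. Since [beam_repr] is invariant under equality almost everywhere, the coordinates of such a
    state decide its image. *)
Lemma opA_crd_eq (W : state R) (x : bool -> X) : in_H W ->
  (forall s, crd s W = T (x s)) -> in_H (A W) /\ forall s, crd s (A W) = x s.
Proof.
move=> HW WP; have [dW' W'P] := st_opT b alpha a0 xi0 xi1 x.
set W' := st (fun s => T (x s)) in dW' W'P.
have [HW' cW'] := st_crd (fun s => T (x s)).
have WW' : eq_H W W' by apply: crd_eq => // s; rewrite WP cW'.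
have [/eq_aeP WW1 /eq_aeP WW2] := WW'.
have [phi [m rW']] := dom_beam_repr xi0 xi1 dW'.
have rW : beam_repr a alpha xi W phi m.
  move=> s; have [h1 h2 _ h3 h4] := rW' s; have [l1 l2 _ _] := in_H_green s HW.
  split; [exact: h1|exact: h2|exact: conj l1 l2|exact: eqr_ae_trans (WW2 s) h3|].
  exact: eqr_ae_trans (WW1 s) h4.
have [HAW AW] := opA_crd b a0 xi0 xi1 rW; split; first exact: HAW.
by move=> s; rewrite AW -W'P (opA_crd b a0 xi0 xi1 rW').2.
Qed.

Lemma strong_solution_crd U0 (V : R -> state R) : dom_A a alpha xi U0 ->
  strong_solution a b alpha xi U0 V -> forall s,
  [/\ forall t, 0 <= t -> crd s (V t) = T (crd s (A (V t))),
      curve_derivative ip (fun t => T (crd s (A (V t)))) (fun t => crd s (A (V t))) &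
      T (crd s (A (V 0))) = crd s U0].
Proof.
move=> dU0 [dV _ [dU [HdU _ dVdU dUA]] V0] s.
have [HU0 _ _] := dom_A_crd b a0 xi0 xi1 dU0.
have HV t : 0 <= t -> in_H (V t) by move=> /dV /(dom_A_crd b a0 xi0 xi1)[].
have HAV t : 0 <= t -> in_H (A (V t)) by move=> /dV /(dom_A_crd b a0 xi0 xi1)[].
have VT t : 0 <= t -> crd s (V t) = T (crd s (A (V t))).
  by move=> /dV /(dom_A_crd b a0 xi0 xi1)[].
split; [exact: VT| |].
  2: by rewrite -(VT 0 (lexx 0)); exact: eq_H_crd (HV 0 (lexx 0)) HU0 V0 s.
apply: curve_derivative_ext ((derivative_curve_crd HV HdU).1 dVdU s); first exact: VT.
by move=> t t0; exact: (eq_H_crd (HdU t t0) (HAV t t0) (dUA t t0)).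
Qed.

Lemma strong_solution_unique U0 (U V : R -> state R) : dom_A a alpha xi U0 ->
  strong_solution a b alpha xi U0 U -> strong_solution a b alpha xi U0 V ->
  forall t, 0 <= t -> eq_H (V t) (U t).
Proof.
move=> dU0 sU sV t t0.
have [HU _ _] : [/\ in_H (U t), True & True].
  by case: sU => dU _ _ _; have [] := dom_A_crd b a0 xi0 xi1 (dU t t0).
have [HV _ _] : [/\ in_H (V t), True & True].
  by case: sV => dV _ _ _; have [] := dom_A_crd b a0 xi0 xi1 (dV t t0).
apply: crd_eq => // s.
have [UT dU U00] := strong_solution_crd dU0 sU s.
have [VT dV V00] := strong_solution_crd dU0 sV s.
have VU0 : T (crd s (A (V 0))) = T (crd s (A (U 0))) := etrans V00 (esym U00).
have VU := opT_curve_unique dV dU VU0 t0.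
exact: etrans (VT t t0) (etrans (congr1 T VU) (esym (UT t t0))).
Qed.

Lemma strong_solution_exists U0 : dom_A a alpha xi U0 ->
  exists U, strong_solution a b alpha xi U0 U.
Proof.
move=> dU0; have [HU0 HAU0 U0T] := dom_A_crd b a0 xi0 xi1 dU0.
(* Starting at the coordinates of [A U0] makes [T Z] start at those of [U0]. *)
have /choice[Z ZP] s := opT_flow_exists xi a0 b0 alpha0 (crd s (A U0)).
have cZ s : curve_continuous ip (Z s) by have [] := ZP s.
have [U [UE dU]] : exists U : R -> state R,
    (forall s t, crd s (U t) = T (Z s t)) /\
    forall t, dom_A a alpha xi (U t) /\ forall s, crd s (A (U t)) = Z s t.
  exists (fun t => st (fun s => T (Z s t))); split=> [s t|t].
    exact: (st_crd (fun s => T (Z s t))).2.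
  have [h1 h2] := st_opT b alpha a0 xi0 xi1 (fun s => Z s t).
  by split; [exact: h1|exact: h2].
have HAU t : in_H (A (U t)) by have [] := dom_A_crd b a0 xi0 xi1 (dU t).1.
have HU t : in_H (U t) by have [] := dom_A_crd b a0 xi0 xi1 (dU t).1.
exists U.
split.
- by move=> t _; exact: (dU t).1.
- move=> t t0; rewrite -[X in _ --> X](addr0 0).
  have dWP r := diff_crd (HU r) (HU t).
  have AWP r : in_H (A (U r - U t)) /\ forall s, crd s (A (U r - U t)) = Z s r - Z s t.
    apply: opA_crd_eq (dWP r).1 _ => s; rewrite (dWP r).2 (UE s r) (UE s t).
    exact: esym (opTB _ _ _ _ _ _).
  (* The two terms of the graph norm correspond to the continuity of [T Z] and of [Z]. *)
  apply: cvgD.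
    apply: (norm_H_cvg (W := fun r => U r - U t) (Y := fun s t => T (Z s t)) t0) => [r r0|s].
      by split=> [|s]; [exact: (dWP r).1|rewrite (dWP r).2 (UE s r) (UE s t)].
    exact: opT_curve_continuous.
  by apply: (norm_H_cvg (W := fun r => A (U r - U t)) (Y := Z) t0) => // r _; exact: AWP.
- exists (fun t => A (U t)); split.
  + by move=> t _; exact: HAU.
  + apply/continuous_curve_crd => [t _|s]; first exact: HAU.
    by apply: curve_continuous_ext (cZ s) => t _; exact: esym ((dU t).2 s).
  + apply/derivative_curve_crd => [t _|t _|s]; [exact: HU|exact: HAU|].
    have [_ _ dZ] := ZP s; apply: curve_derivative_ext dZ => t _.
      exact: esym (UE s t).
    exact: esym ((dU t).2 s).
  + by move=> t _; split; apply/eq_aeP => s; exact: eqr_ae_refl.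
- apply: crd_eq (HU 0) HU0 _ => s; have [Z0 _ _] := ZP s.
  exact: etrans (UE s 0) (etrans (congr1 T Z0) (esym (U0T s))).
Qed.

(** A test state with zero imaginary part picks out the part [s] of [U], which decouples the complex
    identities. *)
Lemma part_inner_H_real (U : state R) (x : X) s : in_H U ->
  part s (inner_H a U (st (fun s => if s then 0 else x))) = ip (crd s U) x.
Proof.
move=> HU; have [HX XP] := st_crd (fun s => if s then 0 else x).
rewrite (inner_H_crd a HU HX) (XP false) (XP true) !(ip0r hilb).
by case: s; rewrite [LHS]/= ?subr0 ?addr0.
Qed.

(* Every [w] is of the form [A^* V]: testing with such [V] turns the weak
   formulation into [d/dt (T U) = U]. *)
Lemma adjoint_test (w : X) :
  let V := st (fun s => if s then 0 else opTadj a b alpha xi w) in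
  let W := st (fun s => if s then 0 else w) in adjoint_A a b alpha xi V W.
Proof.
move=> V W; have [HV _] := st_crd (fun s => if s then 0 else opTadj a b alpha xi w).
have [HW _] := st_crd (fun s => if s then 0 else w).
split; [exact: HV|exact: HW|move=> Y dY].
have [HY HAY YT] := dom_A_crd b a0 xi0 xi1 dY; apply: part_eq => s.
rewrite (part_inner_H_real _ _ HAY) (part_inner_H_real _ _ HY) (YT s).
by rewrite (ipC hilb) -(opT_adj b alpha xi a0) (ipC hilb).
Qed.

(** Testing with a state [Y] of coordinates [T x], whose image under the generator has coordinates
    [x], shows that [x] paired with [V] equals [T x] paired with [W]. The two equations are the real
    and imaginary parts of this. *)
Lemma adjoint_crd (V W : state R) : adjoint_A a b alpha xi V W ->
  forall x : bool -> X,
  ip (x false) (crd false V) + ip (x true) (crd true V) =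
    ip (T (x false)) (crd false W) + ip (T (x true)) (crd true W) /\
  ip (x true) (crd false V) - ip (x false) (crd true V) =
    ip (T (x true)) (crd false W) - ip (T (x false)) (crd true W).
Proof.
move=> [HV HW VW] x; have [dY YP] := st_opT b alpha a0 xi0 xi1 x.
have [HY HAY YT] := dom_A_crd b a0 xi0 xi1 dY.
have := VW _ dY; rewrite (inner_H_crd a HAY HV) (inner_H_crd a HY HW) !YT !YP => e.
exact: conj (congr1 (@complex.Re R) e) (congr1 (@complex.Im R) e).
Qed.

Lemma weak_solution_crd U0 (V : R -> state R) : in_H U0 ->
  weak_solution a b alpha xi U0 V -> forall s,
  crd s (V 0) = crd s U0 /\
  curve_derivative ip (fun t => T (crd s (V t))) (fun t => crd s (V t)).
Proof.
move=> HU0 [HV cV wV V0] s.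
have V0E s' : crd s' (V 0) = crd s' U0 := eq_H_crd (HV 0 (lexx 0)) HU0 V0 s'.
split; first exact: V0E.
apply: (weak_curve_primitive hilb); first exact: (continuous_curve_crd HV).1 cV s.
move=> w t t0; rewrite V0E.
have adj x : ip x (opTadj a b alpha xi w) = ip (T x) w.
  by rewrite (ipC hilb) -(opT_adj b alpha xi a0) (ipC hilb).
have e := etrans (congr1 (part s) (wV _ _ (adjoint_test w) t t0)) (partD s _ _).
have e1 := etrans (part_inner_H_real (opTadj a b alpha xi w) s (HV t t0)) (adj _).
have e2 := etrans (part_inner_H_real (opTadj a b alpha xi w) s HU0) (adj _).
apply: etrans (esym e1) (etrans e _); apply: (congr2 (fun u v : R => u + v) e2).
apply: etrans (part_integralC _ _ _) _; apply: eq_Rintegral => r.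
rewrite inE /= in_itv /= => /andP[/ltW r0 _]; exact: part_inner_H_real (HV r r0).
Qed.

Lemma weak_solution_unique U0 (U V : R -> state R) : in_H U0 ->
  weak_solution a b alpha xi U0 U -> weak_solution a b alpha xi U0 V ->
  forall t, 0 <= t -> eq_H (V t) (U t).
Proof.
move=> HU0 wU wV t t0; have HU : in_H (U t) by case: wU => /(_ t t0).
have HV : in_H (V t) by case: wV => /(_ t t0).
apply: crd_eq => // s.
have [U00 dU] := weak_solution_crd HU0 wU s; have [V00 dV] := weak_solution_crd HU0 wV s.
exact: (opT_curve_unique dV dU (congr1 T (etrans V00 (esym U00))) t0).
Qed.

Lemma weak_solution_exists U0 : in_H U0 -> exists U, weak_solution a b alpha xi U0 U.
Proof.
move=> HU0.
have /choice[Z ZP] s := opT_flow_exists xi a0 b0 alpha0 (crd s U0).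
have cZ s : curve_continuous ip (Z s) by have [] := ZP s.
have dZ s : curve_derivative ip (fun t => T (Z s t)) (Z s) by have [] := ZP s.
have Z0 s : Z s 0 = crd s U0 by have [] := ZP s.
have [U [HU UE]] : exists U : R -> state R,
    (forall t, in_H (U t)) /\ forall s t, crd s (U t) = Z s t.
  exists (fun t => st (Z^~ t)); split=> [t|s t]; first exact: (st_crd (Z^~ t)).1.
  exact: (st_crd (Z^~ t)).2.
exists U; split.
- by move=> t _; exact: HU.
- apply/continuous_curve_crd => [t _|s]; first exact: HU.
  by apply: curve_continuous_ext (cZ s) => t _; exact: esym (UE s t).
- move=> V W VW t t0; have [HV HW _] := VW.
  have adj := adjoint_crd VW.
  (* The real pairings into which the complex inner products split; each [y] is its initial value
     plus the integral of the continuous function [z]. *)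
  pose y s s' r := ip (T (Z s r)) (crd s' W); pose z s s' r := ip (Z s r) (crd s' W).
  have yz s s' : y s s' t = ip (T (crd s U0)) (crd s' W) + prim 0 (z s s') t.
    rewrite -(Z0 s); exact: (derivative_half_prim (curve_derivative_ip hilb _ (dZ s))
      (curve_continuous_ip hilb _ (cZ s)) t0).
  have iz s s' : mu.-integrable `]0, t[ (EFin \o z s s').
    exact: L2r_integrable (L2r_continuous (continuous_half_within (lexx 0)
      (curve_continuous_ip hilb _ (cZ s)))).
  have [a1 a2] := adj (Z^~ t); have [a3 a4] := adj (crd^~ U0).
  have eU := inner_H_crd a (HU t) HV; rewrite !UE in eU.
  have eU0 := inner_H_crd a HU0 HV.
  have zE s r : fpart s (fun r => inner_H a (U r) W) r =
      if s then z true false r - z false true r else z false false r + z true true r.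
    by rewrite /fpart (inner_H_crd a (HU r) HW) !UE /z; case: s.
  have pD f g : mu.-integrable `]0, t[ (EFin \o f) -> mu.-integrable `]0, t[ (EFin \o g) ->
      \int[mu]_(r in `]0, t[) (f r + g r) = prim 0 f t + prim 0 g t.
    by move=> if_ ig; exact: RintegralD.
  have pB f g : mu.-integrable `]0, t[ (EFin \o f) -> mu.-integrable `]0, t[ (EFin \o g) ->
      \int[mu]_(r in `]0, t[) (f r - g r) = prim 0 f t - prim 0 g t.
    by move=> if_ ig; exact: RintegralB.
  have eI s : part s (integralC `]0, t[ (fun r => inner_H a (U r) W)) =
      \int[mu]_(r in `]0, t[) (if s then z true false r - z false true r
                               else z false false r + z true true r).
    by apply: etrans (part_integralC _ _ _) _; apply: eq_Rintegral => r _; exact: zE.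
  rewrite eU eU0; apply: part_eq => s; apply: etrans _ (esym (partD s _ _)).
  case: s.
    apply: (sub_shift a2 a4 (yz _ _) (yz _ _)).
    exact: etrans (eI true) (pB _ _ (iz _ _) (iz _ _)).
  apply: (add_shift a1 a3 (yz _ _) (yz _ _)).
  exact: etrans (eI false) (pD _ _ (iz _ _) (iz _ _)).
- by apply: crd_eq (HU 0) HU0 _ => s; rewrite UE Z0.
Qed.

End Evolution.

Local Close Scope classical_set_scope.

Theorem theorem2p3 (R : realType) (a b alpha xi : R)
    (a_gt0 : 0 < a) (b_gt0 : 0 < b) (alpha_gt0 : 0 < alpha)
    (xi_gt0 : 0 < xi) (xi_lt1 : xi < 1) :
  (forall U0 : state R, dom_A a alpha xi U0 ->
     exists U : R -> state R,
       strong_solution a b alpha xi U0 U /\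
       (forall V : R -> state R, strong_solution a b alpha xi U0 V ->
          forall t, 0 <= t -> eq_H (V t) (U t)))
  /\
  (forall U0 : state R, in_H U0 ->
     exists U : R -> state R,
       weak_solution a b alpha xi U0 U /\
       (forall V : R -> state R, weak_solution a b alpha xi U0 V ->
          forall t, 0 <= t -> eq_H (V t) (U t))).
Proof.
split=> U0 U0P.
  have [U sU] := strong_solution_exists a_gt0 b_gt0 alpha_gt0 xi_gt0 xi_lt1 U0P.
  exists U; split=> [|V sV]; first exact: sU.
  exact: (strong_solution_unique a_gt0 b_gt0 alpha_gt0 xi_gt0 xi_lt1 U0P sU sV).
have [U wU] := weak_solution_exists a_gt0 b_gt0 alpha_gt0 xi_gt0 xi_lt1 U0P.
exists U; split=> [|V wV]; first exact: wU.
exact: (weak_solution_unique a_gt0 b_gt0 alpha_gt0 xi_gt0 xi_lt1 U0P wU wV).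
Qed.
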